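(* Let $\mathcal G$ be a star graph with only external edges, i.e. $\mathcal I=\emptyset$, with finite set of external edges $\mathcal E$, $d=|\mathcal E|$, and let $A,B\in\mathbb C^{d\times d}$. Then $-\Delta(A,B)$ is similar to a self-adjoint operator if and only if all of the following hold: $A,B$ define quasi-sectorial boundary conditions; the matrix $L$ in the quasi-Weierstrass normal form satisfies $$\sigma(L)\subset\{z\in\mathbb C:\operatorname{Re}z<0\}\cup[0,\infty);$$ and for each $l\in\sigma(L)\cap[0,\infty)$ the algebraic and geometric multiplicities of $l$ as an eigenvalue of $L$ agree.
   Context: The star graph $\mathcal G$ consists of $d=|\mathcal E|$ copies of $[0,\infty)$ glued together at their origins; $L^2(\mathcal G)=\bigoplus_{e\in\mathcal E}L^2([0,\infty);\mathbb C)$, $H^2(\mathcal G)=\bigoplus_{e\in\mathcal E}H^2([0,\infty);\mathbb C)$. For $\psi\in H^2(\mathcal G)$ put $\underline\psi=\{\psi_e(0)\}_{e\in\mathcal E}\in\mathbb C^d$ and $\underline\psi'=\{\psi'_e(0)\}_{e\in\mathcal E}\in\mathbb C^d$. For $A,B\in\mathbb C^{d\times d}$ the operator $\Delta(A,B)$ in $L^2(\mathcal G)$ is $\Delta(A,B)\psi=\psi''$ (edgewise) with domain $\{\psi\in H^2(\mathcal G):A\underline\psi+B\underline\psi'=0\}$. An operator $T$ in a Hilbert space is similar to a self-adjoint operator if there is a bounded operator $\Phi$ with bounded inverse such that $\Phi T\Phi^{-1}$ is self-adjoint. The boundary conditions defined by $A,B$ are called regular if $\mathrm{Rank}(A\ B)=d$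 and $\det(A+\lambda B)\neq0$ for some $\lambda\in\mathbb C$. For regular boundary conditions there exist (quasi-Weierstrass normal form) $0\le m\le d$, invertible $F,G\in\mathbb C^{d\times d}$, a matrix $L\in\mathbb C^{m\times m}$ and a nilpotent matrix $N_B\in\mathbb C^{(d-m)\times(d-m)}$ with $$A=F\begin{bmatrix}L&0\\0&\mathds 1_{\mathbb C^{d-m}}\end{bmatrix}G,\qquad B=F\begin{bmatrix}\mathds 1_{\mathbb C^{m}}&0\\0&N_B\end{bmatrix}G .$$ Here $\mathds 1$ denotes the identity. The boundary conditions are called quasi-sectorial if they are regular and $N_B=0$ in this normal form (the case $m=d$, in which the second block is absent, is included). *)

(* Defs.v *)
From HB Require Import structures.
From mathcomp Require Import ring.
From mathcomp Require Import all_boot all_order all_algebra.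
From mathcomp Require Import all_classical all_reals all_analysis.
From mathcomp Require Import measurable_realfun.
From mathcomp Require Import complex.

Set Implicit Arguments.
Unset Strict Implicit.
Unset Printing Implicit Defensive.

Import Order.TTheory GRing.Theory Num.Theory.
Import numFieldNormedType.Exports.

Local Open Scope classical_set_scope.
Local Open Scope ring_scope.
Local Open Scope quotient_scope.

(* Unbounded operators in a Hilbert space H are identified with their graphs,
   i.e. with subsets of H * H; [ip] is the inner product of H, linear in its
   first argument. *)
Section HilbertSpaceOperators.
Context {R : realType} {H : lmodType R[i]} (ip : H -> H -> R[i]).
Implicit Types (T : set (H * H)) (Phi : H -> H).

Definition hnorm (x : H) : R := Num.sqrt (complex.Re (ip x x)).

Definition bounded_op Phi := exists M : R, forall x, hnorm (Phi x) <= M * hnorm x.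

Definition densely_defined T :=
  forall (x : H) (eps : R), 0 < eps -> exists u w, T (u, w) /\ hnorm (x - u) < eps.

(* y is in the domain of the adjoint, with value z, when <T u, y> = <u, z> for
   every u in the domain of T *)
Definition adjoint_op T : set (H * H) :=
  [set yz | forall u w, T (u, w) -> ip w yz.1 = ip u yz.2].

Definition self_adjoint T := densely_defined T /\ T = adjoint_op T.

Definition opp_op T : set (H * H) := [set (xy.1, - xy.2) | xy in T].

(* the graph of Phi T Phi^-1, for Phi bijective *)
Definition conj_op Phi T : set (H * H) := [set (Phi xy.1, Phi xy.2) | xy in T].

Definition similar_to_self_adjoint T :=
  exists Phi Psi : {linear H -> H},
    [/\ bounded_op Phi, bounded_op Psi, cancel Phi Psi, cancel Psi Phi
      & self_adjoint (conj_op Phi T)].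

End HilbertSpaceOperators.

(* Functions on the half-line are functions on R of which only the restriction
   to [0, +oo[ is relevant. *)
Section HalfLine.
Context {R : realType}.
Implicit Types f g : R -> R[i].

Definition half_line : set R := `[0, +oo[.

Definition Cintegral (D : set R) f : R[i] :=
  Complex (\int[lebesgue_measure]_(x in D) complex.Re (f x))
          (\int[lebesgue_measure]_(x in D) complex.Im (f x)).

Definition sqr_norm (z : R[i]) : R := complex.Re z ^+ 2 + complex.Im z ^+ 2.

Definition square_integrable f :=
  [/\ measurable_fun half_line (fun x => complex.Re (f x)),
      measurable_fun half_line (fun x => complex.Im (f x))
    & (\int[lebesgue_measure]_(x in half_line) (sqr_norm (f x))%:E < +oo)%E].

(* f is locally absolutely continuous on [0, +oo[ with a.e. derivative g
   (whenever g is locally integrable there) *)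
Definition is_primitive f g :=
  forall x : R, 0 <= x -> f x = f 0 + Cintegral `[0, x] g.

Lemma sqr_norm_ge0 z : 0 <= sqr_norm z.
Proof. by rewrite addr_ge0 ?sqr_ge0. Qed.

Lemma measurable_half_line : measurable half_line.
Proof. exact: measurable_itv. Qed.

Lemma measurable_sqr_norm f : measurable_fun half_line (fun x => complex.Re (f x)) ->
  measurable_fun half_line (fun x => complex.Im (f x)) ->
  measurable_fun half_line (fun x => (sqr_norm (f x))%:E).
Proof.
by move=> mr mi; apply/measurable_EFinP/measurable_funD; exact: measurable_funX.
Qed.

Lemma square_integrable0 : square_integrable 0.
Proof.
split; [exact: measurable_cst|exact: measurable_cst|].
rewrite (eq_integral (cst 0%E)) ?integral0// => x _ /=.
by rewrite /sqr_norm /= expr0n addr0.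
Qed.

Lemma square_integrableD f g :
  square_integrable f -> square_integrable g -> square_integrable (f + g).
Proof.
move=> [mrf mif If] [mrg mig Ig].
have ReD : (fun x => complex.Re ((f + g) x)) = (fun x => complex.Re (f x)) \+ (fun x => complex.Re (g x)).
  by apply/funext => x; rewrite /= /GRing.add /=; case: (f x); case: (g x).
have ImD : (fun x => complex.Im ((f + g) x)) = (fun x => complex.Im (f x)) \+ (fun x => complex.Im (g x)).
  by apply/funext => x; rewrite /= /GRing.add /=; case: (f x); case: (g x).
have mr : measurable_fun half_line (fun x => complex.Re ((f + g) x)).
  by rewrite ReD; exact: measurable_funD.
have mi : measurable_fun half_line (fun x => complex.Im ((f + g) x)).
  by rewrite ImD; exact: measurable_funD.
split => //.
pose h x := (2%:E * ((sqr_norm (f x))%:E + (sqr_norm (g x))%:E))%E.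
have mD := measurable_half_line.
have p0 (k : R -> R[i]) x : half_line x -> (0 <= (sqr_norm (k x))%:E)%E.
  by rewrite lee_fin sqr_norm_ge0.
apply: (@le_lt_trans _ _ (\int[lebesgue_measure]_(x in half_line) h x)%E).
  apply: ge0_le_integral => //.
  - exact: p0.
  - exact: measurable_sqr_norm.
  - by apply: measurable_funeM; apply: emeasurable_funD;
      exact: measurable_sqr_norm.
  - move=> x _; rewrite /h -EFinD -EFinM lee_fin.
    have -> : (f + g) x = f x + g x by [].
    case: (f x) => a b; case: (g x) => c d; rewrite /sqr_norm /=.
    rewrite -subr_ge0 (_ : _ - _ = (a - c) ^+ 2 + (b - d) ^+ 2).
      by rewrite addr_ge0 ?sqr_ge0.
    by rewrite !sqrrD !sqrrN !mulrDr !mulr2n; ring.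
have mf := measurable_sqr_norm mrf mif.
have mg := measurable_sqr_norm mrg mig.
have -> : (\int[lebesgue_measure]_(x in half_line) h x =
    2%:E * (\int[lebesgue_measure]_(x in half_line) (sqr_norm (f x))%:E +
            \int[lebesgue_measure]_(x in half_line) (sqr_norm (g x))%:E))%E.
  rewrite -ge0_integralD//; [|exact: p0|exact: p0].
  rewrite ge0_integralZl//; first exact: emeasurable_funD.
  by move=> x Dx; apply: adde_ge0; exact: p0.
apply: lte_mul_pinfty => //; first exact: lte_add_pinfty.
Qed.

Lemma square_integrableZ (c : R[i]) f :
  square_integrable f -> square_integrable (c *: f).
Proof.
move=> [mrf mif If]; case: c => a b.
have ReZ : (fun x => complex.Re ((Complex a b *: f) x)) =
    (fun x => a * complex.Re (f x) - b * complex.Im (f x)).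
  by apply/funext => x /=; rewrite /GRing.scale /=; case: (f x).
have ImZ : (fun x => complex.Im ((Complex a b *: f) x)) =
    (fun x => a * complex.Im (f x) + b * complex.Re (f x)).
  by apply/funext => x /=; rewrite /GRing.scale /=; case: (f x).
split.
- by rewrite ReZ; apply: measurable_funB; exact: measurable_funM.
- by rewrite ImZ; apply: measurable_funD; exact: measurable_funM.
under eq_integral => x _.
  rewrite (_ : sqr_norm _ = sqr_norm (Complex a b) * sqr_norm (f x)); last first.
    have -> : (Complex a b *: f) x = Complex a b * f x by [].
    by case: (f x) => c d; rewrite /sqr_norm /=; ring.
  rewrite EFinM; over.
rewrite ge0_integralZl//=.
- by rewrite lte_mul_pinfty ?lee_fin ?sqr_norm_ge0.
- exact: measurable_half_line.
- exact: measurable_sqr_norm.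
- by move=> x _; rewrite lee_fin sqr_norm_ge0.
- by rewrite lee_fin sqr_norm_ge0.
Qed.

End HalfLine.

Section StarGraphL2.
Context {R : realType} {d : nat}.
Implicit Types f g : 'I_d -> R -> R[i].

Definition L2_pred : {pred 'I_d -> R -> R[i]} :=
  [pred f | `[< forall e, square_integrable (f e) >]].

Lemma L2_predP f : reflect (forall e, square_integrable (f e)) (f \in L2_pred).
Proof. exact: asboolP. Qed.

Lemma L2_submod_closed : submod_closed L2_pred.
Proof.
split=> [|c f g /L2_predP fL /L2_predP gL]; apply/L2_predP => e.
  exact: square_integrable0.
exact: square_integrableD (square_integrableZ c (fL e)) (gL e).
Qed.

HB.instance Definition _ :=
  GRing.isSubmodClosed.Build R[i] ('I_d -> R -> R[i]) L2_pred L2_submod_closed.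

End StarGraphL2.

(* square-integrable functions on the star graph with d half-lines, before
   identification of functions equal almost everywhere *)
Record L2fun (R : realType) (d : nat) := MkL2fun {
  L2fun_val :> 'I_d -> R -> R[i];
  _ : L2fun_val \in L2_pred }.

HB.instance Definition _ (R : realType) (d : nat) :=
  [isSub for @L2fun_val R d].
HB.instance Definition _ (R : realType) (d : nat) :=
  [Choice of L2fun R d by <:].
HB.instance Definition _ (R : realType) (d : nat) :=
  [SubChoice_isSubLmodule of L2fun R d by <:].

Section StarGraphL2Quotient.
Context {R : realType} {d : nat}.
Implicit Types f g : L2fun R d.

Definition null_pred : {pred L2fun R d} :=
  [pred f : L2fun R d | `[< forall e, f e = cst 0 %[ae lebesgue_measure in half_line] >]].

Lemma null_predP f :
  reflect (forall e, f e = cst 0 %[ae lebesgue_measure in half_line])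
          (f \in null_pred).
Proof. exact: asboolP. Qed.

Lemma null_submod_closed : submod_closed null_pred.
Proof.
split=> [|c f g /null_predP f0 /null_predP g0]; apply/null_predP => e.
  exact: ae_eq_refl.
have F := ae_filter_ringOfSetsType
  (lebesgue_measure : {measure set (measurableTypeR R) -> \bar R}).
move: (f0 e) (g0 e); apply: filterS2 => x fx0 gx0 Dx.
have -> : (c *: f + g : L2fun R d) e x = c *: f e x + g e x by [].
by rewrite fx0// gx0//= scaler0 addr0.
Qed.

HB.instance Definition _ :=
  GRing.isSubmodClosed.Build R[i] (L2fun R d) null_pred null_submod_closed.

End StarGraphL2Quotient.

Definition L2 (R : realType) (d : nat) : Type :=
  Quotient.quot (null_pred : zmodClosed (L2fun R d)).

HB.instance Definition _ (R : realType) (d : nat) := GRing.Zmodule.on (L2 R d).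

Section L2Lmodule.
Context {R : realType} {d : nat}.
Implicit Types (x y : L2 R d) (f g : L2fun R d) (a b : R[i]).

Definition L2_class f : L2 R d := \pi_(L2 R d) f.

Lemma L2_class_repr x : L2_class (repr x) = x.
Proof. exact: reprK. Qed.

Lemma L2_classE f g : L2_class f = L2_class g <-> f - g \in null_pred.
Proof. by rewrite Quotient.idealrBE; split=> [fg|/eqP //]; apply/eqP. Qed.

Lemma L2_classD : {morph L2_class : f g / f + g}.
Proof. by move=> f g; rewrite /L2_class !piE. Qed.

Definition L2_scale a x : L2 R d := L2_class (a *: repr x).

Lemma L2_classZ a f : L2_scale a (L2_class f) = L2_class (a *: f).
Proof.
apply/L2_classE; rewrite -scalerBr rpredZ//.
by apply/L2_classE; exact: L2_class_repr.
Qed.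

Lemma L2_scaleA a b x : L2_scale a (L2_scale b x) = L2_scale (a * b) x.
Proof. by rewrite -[x]L2_class_repr !L2_classZ scalerA. Qed.

Lemma L2_scale1 : left_id 1 L2_scale.
Proof. by move=> x; rewrite -[x]L2_class_repr L2_classZ scale1r. Qed.

Lemma L2_scaleDr : right_distributive L2_scale +%R.
Proof.
move=> a x y; rewrite -[x]L2_class_repr -[y]L2_class_repr.
by rewrite -L2_classD !L2_classZ -L2_classD scalerDr.
Qed.

Lemma L2_scaleDl x : {morph L2_scale^~ x : a b / a + b}.
Proof.
by move=> a b; rewrite -[x]L2_class_repr !L2_classZ -L2_classD scalerDl.
Qed.

End L2Lmodule.

HB.instance Definition _ (R : realType) (d : nat) :=
  GRing.Zmodule_isLmodule.Build R[i] (L2 R d)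
    (@L2_scaleA R d) (@L2_scale1 R d) (@L2_scaleDr R d) (@L2_scaleDl R d).

Section StarGraphLaplacian.
Context {R : realType} {d : nat}.

Definition L2fun_inner (f g : L2fun R d) : R[i] :=
  \sum_(e < d) Cintegral half_line (fun t => f e t * conjc (g e t)).

Definition L2_inner (x y : L2 R d) : R[i] := L2fun_inner (repr x) (repr y).

Lemma L2_inner_class (f g : L2fun R d) :
  L2_inner (L2_class f) (L2_class g) = L2fun_inner f g.
Proof.
have eqrepr (h : L2fun R d) e :
    h e = (repr (L2_class h) : L2fun R d) e %[ae lebesgue_measure in half_line].
  have hn := (L2_classE h (repr (L2_class h))).1 (esym (L2_class_repr _)).
  move/null_predP: hn => /(_ e).
  have F := ae_filter_ringOfSetsType
    (lebesgue_measure : {measure set (measurableTypeR R) -> \bar R}).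
  apply: filterS => t ht Dt; move: (ht Dt) => /eqP.
  have -> : (h - repr (L2_class h) : L2fun R d) e t = h e t -
    (repr (L2_class h) : L2fun R d) e t by [].
  by rewrite subr_eq0 => /eqP.
have meas (h : L2fun R d) e :
    measurable_fun half_line (fun t => complex.Re (h e t)) /\
    measurable_fun half_line (fun t => complex.Im (h e t)).
  by have /L2_predP/(_ e)[] := valP h.
have measM (h k : L2fun R d) e :
    measurable_fun half_line (fun t => complex.Re (h e t * conjc (k e t))) /\
    measurable_fun half_line (fun t => complex.Im (h e t * conjc (k e t))).
  have [hr hi] := meas h e; have [kr ki] := meas k e.
  split.
    rewrite (_ : (fun t => _) = (fun t => complex.Re (h e t) * complex.Re (k e t)
       + complex.Im (h e t) * complex.Im (k e t))).
      by apply: measurable_funD; exact: measurable_funM.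
    by apply/funext => t; case: (h e t) => ? ?; case: (k e t) => ? ? /=; ring.
  rewrite (_ : (fun t => _) = (fun t => complex.Im (h e t) * complex.Re (k e t)
     - complex.Re (h e t) * complex.Im (k e t))).
    by apply: measurable_funB; exact: measurable_funM.
  by apply/funext => t; case: (h e t) => ? ?; case: (k e t) => ? ? /=; ring.
have F := ae_filter_ringOfSetsType
  (lebesgue_measure : {measure set (measurableTypeR R) -> \bar R}).
apply: eq_bigr => e _.
have [m1 m2] := measM (repr (L2_class f)) (repr (L2_class g)) e.
have [m3 m4] := measM f g e.
congr Complex; congr fine; apply: ae_eq_integral => //;
  try exact: measurable_half_line; try exact/measurable_EFinP;
  move: (eqrepr f e) (eqrepr g e); apply: filterS2 => t ef eg Dt;
  by rewrite ef// eg.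
Qed.

(* An element of H^2 of the star graph is given by the absolutely continuous
   representative psi together with its derivatives psi1 = psi' (everywhere)
   and psi2 = psi'' (almost everywhere), all of them square integrable. *)
Definition H2 (psi psi1 psi2 : L2fun R d) :=
  forall e, is_primitive (psi e) (psi1 e) /\ is_primitive (psi1 e) (psi2 e).

Definition at_vertex (psi : L2fun R d) : 'cV[R[i]]_d := \col_e psi e 0.

Definition Delta (A B : 'M[R[i]]_d) : set (L2 R d * L2 R d) :=
  [set xy | exists psi psi1 psi2 : L2fun R d,
     [/\ H2 psi psi1 psi2, A *m at_vertex psi + B *m at_vertex psi1 = 0,
         xy.1 = L2_class psi & xy.2 = L2_class psi2]].

End StarGraphLaplacian.

Section BoundaryConditions.
Context {C : closedFieldType}.

Definition regular_bc d (A B : 'M[C]_d) :=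
  \rank (row_mx A B) = d /\ exists lambda, \det (A + lambda *: B) != 0.

Definition nilpotent_mx n (N : 'M[C]_n) := exists k, N ^+ k = 0.

Definition quasi_Weierstrass d (A B : 'M[C]_d) m n (dE : (m + n)%N = d)
    (F G : 'M[C]_d) (L : 'M[C]_m) (N : 'M[C]_n) :=
  [/\ F \in unitmx, G \in unitmx, nilpotent_mx N,
      A = F *m castmx (dE, dE) (block_mx L 0 0 1%:M) *m G
    & B = F *m castmx (dE, dE) (block_mx 1%:M 0 0 N) *m G].

(* m, n and the similarity classes of L and N are determined by A and B *)
Definition quasi_sectorial d (A B : 'M[C]_d) :=
  regular_bc A B /\
  exists m n (dE : (m + n)%N = d) F G L N,
    quasi_Weierstrass A B dE F G L N /\ N = 0.

Definition algebraic_multiplicity n (L : 'M[C]_n) (l : C) :=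
  mup l (char_poly L).

(* eigenspace L l is the left eigenspace, of the same dimension as the right
   one *)
Definition geometric_multiplicity n (L : 'M[C]_n) (l : C) :=
  \rank (eigenspace L l).

End BoundaryConditions.

(* Main.v *)
Require Import Defs.
From HB Require Import structures.
From mathcomp Require Import ring lra.
From mathcomp Require Import all_boot all_order all_algebra.
From mathcomp Require Import all_classical all_reals all_analysis.
From mathcomp Require Import measurable_realfun complex.

Set Implicit Arguments.
Unset Strict Implicit.
Unset Printing Implicit Defensive.

Import Order.TTheory GRing.Theory Num.Theory.
Import numFieldNormedType.Exports.

Local Open Scope classical_set_scope.
Local Open Scope ring_scope.

(** The edgewise operator - d^2/dx^2 with the conditions A psi(0) + B psi'(0) = 0
has only explicit exponential solutions, and both implications rest on them.

Suppose that T = - Delta(A, B) is similar to a self-adjoint operator. Then its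
resolvent satisfies |Im z| ||x|| <= C ||T x - z x|| on the domain
([similar_resolvent_bound]). The functions e^(- k x) p + x e^(- n x) q satisfy the
conditions as soon as A p + B (q - k p) = 0, and for small q they are approximate
eigenfunctions at z = - k^2 ([quasimode_estimate]). Hence p = 0 for every vector p
that solves A p = l B p with Re l > 0 and l not real, or with l imaginary and
nonzero, or that starts a Jordan chain of the pencil at infinity or at some
l >= 0. In terms of the pencil these four exclusions are the regularity of A, B
and the vanishing of the nilpotent block, the location of the spectrum of L, and
the semisimplicity of its nonnegative eigenvalues ([similar_necessary]).

Conversely, a change of coordinates on the edges turns the conditions into
u' = M u on a set S of edges, where every eigenvalue of M has positive real part,
and separated real Robin or Dirichlet conditions on the others
([quasi_sectorial_canonical]). Let K_z be the inverse of d/dx + z with the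
condition s(0) = 0; it is bounded for Re z > 0. The operator
X = (d/dx + M) (d/dx + 1)^-1 = 1 + (M - 1) K_1 is bounded, commutes with the
second derivative and carries the conditions with M = 1 to those with M
([Delta_transmutation]). It has a bounded inverse: up to the bounded factors
1 - (z - 1) K_z the product of the z - M over the roots z of the characteristic
polynomial of M is an obstruction to inverting X, and this product vanishes by
the Cayley-Hamilton theorem ([transmutation_invertible]). Only separated real
conditions remain, and for these the operator is symmetric, has a dense domain
and T + k^2 is surjective for large k, so that it is self-adjoint
([self_adjoint_of_real_conditions]).

The density of the domain is the density of the range of K_1. It holds because
the exponential averages k K_k f converge almost everywhere to f, and
||f - k K_k f||^2 = ||f||^2 - ||k K_k f||^2, so that Fatou's lemma gives
convergence in norm along a subsequence ([range_average_dense]).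

Absolutely continuous functions are given as primitives of locally integrable
ones. The energy estimates and Green's identity for them rest on the product rule,
which is Fubini's theorem on a triangle ([primitiveM]), and on the vanishing at
infinity of integrable functions with integrable derivative
([half_line_boundary]). *)

(** * Primitives of locally integrable functions *)

Section RealPrimitives.
Context {R : realType}.
Notation mu := (@lebesgue_measure R).
Implicit Types (f g h F W : R -> R).

Definition locally_int f := forall x : R, 0 <= x -> mu.-integrable `[0, x] (EFin \o f).

(** The real counterpart of [is_primitive]; statements on complex functions are
reduced to it by taking real and imaginary parts. *)
Definition primitive F f :=
  forall x, 0 <= x -> F x = F 0 + \int[mu]_(t in `[0, x]) f t.

Lemma half_line_bigcup : @half_line R = \bigcup_n `[0, n%:R]%classic.
Proof.
apply/seteqP; split => x /=; rewrite /half_line /= in_itv /=.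
  rewrite andbT => x0; exists (Num.truncn x).+1 => //=.
  by rewrite in_itv/= x0/= ltW// truncnS_gt.
by move=> [n _] /=; rewrite in_itv/= andbT => /andP[].
Qed.

Lemma locally_int_measurable f : locally_int f -> measurable_fun (@half_line R) f.
Proof.
move=> fi; rewrite half_line_bigcup.
apply: (measurable_fun_bigcup _ _).2 => n; first exact: measurable_itv.
by have /integrableP[/measurable_EFinP] := fi n%:R (ler0n _ _).
Qed.

Lemma locally_intD f g : locally_int f -> locally_int g ->
  locally_int (fun x => f x + g x).
Proof.
move=> fi gi x x0.
by apply: eq_integrable (integrableD _ (fi x x0) (gi x x0)).
Qed.

Lemma locally_intZ k f : locally_int f -> locally_int (fun x => k * f x).
Proof.
move=> fi x x0.
by apply: eq_integrable (integrableZl _ k (fi x x0)).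
Qed.

Lemma locally_intN f : locally_int f -> locally_int (fun x => - f x).
Proof.
move=> /(locally_intZ (-1)) fi x x0; apply: eq_integrable (fi x x0) => //.
by move=> t _ /=; rewrite mulN1r.
Qed.

Lemma locally_intB f g : locally_int f -> locally_int g ->
  locally_int (fun x => f x - g x).
Proof. by move=> fi gi; apply: locally_intD fi (locally_intN gi). Qed.

Lemma locally_int_continuous f : continuous f -> locally_int f.
Proof.
move=> fc x x0; apply: continuous_compact_integrable; first exact: segment_compact.
exact: continuous_subspaceT.
Qed.

Lemma locally_int_cst k : locally_int (fun=> k : R).
Proof. by apply: locally_int_continuous => x; exact: cst_continuous. Qed.

Lemma primitive_cst (c : R) : primitive (fun=> c) (fun=> 0).
Proof. by move=> x x0; rewrite Rintegral_cst// mul0r addr0. Qed.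

Lemma primitive_integral f :
  primitive (fun x => \int[mu]_(t in `[0, x]) f t) f.
Proof. by move=> x x0; rewrite set_itv1 Rintegral_set1 add0r. Qed.

Lemma primitiveD F f G g : locally_int f -> locally_int g ->
  primitive F f -> primitive G g ->
  primitive (fun x => F x + G x) (fun x => f x + g x).
Proof.
move=> fi gi Ff Gg x x0; rewrite RintegralD//; last 2 first.
  exact: fi.
  exact: gi.
by rewrite (Ff x)// (Gg x)//; ring.
Qed.

Lemma primitiveZ k F f : locally_int f -> primitive F f ->
  primitive (fun x => k * F x) (fun x => k * f x).
Proof.
move=> fi Ff x x0; rewrite RintegralZl//; last exact: fi.
by rewrite (Ff x)//; ring.
Qed.

Lemma primitiveN F f : locally_int f -> primitive F f ->
  primitive (fun x => - F x) (fun x => - f x).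
Proof.
move=> fi Ff x x0; have := primitiveZ (-1) fi Ff x0.
by rewrite !mulN1r => ->; congr (_ + _); apply: eq_Rintegral => t _; rewrite mulN1r.
Qed.

Lemma primitiveB F f G g : locally_int f -> locally_int g ->
  primitive F f -> primitive G g ->
  primitive (fun x => F x - G x) (fun x => f x - g x).
Proof.
move=> fi gi Ff Gg; apply: (primitiveD fi (locally_intN gi) Ff).
exact: primitiveN.
Qed.

Lemma eq_primitive F F' f f' : (forall x, 0 <= x -> F x = F' x) ->
  (forall x, 0 <= x -> f x = f' x) -> primitive F f -> primitive F' f'.
Proof.
move=> FF ff Ff x x0; rewrite -FF// -FF// Ff//; congr (_ + _).
by apply: eq_Rintegral => t; rewrite inE/= in_itv/= => /andP[t0 _]; rewrite ff.
Qed.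

Lemma eq_locally_int f f' : (forall x, 0 <= x -> f x = f' x) ->
  locally_int f -> locally_int f'.
Proof.
move=> ff fi x x0; apply: eq_integrable (fi x x0) => //.
by move=> t; rewrite inE/= in_itv/= => /andP[t0 _]; rewrite ff.
Qed.

Lemma primitive_within F f b : locally_int f -> primitive F f -> 0 <= b ->
  {within `[0, b], continuous F}.
Proof.
move=> fi Ff b0.
have c := parameterized_integral_continuous b0 (fi b b0).
apply: (@subspace_eq_continuous _ _ _ (fun x => F 0 + parameterized_integral mu 0 x f)).
  by move=> x; rewrite inE/= in_itv/= => /andP[x0 _]; rewrite /parameterized_integral -Ff.
move=> x; apply: cvgD; [exact: cvg_cst|exact: c].
Qed.

Lemma primitive_locally_int F f : locally_int f -> primitive F f -> locally_int F.
Proof.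
move=> fi Ff x x0; apply: continuous_compact_integrable; first exact: segment_compact.
exact: primitive_within Ff _.
Qed.

Lemma primitive_bounded F f b : locally_int f -> primitive F f -> 0 <= b ->
  [bounded F x | x in `[0, b]%classic].
Proof.
move=> fi Ff b0; have := primitive_within fi Ff b0.
move=> /continuous_compact /(_ (@segment_compact _ 0 b)) /compact_bounded.
move=> [M [Mr MF]]; exists M; split => // N MN /= x xb.
by apply: (MF _ MN); exists x.
Qed.

(** A primitive is continuous, hence bounded on bounded intervals. *)
Lemma locally_intM F f g : locally_int f -> primitive F f -> locally_int g ->
  locally_int (fun x => F x * g x).
Proof.
move=> fi Ff gi b b0.
have mF : measurable_fun `[0, b] F.
  by have /integrableP[/measurable_EFinP] := primitive_locally_int fi Ff b0.
have mI : measurable (`[0, b]%classic : set (measurableTypeR R)) by exact: measurable_itv.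
exact: (eq_integrable mI _ _ _ (integrableMr mI mF (primitive_bounded fi Ff b0) (gi b b0))).
Qed.

(** Both sides integrate f s * g t over the triangle t <= s. This is integration by
parts without any regularity of f and g beyond integrability. *)
Lemma triangle_fubini f g X : locally_int f -> locally_int g -> 0 <= X ->
  \int[mu]_(s in `[0, X]) (f s * \int[mu]_(t in `[0, s]) g t) =
  \int[mu]_(t in `[0, X]) (g t * \int[mu]_(s in `[t, X]) f s).
Proof.
move=> fi gi X0.
pose fX := f \_ `[0, X]; pose gX := g \_ `[0, X].
pose M := measurableTypeR R.
pose T : set (M * M) := [set st | st.2 <= st.1].
have mI : measurable (`[0, X]%classic : set (measurableTypeR R)) by exact: measurable_itv.
have ipatch h : locally_int h -> mu.-integrable setT (EFin \o h \_ `[0, X]).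
  by move=> hi; rewrite -restrict_EFin; apply/(integrable_mkcond _ mI).1/hi.
have ifX := ipatch _ fi; have igX := ipatch _ gi.
have mfX : measurable_fun (setT : set M) fX by apply/measurable_EFinP; case/integrableP: ifX.
have mgX : measurable_fun (setT : set M) gX by apply/measurable_EFinP; case/integrableP: igX.
pose phi (st : M * M) : R := fX st.1 * gX st.2 * \1_T st.
have mT : measurable T.
  rewrite -[T]setTI; apply: measurable_fun_le => //.
have mphi : measurable_fun (setT : set (M * M)) (EFin \o phi).
  apply/measurable_EFinP; apply: measurable_funM; last exact: measurable_indic.
  apply: measurable_funM.
    by apply: (measurableT_comp mfX).
  by apply: (measurableT_comp mgX).
have iphi : (mu \x mu)%E.-integrable setT (EFin \o phi).
  have mp : measurable_fun (setT : set (M * M)) (fun st : M * M => (fX st.1 * gX st.2)%:E).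
    apply/measurable_EFinP; apply: measurable_funM.
      by apply: (measurableT_comp mfX).
    by apply: (measurableT_comp mgX).
  suff ip : (mu \x mu)%E.-integrable setT (fun st : M * M => (fX st.1 * gX st.2)%:E).
    apply: (le_integrable _ mphi _ ip) => //.
    move=> [s t] _ /=; rewrite lee_fin /phi/= normrM ler_piMr//.
    by rewrite indicE; case: (_ \in _) => /=; rewrite ?normr1 ?normr0.
  apply/integrable12ltyP => //.
  under eq_integral => s _.
    under eq_integral => t _ do rewrite /= normrM EFinM.
    rewrite ge0_integralZl//; last first.
      by apply/measurable_EFinP; exact: measurableT_comp.
    over.
  have /integrableP[_ /= gfin] := igX; have /integrableP[_ /= ffin] := ifX.
  rewrite ge0_integralZr//; last 2 first.
    by apply/measurable_EFinP; exact: measurableT_comp.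
    exact: integral_ge0.
  rewrite lte_mul_pinfty//; first exact: integral_ge0.
  by rewrite ge0_fin_numE//; exact: integral_ge0.
have pull k h D : measurable (D : set (measurableTypeR R)) ->
    mu.-integrable D (EFin \o h) ->
    (\int[mu]_x (k * (h \_ D) x)%:E = (k * \int[mu]_(x in D) h x)%:E)%E.
  move=> mD hi; under eq_integral do rewrite EFinM.
  have hi' : mu.-integrable setT (EFin \o h \_ D).
    by rewrite -restrict_EFin; apply/(integrable_mkcond _ mD).1.
  rewrite integralZl// EFinM; congr (_ * _)%E.
  rewrite /Rintegral fineK; last exact: integrable_fin_num.
  by rewrite [RHS]integral_mkcond restrict_EFin.
have iT (s t : R) : \1_T (s, t) = (t <= s)%R%:R :> R.
  by rewrite indicE; congr ((nat_of_bool _)%:R); apply/idP/idP; rewrite inE.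
have E1 s : (\int[mu]_t (phi (s, t))%:E =
    ((fun s => f s * \int[mu]_(t in `[0, s]) g t) \_ `[0, X] s)%:E)%E.
  rewrite patchE; case: ifPn => [|sX]; last first.
    apply: integral0_eq => t _; rewrite /phi /fX /= patchE (negbTE sX).
    by rewrite !mul0r.
  rewrite inE/= in_itv/= => /andP[s0 sX].
  rewrite -pull//; last exact: gi.
  apply: eq_integral => t _; rewrite /phi /fX /gX /= !patchE iT.
  rewrite !mem_setE/= !in_itv/= s0 sX/= -mulrA; congr (_ * _)%:E.
  have [ts|ts] := leP t s.
    by rewrite (le_trans ts sX) !andbT mulr1.
  by rewrite mulr0 andbF.
have E2 t : (\int[mu]_s (phi (s, t))%:E =
    ((fun t => g t * \int[mu]_(s in `[t, X]) f s) \_ `[0, X] t)%:E)%E.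
  rewrite patchE; case: ifPn => [|tX]; last first.
    apply: integral0_eq => s _; rewrite /phi /gX /= [X in _ * X * _]patchE (negbTE tX).
    by rewrite mulr0 mul0r.
  rewrite inE/= in_itv/= => /andP[t0 tX].
  rewrite -pull//; last first.
    apply: integrableS (fi _ X0) => //.
    by move=> s /=; rewrite !in_itv/= => /andP[ts ->]; rewrite (le_trans t0 ts).
  apply: eq_integral => s _; rewrite /phi /fX /gX /= !patchE iT.
  rewrite !mem_setE/= !in_itv/= t0 tX/= mulrAC mulrC; congr (_ * _)%:E.
  have [ts|ts] := leP t s.
    by rewrite (le_trans t0 ts) /= mulr1.
  by rewrite mulr0.
have := Fubini iphi.
rewrite /=; under eq_integral do rewrite E1.
under [in RHS]eq_integral do rewrite E2.
have unpatch (h : R -> R) : (\int[mu]_x ((h \_ `[0%R, X]) x)%:E =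
    \int[mu]_(x in `[0%R, X]) (h x)%:E)%E.
  by rewrite [RHS]integral_mkcond restrict_EFin.
by rewrite !unpatch /Rintegral => ->.
Qed.

(** Up to the contributions of F 0 and G 0, the sum of the two integrals of products
is F X * G X because they are exchanged by [triangle_fubini]. *)
Lemma primitiveM F f G g : locally_int f -> locally_int g ->
  primitive F f -> primitive G g ->
  primitive (fun x => F x * G x) (fun x => f x * G x + F x * g x).
Proof.
move=> fi gi Ff Gg X X0.
have FGi := locally_intM fi Ff gi.
have GFi := locally_intM gi Gg fi.
pose IF x := \int[mu]_(t in `[0, x]) f t.
pose IG x := \int[mu]_(t in `[0, x]) g t.
have pIF : primitive IF f := primitive_integral f.
have pIG : primitive IG g := primitive_integral g.
have IFgi := locally_intM fi pIF gi.
have IGfi := locally_intM gi pIG fi.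
have fIGi : locally_int (fun x => f x * IG x).
  by apply: eq_locally_int IGfi => x _; rewrite mulrC.
have gIFi : locally_int (fun x => g x * IF x).
  by apply: eq_locally_int IFgi => x _; rewrite mulrC.
have T := triangle_fubini fi gi X0.
have E : \int[mu]_(t in `[0, X]) (g t * \int[mu]_(s in `[t, X]) f s) =
    \int[mu]_(t in `[0, X]) (IF X * g t - g t * IF t).
  apply: eq_Rintegral => t; rewrite inE/= in_itv/= => /andP[t0 tX].
  have fiX : mu.-integrable [set` Interval (BLeft 0) (BRight X)] (EFin \o f) by exact: fi.
  have := Rintegral_itvB fiX (x := t); rewrite !bnd_simp t0 tX => /(_ isT isT).
  rewrite Rintegral_itv_obnd_cbnd; last first.
    apply: integrableS fiX => //= s; rewrite /= !in_itv/= => /andP[ts ->].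
    by rewrite (ltW (le_lt_trans t0 ts)).
  by move=> <-; rewrite /IF; ring.
rewrite E RintegralB// in T; last 2 first.
- exact: locally_intZ.
- exact: gIFi.
rewrite RintegralZl// in T; last exact: gi.
have -> : \int[mu]_(t in `[0, X]) (f t * G t + F t * g t) =
   \int[mu]_(t in `[0, X]) ((G 0 * f t + f t * IG t) + (F 0 * g t + g t * IF t)).
  apply: eq_Rintegral => t; rewrite inE/= in_itv/= => /andP[t0 tX].
  by rewrite (Ff t)// (Gg t)// /IF /IG; ring.
rewrite RintegralD//; last 2 first.
- by apply: (locally_intD (locally_intZ _ fi) fIGi).
- by apply: (locally_intD (locally_intZ _ gi) gIFi).
rewrite !RintegralD//; try by [exact: locally_intZ|exact: fIGi|exact: gIFi].
rewrite !RintegralZl//; try by [exact: fi|exact: gi].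
have -> : \int[mu]_(t in `[0, X]) (f t * IG t) = IF X * IG X - \int[mu]_(t in `[0, X]) (g t * IF t).
  exact: T.
by rewrite (Ff X)// (Gg X)// /IF /IG; ring.
Qed.
End RealPrimitives.

(** * Integrals over the half-line *)

Section HalfLineIntegrals.
Context {R : realType}.
Notation mu := (@lebesgue_measure R).
Notation half_line := (@half_line R).
Implicit Types (f g h F W : R -> R).

Lemma primitive_C1 F f : (forall x : R, is_derive x 1 F (f x)) -> continuous f ->
  primitive F f.
Proof.
move=> dF cf x; rewrite le_eqVlt => /predU1P[<-|x0].
  by rewrite set_itv1 Rintegral_set1 addr0.
have cF : continuous F.
  by move=> y; apply: differentiable_continuous; apply/derivable1_diffP; apply: ex_derive.
rewrite /Rintegral (@continuous_FTC2 _ f F 0 x)//=.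
- ring.
- exact: continuous_subspaceT.
- split; first by move=> y _; apply: ex_derive.
  + by apply: cvg_at_right_filter; exact: cF.
  + by apply: cvg_at_left_filter; exact: cF.
- by move=> y _; rewrite derive1E; apply: derive_val.
Qed.

Lemma primitive_id : primitive (fun x : R => x) (fun=> 1).
Proof. by apply: primitive_C1 => // x; exact: cst_continuous. Qed.

Let mhl : measurable (half_line : set (measurableTypeR R)).
Proof. exact: measurable_half_line. Qed.

Lemma integrable_locally_int h : mu.-integrable half_line (EFin \o h) -> locally_int h.
Proof.
move=> hi x x0; apply: integrableS hi => //.
by move=> t /=; rewrite /Defs.half_line/= !in_itv/= andbT => /andP[].
Qed.

Lemma half_line_cvg h : (forall x, 0 <= x -> 0 <= h x) -> locally_int h ->
  (\int[mu]_(x in `[0%R, n%:R]) (h x)%:E @[n --> \oo] -->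
   \int[mu]_(x in half_line) (h x)%:E)%E.
Proof.
move=> h0 hi; rewrite half_line_bigcup.
apply: ge0_nondecreasing_set_cvg_integral.
- move=> m n mn; apply/subsetPset => x /=; rewrite !in_itv/= => /andP[-> xm]/=.
  by rewrite (le_trans xm)// ler_nat.
- by move=> n; exact: measurable_itv.
- by move=> n; have /integrableP[] := hi n%:R (ler0n _ _).
- by move=> n x /=; rewrite in_itv/= => /andP[x0 _]; rewrite lee_fin h0.
Qed.

(** Monotone convergence. This is how energy inequalities on bounded intervals give
square integrability on the half-line. *)
Lemma half_line_le h C : (forall x, 0 <= x -> 0 <= h x) -> locally_int h ->
  (forall X, 0 <= X -> \int[mu]_(t in `[0, X]) h t <= C) ->
  mu.-integrable half_line (EFin \o h) /\ \int[mu]_(t in half_line) h t <= C.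
Proof.
move=> h0 hi hC.
have le : (\int[mu]_(x in half_line) (h x)%:E <= C%:E)%E.
  rewrite -(cvg_lim _ (half_line_cvg h0 hi))//.
  apply: lime_le; first by apply/cvg_ex; eexists; exact: half_line_cvg.
  apply: nearW => n; have := hC n%:R (ler0n _ _).
  rewrite -lee_fin /Rintegral fineK//.
  by apply: integrable_fin_num => //; exact: hi.
have hint : mu.-integrable half_line (EFin \o h).
  apply/integrableP; split.
    by apply/measurable_EFinP; exact: locally_int_measurable.
  rewrite (_ : (\int[mu]_(x in half_line) _)%E = (\int[mu]_(x in half_line) (h x)%:E)%E).
    exact: le_lt_trans le (ltry _).
  apply: eq_integral => x; rewrite inE /Defs.half_line /= in_itv/= andbT => x0.
  by rewrite ger0_norm// h0.
split=> //; rewrite -lee_fin /Rintegral fineK//.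
exact: integrable_fin_num.
Qed.

Lemma half_line_ge h X : (forall x, 0 <= x -> 0 <= h x) ->
  mu.-integrable half_line (EFin \o h) -> 0 <= X ->
  \int[mu]_(t in `[0, X]) h t <= \int[mu]_(t in half_line) h t.
Proof.
move=> h0 hi X0; have hl := integrable_locally_int hi.
rewrite /Rintegral fine_le//.
- by apply: integrable_fin_num => //; exact: hl.
- exact: integrable_fin_num.
apply: ge0_subset_integral => //.
- by have /integrableP[] := hi.
- by move=> x; rewrite /Defs.half_line /= in_itv/= andbT => x0; rewrite lee_fin h0.
- by move=> t /=; rewrite /Defs.half_line/= !in_itv/= andbT => /andP[].
Qed.

Lemma half_line_tail h X : mu.-integrable half_line (EFin \o h) -> 0 <= X ->
  `|\int[mu]_(t in half_line) h t - \int[mu]_(t in `[0, X]) h t| <=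
  \int[mu]_(t in half_line) `|h t| - \int[mu]_(t in `[0, X]) `|h t|.
Proof.
move=> hi X0.
have ai : mu.-integrable half_line (EFin \o (fun t => `|h t|)) by exact: integrable_norm.
rewrite /Defs.half_line.
rewrite !(Rintegral_itvB (x := X)) ?bnd_simp//.
apply: le_normr_Rintegral => //.
apply: integrableS hi => //.
by move=> t /=; rewrite /Defs.half_line/= !in_itv/= !andbT => /ltW; exact: le_trans.
Qed.

Lemma half_line_tail_small h (eps : R) : mu.-integrable half_line (EFin \o h) ->
  0 < eps -> exists N : nat, forall X, N%:R <= X ->
  `|\int[mu]_(t in half_line) h t - \int[mu]_(t in `[0, X]) h t| < eps.
Proof.
move=> hi e0; have hl := integrable_locally_int hi.
have ai : mu.-integrable half_line (EFin \o (fun t => `|h t|)) by exact: integrable_norm.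
have al := integrable_locally_int ai.
pose I := \int[mu]_(t in half_line) `|h t|.
have [N /= HN] : exists N : nat, I - eps < \int[mu]_(t in `[0, N%:R]) `|h t|.
  have c := half_line_cvg (fun x _ => normr_ge0 (h x)) al.
  have If : (\int[mu]_(x in half_line) `|h x|%:E)%E = I%:E.
    by rewrite /I /Rintegral fineK//; exact: integrable_fin_num.
  rewrite If in c.
  apply/not_existsP => H.
  have : (I%:E <= (I - eps)%:E)%E.
    rewrite -(cvg_lim _ c)//; apply: lime_le; first by apply/cvg_ex; eexists; exact: c.
    apply: nearW => n; have := H n; move/negP; rewrite -leNgt -lee_fin /Rintegral fineK//.
    by apply: integrable_fin_num => //; exact: al.
  by rewrite lee_fin leNgt gtrBl e0.
exists N => X NX; have X0 : 0 <= X by rewrite (le_trans _ NX).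
apply: le_lt_trans (half_line_tail hi X0) _.
rewrite ltrBlDr -ltrBlDl; apply: lt_le_trans HN _.
rewrite /Rintegral fine_le//.
- by apply: integrable_fin_num => //; exact: al.
- by apply: integrable_fin_num => //; exact: al.
apply: ge0_subset_integral => //.
- by have /integrableP[] := al _ X0.
- by move=> t /=; rewrite !in_itv/= => /andP[-> /le_trans]; apply.
Qed.

(** W has a limit at infinity because its derivative is integrable, and this limit
vanishes because W itself is integrable. *)
Lemma half_line_boundary W h : mu.-integrable half_line (EFin \o h) ->
  mu.-integrable half_line (EFin \o W) -> primitive W h ->
  \int[mu]_(t in half_line) h t = - W 0.
Proof.
move=> hi Wi Wh; apply/eqP; rewrite -subr_eq0 opprK.
set w := _ + _; apply/negPn/negP => w0.
have hl := integrable_locally_int hi.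
have ai : mu.-integrable half_line (EFin \o (fun t => `|h t|)) by exact: integrable_norm.
have al := integrable_locally_int ai.
have bi : mu.-integrable half_line (EFin \o (fun t => `|W t|)) by exact: integrable_norm.
have bl := integrable_locally_int bi.
have w2 : 0 < `|w| / 2 by rewrite divr_gt0// normr_gt0.
have [N HN] := half_line_tail_small hi w2.
have Wbig X : N%:R <= X -> `|w| / 2 <= `|W X|.
  move=> NX; have X0 : 0 <= X by rewrite (le_trans _ NX).
  have E : w - W X = \int[mu]_(t in half_line) h t - \int[mu]_(t in `[0, X]) h t.
    by rewrite /w (Wh X)//; ring.
  have := HN X NX; rewrite -E => /(le_lt_trans (lerB_dist w (W X))).
  by rewrite ltrBlDr -ltrBlDl {1}[`|w|]splitr addrK => /ltW.
have [M HM] : exists M : nat, \int[mu]_(t in half_line) `|W t| < M%:R * (`|w| / 2).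
  exists (Num.truncn (\int[mu]_(t in half_line) `|W t| / (`|w| / 2))).+1.
  by rewrite -ltr_pdivrMr ?truncnS_gt// divr_gt0// normr_gt0.
have := half_line_ge (fun x _ => normr_ge0 (W x)) bi (ler0n _ (N + M)).
rewrite leNgt => /negP; apply; apply: lt_le_trans HM _.
have -> : M%:R * (`|w| / 2) = \int[mu]_(t in `[N%:R, (N + M)%:R]) (`|w| / 2).
  rewrite Rintegral_cst//.
  have -> : fine (mu `[N%:R, (N + M)%:R]) = M%:R :> R.
    have -> := @lebesgue_measure_itv R `[N%:R, (N + M)%:R].
    rewrite /= lte_fin ltr_nat; case: ifPn => [_|].
      by rewrite -EFinD/= natrD; ring.
    by rewrite -leqNgt -{2}[N]addn0 leq_add2l leqn0 => /eqP ->.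
  by rewrite mulrC.
have si : mu.-integrable `[N%:R, (N + M)%:R] (EFin \o (fun t => `|W t|)).
  apply: integrableS bi => // t /=.
  by rewrite /Defs.half_line/= !in_itv/= andbT => /andP[/(le_trans _)-> //].
apply: (@le_trans _ _ (\int[mu]_(t in `[N%:R, (N + M)%:R]) `|W t|)).
  apply: le_Rintegral => //.
    by apply: continuous_compact_integrable; [exact: segment_compact|apply: continuous_subspaceT => x; exact: cst_continuous].
  by move=> x /=; rewrite in_itv/= => /andP[Nx _]; exact: Wbig.
rewrite /Rintegral fine_le//.
- exact: integrable_fin_num.
- by apply: integrable_fin_num => //; exact: bl.
apply: ge0_subset_integral => //.
- by have /integrableP[] := bl _ (ler0n _ (N + M)).
- by move=> t /=; rewrite !in_itv/= => /andP[/(le_trans _)-> //].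
Qed.
End HalfLineIntegrals.

(** * Square-integrable real functions *)

Section RealSquareIntegrable.
Context {R : realType}.
Notation mu := (@lebesgue_measure R).
Notation half_line := (@half_line R).
Implicit Types (f g h : R -> R).

Definition sqint f := measurable_fun half_line f /\
  mu.-integrable half_line (EFin \o (fun x => f x ^+ 2)).

Let mhl : measurable (half_line : set (measurableTypeR R)).
Proof. exact: measurable_half_line. Qed.

Lemma integrable_le f g : measurable_fun half_line f ->
  (forall x, half_line x -> `|f x| <= g x) ->
  mu.-integrable half_line (EFin \o g) -> mu.-integrable half_line (EFin \o f).
Proof.
move=> mf fg ig; apply: (le_integrable _ _ _ ig) => //.
  exact/measurable_EFinP.
by move=> x hx /=; rewrite lee_fin (le_trans (fg _ hx))// ler_norm.
Qed.

Lemma sqint_mul f g : sqint f -> sqint g ->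
  mu.-integrable half_line (EFin \o (fun x => f x * g x)).
Proof.
move=> [mf fi] [mg gi].
apply: (@integrable_le _ (fun x => f x ^+ 2 + g x ^+ 2)).
- exact: measurable_funM.
- move=> x _; rewrite normrM -(real_normK (num_real (f x))) -(real_normK (num_real (g x))).
  have := sqr_ge0 (`|f x| - `|g x|); have := sqr_ge0 (`|f x| + `|g x|).
  by move: (`|f x|) (`|g x|) => a b; nra.
- have := integrableD mhl fi gi; exact: eq_integrable.
Qed.

Lemma sqintD f g : sqint f -> sqint g -> sqint (fun x => f x + g x).
Proof.
move=> [mf fi] [mg gi]; split; first exact: measurable_funD.
apply: (@integrable_le _ (fun x => 2 * f x ^+ 2 + 2 * g x ^+ 2)).
- by apply: measurable_funX; exact: measurable_funD.
- move=> x _; rewrite ger0_norm ?sqr_ge0//.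
  have := sqr_ge0 (f x - g x); move: (f x) (g x) => a b; nra.
- have := integrableD mhl (integrableZl mhl 2 fi) (integrableZl mhl 2 gi).
  exact: eq_integrable.
Qed.

Lemma sqintZ k f : sqint f -> sqint (fun x => k * f x).
Proof.
move=> [mf fi]; split; first exact: measurable_funM.
have := integrableZl mhl (k ^+ 2) fi; apply: eq_integrable => // x _ /=.
by rewrite exprMn.
Qed.

Lemma sqint_locally f : sqint f -> locally_int f.
Proof.
move=> [mf fi] X X0.
have iX : mu.-integrable `[0, X] (EFin \o (fun x => 1 + f x ^+ 2)).
  exact: (locally_intD (locally_int_cst 1) (integrable_locally_int fi)).
apply: (le_integrable _ _ _ iX) => //.
  apply/measurable_EFinP; apply: measurable_funS mf => //.
  by move=> t /=; rewrite /Defs.half_line/= !in_itv/= andbT => /andP[].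
move=> x _ /=; rewrite lee_fin [leRHS]ger0_norm ?addr_ge0 ?sqr_ge0//.
rewrite -(real_normK (num_real (f x))).
by have := sqr_ge0 (`|f x| - 1); have := normr_ge0 (f x); move: (`|f x|) => a; nra.
Qed.

Lemma eq_sqint f g : (forall x, 0 <= x -> f x = g x) -> sqint f -> sqint g.
Proof.
move=> fg [mf fi]; have fg' : {in half_line, f =1 g}.
  by move=> x; rewrite inE /Defs.half_line /= in_itv/= andbT => /fg.
split; first exact: eq_measurable_fun fg' mf.
by apply: eq_integrable fi => // x /fg' /= ->.
Qed.

Lemma primitive_nondecreasing_on F f X Y : locally_int f -> primitive F f ->
  (forall x, 0 <= x -> x <= Y -> 0 <= f x) -> 0 <= X -> X <= Y -> F X <= F Y.
Proof.
move=> fi Ff f0 X0 XY; have Y0 := le_trans X0 XY.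
rewrite (Ff X)// (Ff Y)// lerD2l /Rintegral fine_le//.
- by apply: integrable_fin_num => //; exact: fi.
- by apply: integrable_fin_num => //; exact: fi.
apply: ge0_subset_integral => //.
- by have /integrableP[] := fi _ Y0.
- by move=> x /=; rewrite in_itv/= => /andP[x0 xY]; rewrite lee_fin f0.
- by move=> t /=; rewrite !in_itv/= => /andP[-> /le_trans]; apply.
Qed.

Lemma primitive_nondecreasing F f X Y : locally_int f -> primitive F f ->
  (forall x, 0 <= x -> 0 <= f x) -> 0 <= X -> X <= Y -> F X <= F Y.
Proof. by move=> fi Ff f0; apply: primitive_nondecreasing_on fi Ff _ => x x0 _; exact: f0. Qed.

Lemma is_derive_expRM (a x : R) :
  is_derive x 1 (fun x => expR (a * x)) (a * expR (a * x)).
Proof.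
have -> : (fun x : R => expR (a * x)) = expR \o ( *%R a) by [].
apply: is_derive_eq; by rewrite /GRing.scale /=; ring.
Qed.

Lemma continuous_expRM (a : R) : continuous (fun x => expR (a * x)).
Proof.
by move=> x; apply: continuous_comp; [exact: mulrl_continuous|exact: continuous_expR].
Qed.

Lemma primitive_expRM (a : R) :
  primitive (fun x => expR (a * x)) (fun x => a * expR (a * x)).
Proof.
apply: (primitive_C1 (@is_derive_expRM a)) => x.
by apply: cvgM; [exact: cvg_cst|exact: continuous_expRM].
Qed.

Lemma integral_expRN (a : R) : 0 < a ->
  mu.-integrable half_line (EFin \o (fun x => expR (- a * x))) /\
  \int[mu]_(x in half_line) expR (- a * x) = a^-1.
Proof.
move=> a0; have an0 : a != 0 by rewrite gt_eqF.
have el : locally_int (fun x => expR (- a * x)).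
  by apply: locally_int_continuous; exact: continuous_expRM.
have W : primitive (fun x => - a^-1 * expR (- a * x)) (fun x => expR (- a * x)).
  have := primitiveZ (- a^-1) (locally_intZ (- a) el) (@primitive_expRM (- a)).
  by apply: eq_primitive => // x _; rewrite mulrA mulrNN mulVf// mul1r.
have [ei _] : mu.-integrable half_line (EFin \o (fun x => expR (- a * x))) /\
    \int[mu]_(x in half_line) expR (- a * x) <= a^-1.
  apply: half_line_le => // X X0.
  have := W X X0; rewrite mulr0 expR0 mulr1 => /eqP; rewrite addrC -subr_eq => /eqP <-.
  by rewrite opprK gerDr mulNr oppr_le0 mulr_ge0 ?expR_ge0// invr_ge0 ltW.
split=> //; rewrite (half_line_boundary ei _ W).
  by rewrite mulr0 expR0 mulr1 opprK.
have := integrableZl mhl (- a^-1) ei; exact: eq_integrable.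
Qed.

Lemma sqint_expRN (a : R) : 0 < a -> sqint (fun x => expR (- a * x)).
Proof.
move=> a0; split; first by apply: locally_int_measurable; apply: locally_int_continuous; exact: continuous_expRM.
have a2 : 0 < 2 * a by rewrite mulr_gt0.
have [ei _] := integral_expRN a2.
apply: eq_integrable ei => // x _ /=.
by rewrite expr2 -expRD; congr (expR _)%:E; ring.
Qed.

(** With e x = exp (k x), the solution is g x = e x * \int_x^oo exp (- k t) f t dt: no
value at 0 is prescribed, the equation is integrated backwards from infinity.
Every other solution differs from it by a multiple of e. Boundedness of g comes
from (g^2)' + f^2 / (2 k) = 2 k (g - f / (2 k))^2 >= 0, applied to the solutions
vanishing at a point Y that tends to infinity; square integrability comes from
(g^2)' - k g^2 + f^2 / k = k (g - f / k)^2 >= 0. *)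
Lemma backward_equation (k : R) f : 0 < k -> sqint f ->
  exists g, sqint g /\ primitive g (fun x => k * g x - f x).
Proof.
move=> k0 fL; have [mf f2i] := fL.
have f2l := integrable_locally_int f2i.
have fl := sqint_locally fL.
pose e x := expR (k * x); pose em x := expR (- k * x).
have eem x : e x * em x = 1 by rewrite /e /em -expRD mulNr addrN expR0.
have emi : mu.-integrable half_line (EFin \o (fun x => em x * f x)).
  by apply: sqint_mul fL; exact: sqint_expRN.
pose H x := \int[mu]_(t in `[0, x]) (em t * f t).
pose Hoo := \int[mu]_(t in half_line) (em t * f t).
have Hl := integrable_locally_int emi.
have sol c : let g := fun x => e x * (c - H x) in
    [/\ primitive g (fun x => k * g x - f x), locally_int (fun x => k * g x - f x) & locally_int g].
  move=> g; have ce : locally_int (fun x => k * e x).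
    by apply/locally_intZ/locally_int_continuous; exact: continuous_expRM.
  have pc : primitive (fun x => c - H x) (fun x => 0 - em x * f x).
    apply: (primitiveB (locally_int_cst 0) Hl _ (primitive_integral _)).
    by move=> x x0; rewrite Rintegral_cst// mul0r addr0.
  have li := locally_intB (locally_int_cst 0) Hl.
  have pg := primitiveM ce li (@primitive_expRM k) pc.
  have E x : k * e x * (c - H x) + e x * (0 - em x * f x) = k * g x - f x.
    by rewrite sub0r mulrN [e x * (_ * _)]mulrA eem mul1r mulrA.
  have lg : locally_int (fun x => k * g x - f x).
    apply: eq_locally_int (fun x _ => E x) _; apply: locally_intD.
      apply: eq_locally_int (locally_intM li pc ce) => x _.
      by rewrite mulrC.
    exact: (locally_intM ce (@primitive_expRM k) li).
  have pg' : primitive g (fun x => k * g x - f x) by apply: eq_primitive pg.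
  by split => //; exact: primitive_locally_int lg pg'.
pose F2 := \int[mu]_(t in half_line) f t ^+ 2.
have If2 X : 0 <= X -> \int[mu]_(t in `[0, X]) f t ^+ 2 <= F2.
  by move=> X0; apply: half_line_ge => // x _; exact: sqr_ge0.
have I0 h : \int[mu]_(t in `[0, 0]) h t = 0 by rewrite set_itv1 Rintegral_set1.
have sq g : primitive g (fun x => k * g x - f x) -> locally_int (fun x => k * g x - f x) ->
    locally_int (fun x => 2 * (g x * (k * g x - f x))) /\
    primitive (fun x => g x ^+ 2) (fun x => 2 * (g x * (k * g x - f x))).
  move=> pg dl; split; first exact/locally_intZ/(locally_intM dl pg dl).
  by apply: eq_primitive (primitiveM dl dl pg pg) => // x _; ring.
have bnd c X Y : 0 <= X -> X <= Y ->
    (e X * (c - H X)) ^+ 2 <= (e Y * (c - H Y)) ^+ 2 + (2 * k)^-1 * F2.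
  move=> X0 XY; have [] := sol c; set g := fun x => _ => pg dl gl.
  have c2 : 0 < (2 * k)^-1 by rewrite invr_gt0 mulr_gt0.
  have [dl2 pg2] := sq g pg dl.
  have dfl := locally_intZ (2 * k)^-1 f2l.
  have pP := primitiveD dl2 dfl pg2 (primitiveZ _ f2l (primitive_integral _)).
  have := primitive_nondecreasing (locally_intD dl2 dfl) pP _ X0 XY.
  move=> /= /(_ _)/wrap[x _|].
    have -> : 2 * (g x * (k * g x - f x)) + (2 * k)^-1 * f x ^+ 2 =
        2 * k * (g x - (2 * k)^-1 * f x) ^+ 2 by field; rewrite gt_eqF.
    by rewrite mulr_ge0 ?sqr_ge0// mulr_ge0// ltW.
  rewrite -/(g X) -/(g Y) => h.
  have h1 : 0 <= \int[mu]_(t in `[0, X]) f t ^+ 2.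
    by apply: Rintegral_ge0 => t _; exact: sqr_ge0.
  have h2 := If2 Y (le_trans X0 XY).
  rewrite (le_trans _ (le_trans h _))//; first by rewrite lerDl mulr_ge0// ltW.
  by rewrite lerD2l ler_pM2l.
pose g x := e x * (Hoo - H x).
have [pg dl gl] := sol Hoo; rewrite -/g in pg dl gl.
have B0 : 0 <= (2 * k)^-1 * F2.
  rewrite mulr_ge0//; first by rewrite invr_ge0 mulr_ge0// ltW.
  by apply: Rintegral_ge0 => t _; exact: sqr_ge0.
pose B := Num.sqrt ((2 * k)^-1 * F2).
have gB X : 0 <= X -> `|g X| <= B.
  move=> X0; apply/ler_addgt0Pr => eps eps0.
  have [N HN] := half_line_tail_small emi (divr_gt0 eps0 (expR_gt0 (k * X))).
  pose Y := Num.max N%:R X; have XY : X <= Y by rewrite le_max lexx orbT.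
  have := HN Y; rewrite le_max lexx => /(_ isT) HY.
  have -> : g X = e X * (H Y - H X) + e X * (Hoo - H Y) by rewrite /g; ring.
  apply: le_trans (ler_normD _ _) _; apply: lerD.
    rewrite -sqrtr_sqr ler_wsqrtr//.
    by have := bnd (H Y) X Y X0 XY; rewrite subrr mulr0 expr0n add0r.
  by rewrite normrM gtr0_norm ?expR_gt0// mulrC -ler_pdivlMr ?expR_gt0// ltW.
have [dl2 pg2] := sq g pg dl.
have g2l : locally_int (fun x => g x ^+ 2).
  by apply: eq_locally_int (locally_intM dl pg gl).
exists g; split=> //; split; first exact: locally_int_measurable.
apply: (proj1 (@half_line_le _ _ (k^-1 * (B ^+ 2 + k^-1 * F2)) _ _ _)) => //.
  by move=> x _; exact: sqr_ge0.
move=> X X0.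
have c1 : 0 < k^-1 by rewrite invr_gt0.
have q1 := locally_intZ k^-1 f2l; have q2 := locally_intZ k g2l.
have pQ := primitiveD (locally_intB dl2 q2) q1
  (primitiveB dl2 q2 pg2 (primitiveZ k g2l (primitive_integral _)))
  (primitiveZ k^-1 f2l (primitive_integral _)).
have := primitive_nondecreasing (locally_intD (locally_intB dl2 q2) q1) pQ _ (lexx 0) X0.
move=> /= /(_ _)/wrap[x _|].
  have -> : 2 * (g x * (k * g x - f x)) - k * g x ^+ 2 + k^-1 * f x ^+ 2 =
      k * (g x - k^-1 * f x) ^+ 2 by field; rewrite gt_eqF.
  by rewrite mulr_ge0 ?sqr_ge0// ltW.
rewrite !I0 !mulr0 subr0 addr0 => h.
rewrite -ler_pdivrMl ?invrK//.
have gX : g X ^+ 2 <= B ^+ 2.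
  by rewrite -(real_normK (num_real (g X))) lerXn2r ?nnegrE ?sqrtr_ge0// gB.
have h2 : k^-1 * \int[mu]_(t in `[0, X]) f t ^+ 2 <= k^-1 * F2.
  by rewrite ler_pM2l// If2.
have h3 := sqr_ge0 (g 0).
move: h gX h2 h3; set a := g 0 ^+ 2; set b := g X ^+ 2; set i1 := _ * _; set i2 := k^-1 * _.
set i3 := k^-1 * F2; move: a b i1 i2 i3 (B ^+ 2) => a b i1 i2 i3 B2; clear; lra.
Qed.
End RealSquareIntegrable.

(** * Complex-valued primitives and exponentials *)

Section ComplexParts.
Context {R : realType}.
Implicit Types (z w : R[i]).

Lemma complex_ReD z w : complex.Re (z + w) = complex.Re z + complex.Re w.
Proof. by case: z w => [? ?] [? ?]. Qed.
Lemma complex_ImD z w : complex.Im (z + w) = complex.Im z + complex.Im w.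
Proof. by case: z w => [? ?] [? ?]. Qed.
Lemma complex_ReN z : complex.Re (- z) = - complex.Re z.
Proof. by case: z. Qed.
Lemma complex_ImN z : complex.Im (- z) = - complex.Im z.
Proof. by case: z. Qed.
Lemma complex_ReM z w :
  complex.Re (z * w) = complex.Re z * complex.Re w - complex.Im z * complex.Im w.
Proof. by case: z w => [? ?] [? ?]. Qed.
Lemma complex_ImM z w :
  complex.Im (z * w) = complex.Re z * complex.Im w + complex.Im z * complex.Re w.
Proof. by case: z w => [? ?] [? ?]. Qed.
Lemma complex_Re_conj z : complex.Re (conjc z) = complex.Re z.
Proof. by case: z. Qed.
Lemma complex_Im_conj z : complex.Im (conjc z) = - complex.Im z.
Proof. by case: z. Qed.

Definition complex_partsE := (complex_ReD, complex_ImD, complex_ReN, complex_ImN,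
  complex_ReM, complex_ImM, complex_Re_conj, complex_Im_conj).

Lemma complex_ext z w : complex.Re z = complex.Re w -> complex.Im z = complex.Im w -> z = w.
Proof. by case: z w => [? ?] [? ?] /= -> ->. Qed.

Lemma sqr_normM z w : sqr_norm (z * w) = sqr_norm z * sqr_norm w.
Proof. by rewrite /sqr_norm !complex_partsE; ring. Qed.

Lemma sqr_norm_eq0 z : (sqr_norm z == 0) = (z == 0).
Proof.
case: z => a b; rewrite /sqr_norm /= paddr_eq0 ?sqr_ge0// !sqrf_eq0.
by apply/andP/eqP => [[/eqP -> /eqP ->]//|[-> ->]].
Qed.

Lemma sqr_normD_le z w : sqr_norm (z + w) <= 2 * sqr_norm z + 2 * sqr_norm w.
Proof.
rewrite /sqr_norm !complex_partsE.
have := sqr_ge0 (complex.Re z - complex.Re w); have := sqr_ge0 (complex.Im z - complex.Im w).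
move: (complex.Re z) (complex.Im z) (complex.Re w) (complex.Im w) => a b c d; nra.
Qed.

End ComplexParts.

Section ComplexPrimitives.
Context {R : realType}.
Notation mu := (@lebesgue_measure R).
Notation half_line := (@half_line R).
Implicit Types (f g h s v : R -> R[i]) (c z : R[i]).

Definition locally_intC f :=
  locally_int (fun x => complex.Re (f x)) /\ locally_int (fun x => complex.Im (f x)).

Lemma is_primitiveE f g : is_primitive f g <->
  primitive (fun x => complex.Re (f x)) (fun x => complex.Re (g x)) /\
  primitive (fun x => complex.Im (f x)) (fun x => complex.Im (g x)).
Proof.
split=> [fg|[re im] x x0].
  by split=> x x0; rewrite (fg x x0) complex_partsE.
by apply: complex_ext; [rewrite complex_ReD; exact: re|rewrite complex_ImD; exact: im].
Qed.

Lemma eq_locally_intC f g : (forall x, 0 <= x -> f x = g x) -> locally_intC f -> locally_intC g.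
Proof. by move=> fg [a b]; split; [move: a|move: b]; apply: eq_locally_int => x /fg ->. Qed.

Lemma eq_is_primitive f f' g g' : (forall x, 0 <= x -> f x = f' x) ->
  (forall x, 0 <= x -> g x = g' x) -> is_primitive f g -> is_primitive f' g'.
Proof.
move=> ff gg /is_primitiveE[a b]; apply/is_primitiveE; split; [move: a|move: b];
by apply: eq_primitive => x x0; rewrite ?ff ?gg.
Qed.

Lemma locally_intCD f g : locally_intC f -> locally_intC g -> locally_intC (fun x => f x + g x).
Proof.
move=> [a b] [a' b']; split.
  by apply: eq_locally_int (locally_intD a a') => x _; rewrite complex_partsE.
by apply: eq_locally_int (locally_intD b b') => x _; rewrite complex_partsE.
Qed.

Lemma locally_intCZ c f : locally_intC f -> locally_intC (fun x => c * f x).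
Proof.
move=> [a b]; split.
  by apply: eq_locally_int (locally_intB (locally_intZ (complex.Re c) a)
    (locally_intZ (complex.Im c) b)) => x _; rewrite complex_partsE.
by apply: eq_locally_int (locally_intD (locally_intZ (complex.Re c) b)
  (locally_intZ (complex.Im c) a)) => x _; rewrite complex_partsE.
Qed.

Lemma locally_intCB f g : locally_intC f -> locally_intC g -> locally_intC (fun x => f x - g x).
Proof.
move=> a /(locally_intCZ (-1)) b; apply: eq_locally_intC (locally_intCD a b) => x _.
by rewrite mulN1r.
Qed.

Lemma is_primitiveD F f G g : locally_intC f -> locally_intC g ->
  is_primitive F f -> is_primitive G g -> is_primitive (fun x => F x + G x) (fun x => f x + g x).
Proof.
move=> [a b] [a' b'] /is_primitiveE[p q] /is_primitiveE[p' q']; apply/is_primitiveE; split.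
  by apply: eq_primitive (primitiveD a a' p p') => x _; rewrite complex_partsE.
by apply: eq_primitive (primitiveD b b' q q') => x _; rewrite complex_partsE.
Qed.

Lemma is_primitiveZ c F f : locally_intC f ->
  is_primitive F f -> is_primitive (fun x => c * F x) (fun x => c * f x).
Proof.
move=> [a b] /is_primitiveE[p q]; apply/is_primitiveE.
set cr := complex.Re c; set ci := complex.Im c; split.
  by apply: eq_primitive (primitiveB (locally_intZ cr a) (locally_intZ ci b)
    (primitiveZ cr a p) (primitiveZ ci b q)) => x _; rewrite complex_partsE.
by apply: eq_primitive (primitiveD (locally_intZ cr b) (locally_intZ ci a)
  (primitiveZ cr b q) (primitiveZ ci a p)) => x _; rewrite complex_partsE.
Qed.

Lemma is_primitiveB F f G g : locally_intC f -> locally_intC g ->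
  is_primitive F f -> is_primitive G g -> is_primitive (fun x => F x - G x) (fun x => f x - g x).
Proof.
move=> fi gi Ff Gg.
apply: eq_is_primitive (is_primitiveD fi (locally_intCZ (-1) gi) Ff (is_primitiveZ (-1) gi Gg)).
  by move=> x _; rewrite mulN1r.
by move=> x _; rewrite mulN1r.
Qed.

Lemma locally_intC_cst c : locally_intC (fun=> c).
Proof. by split; exact: locally_int_cst. Qed.

Lemma is_primitive0 c : is_primitive (fun=> c) (fun=> 0).
Proof.
by apply/is_primitiveE; split; exact: primitive_cst.
Qed.

Lemma locally_intC_sum I (r : seq I) (f : I -> R -> R[i]) :
  (forall i, locally_intC (f i)) -> locally_intC (fun x => \sum_(i <- r) f i x).
Proof.
move=> fi; elim: r => [|i r ih].
  by apply: eq_locally_intC (locally_intC_cst 0) => x _; rewrite big_nil.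
by apply: eq_locally_intC (locally_intCD (fi i) ih) => x _; rewrite big_cons.
Qed.

Lemma is_primitive_sum I (r : seq I) (F f : I -> R -> R[i]) :
  (forall i, locally_intC (f i)) -> (forall i, is_primitive (F i) (f i)) ->
  is_primitive (fun x => \sum_(i <- r) F i x) (fun x => \sum_(i <- r) f i x).
Proof.
move=> fi Ff; elim: r => [|i r ih].
  by apply: eq_is_primitive (is_primitive0 0) => x _; rewrite big_nil.
by apply: eq_is_primitive (is_primitiveD (fi i) (locally_intC_sum r fi) (Ff i) ih) => x _;
  rewrite big_cons.
Qed.

Lemma is_primitive_locally_int F f : locally_intC f -> is_primitive F f -> locally_intC F.
Proof.
move=> [a b] /is_primitiveE[p q]; split; [exact: primitive_locally_int a p|exact: primitive_locally_int b q].
Qed.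

Lemma locally_intCM F f g : locally_intC f -> is_primitive F f -> locally_intC g ->
  locally_intC (fun x => F x * g x).
Proof.
move=> [a b] /is_primitiveE[p q] [a' b']; split.
  by apply: eq_locally_int (locally_intB (locally_intM a p a') (locally_intM b q b')) => x _;
  rewrite complex_partsE.
by apply: eq_locally_int (locally_intD (locally_intM a p b') (locally_intM b q a')) => x _;
  rewrite complex_partsE.
Qed.

Lemma is_primitiveM F f G g : locally_intC f -> locally_intC g ->
  is_primitive F f -> is_primitive G g ->
  is_primitive (fun x => F x * G x) (fun x => f x * G x + F x * g x).
Proof.
move=> [a b] [a' b'] /is_primitiveE[p q] /is_primitiveE[p' q']; apply/is_primitiveE.
have l1 := locally_intM a p a'; have l2 := locally_intM a' p' a.
have l3 := locally_intM b q b'; have l4 := locally_intM b' q' b.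
have l5 := locally_intM a p b'; have l6 := locally_intM a' p' b.
have l7 := locally_intM b q a'; have l8 := locally_intM b' q' a.
have sw (u w : R -> R) : locally_int (fun x => w x * u x) -> locally_int (fun x => u x * w x).
  by apply: eq_locally_int => x _; rewrite mulrC.
split.
  apply: eq_primitive (primitiveB (locally_intD (sw _ _ l2) l1) (locally_intD (sw _ _ l4) l3)
    (primitiveM a a' p p') (primitiveM b b' q q')) => x _; first by rewrite complex_partsE.
  by rewrite !complex_partsE; ring.
apply: eq_primitive (primitiveD (locally_intD (sw _ _ l8) l5) (locally_intD (sw _ _ l6) l7)
    (primitiveM a b' p q') (primitiveM b a' q p')) => x _; first by rewrite complex_partsE.
by rewrite !complex_partsE; ring.
Qed.

Lemma is_primitive_integral f :
  is_primitive (fun x => Cintegral `[0, x] f) f.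
Proof. by apply/is_primitiveE; split; exact: primitive_integral. Qed.

Definition cexp z (x : R) : R[i] :=
  Complex (expR (complex.Re z * x) * cos (complex.Im z * x))
          (expR (complex.Re z * x) * sin (complex.Im z * x)).

Lemma cexp0 z : cexp z 0 = 1.
Proof. by rewrite /cexp !mulr0 expR0 cos0 sin0 !mul1r. Qed.

Lemma cexpVM z x : cexp z x * cexp (- z) x = 1.
Proof.
apply: complex_ext; rewrite complex_partsE/= !complex_partsE !mulNr cosN sinN expRN.
  have -> : forall e c s : R, e * c * (e^-1 * c) - e * s * (e^-1 * - s) =
      (e * e^-1) * (c ^+ 2 + s ^+ 2) by move=> e c s; ring.
  by rewrite cos2Dsin2 mulr1 divff// gt_eqF// expR_gt0.
ring.
Qed.

Lemma sqr_norm_cexp z x : sqr_norm (cexp z x) = expR (2 * complex.Re z * x).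
Proof.
rewrite /sqr_norm /cexp /= !exprMn -mulrDr cos2Dsin2 mulr1 expr2 -expRD.
by congr expR; ring.
Qed.

Lemma locally_intC_cexp z : locally_intC (cexp z).
Proof.
have cc (k : R) : continuous (fun x : R => cos (k * x)).
  by move=> x; apply: continuous_comp; [exact: mulrl_continuous|exact: continuous_cos].
have cs (k : R) : continuous (fun x : R => sin (k * x)).
  by move=> x; apply: continuous_comp; [exact: mulrl_continuous|exact: continuous_sin].
by split; apply: locally_int_continuous => x; apply: cvgM;
  [exact: continuous_expRM|exact: cc|exact: continuous_expRM|exact: cs].
Qed.

Lemma is_primitive_cexp z : is_primitive (cexp z) (fun x => z * cexp z x).
Proof.
have dc (k x : R) : is_derive x 1 (fun x => cos (k * x)) (- k * sin (k * x)).
  have -> : (fun x : R => cos (k * x)) = cos \o ( *%R k) by [].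
  by apply: is_derive_eq; rewrite /GRing.scale /=; ring.
have ds (k x : R) : is_derive x 1 (fun x => sin (k * x)) (k * cos (k * x)).
  have -> : (fun x : R => sin (k * x)) = sin \o ( *%R k) by [].
  by apply: is_derive_eq; rewrite /GRing.scale /=; ring.
have cc (k : R) : continuous (fun x : R => cos (k * x)).
  by move=> x; apply: continuous_comp; [exact: mulrl_continuous|exact: continuous_cos].
have cs (k : R) : continuous (fun x : R => sin (k * x)).
  by move=> x; apply: continuous_comp; [exact: mulrl_continuous|exact: continuous_sin].
have pc (k : R) : primitive (fun x : R => cos (k * x)) (fun x => - k * sin (k * x)).
  by apply: (primitive_C1 (dc k)) => x; apply: cvgM; [exact: cvg_cst|exact: cs].
have ps (k : R) : primitive (fun x : R => sin (k * x)) (fun x => k * cos (k * x)).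
  by apply: (primitive_C1 (ds k)) => x; apply: cvgM; [exact: cvg_cst|exact: cc].
have le := locally_intZ (complex.Re z) (locally_int_continuous (@continuous_expRM _ (complex.Re z))).
apply/is_primitiveE; split => /=.
  apply: eq_primitive (primitiveM le (locally_intZ _ (locally_int_continuous (cs (complex.Im z))))
    (@primitive_expRM _ (complex.Re z)) (pc (complex.Im z))) => // x _.
  by rewrite complex_partsE /=; ring.
apply: eq_primitive (primitiveM le (locally_intZ _ (locally_int_continuous (cc (complex.Im z))))
    (@primitive_expRM _ (complex.Re z)) (ps (complex.Im z))) => // x _.
by rewrite complex_partsE /=; ring.
Qed.

End ComplexPrimitives.

(** * First-order equations with square-integrable data *)

Section ComplexSquareIntegrable.
Context {R : realType}.
Notation mu := (@lebesgue_measure R).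
Notation half_line := (@half_line R).
Implicit Types (f g h s v w : R -> R[i]) (c z : R[i]).

Let mhl : measurable (half_line : set (measurableTypeR R)).
Proof. exact: measurable_half_line. Qed.

Definition sqr_L2norm f : R := \int[mu]_(x in half_line) sqr_norm (f x).

Lemma square_integrableE f : square_integrable f <->
  sqint (fun x => complex.Re (f x)) /\ sqint (fun x => complex.Im (f x)).
Proof.
split=> [[mr mi I]|[[mr ri] [mi ii]]].
  have Ni : mu.-integrable half_line (EFin \o (fun x => sqr_norm (f x))).
    apply/integrableP; split.
      exact: measurable_sqr_norm.
    apply: le_lt_trans I; rewrite le_eqVlt; apply/orP; left; apply/eqP.
    by apply: eq_integral => x _ /=; rewrite ger0_norm// sqr_norm_ge0.
  split; split=> //; apply: integrable_le Ni.
  - exact: measurable_funX.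
  - by move=> x _; rewrite ger0_norm ?sqr_ge0// /sqr_norm lerDl sqr_ge0.
  - exact: measurable_funX.
  - by move=> x _; rewrite ger0_norm ?sqr_ge0// /sqr_norm lerDr sqr_ge0.
split=> //; have := integrableD mhl ri ii => /integrable_lty; exact.
Qed.

Lemma integrable_sqr_norm f : square_integrable f ->
  mu.-integrable half_line (EFin \o (fun x => sqr_norm (f x))).
Proof.
by move=> /square_integrableE[[_ a] [_ b]]; apply: eq_integrable (integrableD mhl a b).
Qed.

Lemma sqr_L2norm_ge0 f : 0 <= sqr_L2norm f.
Proof. by apply: Rintegral_ge0 => x _; exact: sqr_norm_ge0. Qed.

Lemma eq_square_integrable f g : (forall x, 0 <= x -> f x = g x) ->
  square_integrable f -> square_integrable g.
Proof.
move=> fg /square_integrableE[a b]; apply/square_integrableE; split; [move: a|move: b];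
by apply: eq_sqint => x /fg ->.
Qed.

Lemma sqr_L2norm0 : sqr_L2norm (fun=> 0) = 0.
Proof.
rewrite /sqr_L2norm (_ : (fun x => _) = cst 0); last first.
  by apply/funext => t; rewrite /sqr_norm/= expr0n addr0.
by rewrite Rintegral_cst// mul0r.
Qed.

Lemma eq_sqr_L2norm f g : (forall x, 0 <= x -> f x = g x) -> sqr_L2norm f = sqr_L2norm g.
Proof.
move=> fg; apply: eq_Rintegral => x.
by rewrite inE /Defs.half_line /= in_itv/= andbT => /fg ->.
Qed.

Lemma square_integrable_locally f : square_integrable f -> locally_intC f.
Proof. by move=> /square_integrableE[a b]; split; exact: sqint_locally. Qed.

Lemma square_integrable_fD f g : square_integrable f -> square_integrable g ->
  square_integrable (fun x => f x + g x).
Proof. exact: square_integrableD. Qed.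

Lemma square_integrable_fZ c f : square_integrable f -> square_integrable (fun x => c * f x).
Proof. exact: square_integrableZ. Qed.

Lemma square_integrable_fB f g : square_integrable f -> square_integrable g ->
  square_integrable (fun x => f x - g x).
Proof.
move=> fi /(square_integrable_fZ (-1)) gi.
by apply: eq_square_integrable (square_integrable_fD fi gi) => x _; rewrite mulN1r.
Qed.

Lemma square_integrable_sum I (r : seq I) (f : I -> R -> R[i]) :
  (forall i, square_integrable (f i)) -> square_integrable (fun x => \sum_(i <- r) f i x).
Proof.
move=> fi; elim: r => [|i r ih].
  by apply: eq_square_integrable square_integrable0 => x _; rewrite big_nil.
by apply: eq_square_integrable (square_integrable_fD (fi i) ih) => x _; rewrite big_cons.
Qed.

Lemma sqr_L2normZ c f : square_integrable f ->
  sqr_L2norm (fun x => c * f x) = sqr_norm c * sqr_L2norm f.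
Proof.
move=> fi; rewrite -RintegralZl//; last exact: integrable_sqr_norm.
by apply: eq_Rintegral => x _; rewrite sqr_normM.
Qed.

Lemma sqr_L2normD_le f g : square_integrable f -> square_integrable g ->
  sqr_L2norm (fun x => f x + g x) <= 2 * sqr_L2norm f + 2 * sqr_L2norm g.
Proof.
move=> fi gi; have fi' := integrable_sqr_norm fi; have gi' := integrable_sqr_norm gi.
have a := integrableZl mhl 2 fi'; have b := integrableZl mhl 2 gi'.
rewrite -RintegralZl// -RintegralZl// -RintegralD//.
apply: le_Rintegral => //.
- exact/integrable_sqr_norm/square_integrable_fD.
- exact: eq_integrable (integrableD mhl a b).
- by move=> x _; exact: sqr_normD_le.
Qed.

Lemma primitive_sqr_norm s s1 : locally_intC s1 -> is_primitive s s1 ->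
  let n1 := fun x => 2 * (complex.Re (s x) * complex.Re (s1 x) + complex.Im (s x) * complex.Im (s1 x)) in
  locally_int n1 /\ primitive (fun x => sqr_norm (s x)) n1.
Proof.
move=> [a b] /is_primitiveE[p q] n1.
have l1 := locally_intM a p a; have l2 := locally_intM b q b.
have l3 : locally_int n1 by apply/locally_intZ/locally_intD.
split=> //.
have l1' : locally_int (fun x => complex.Re (s1 x) * complex.Re (s x)).
  by apply: eq_locally_int l1 => x _; rewrite mulrC.
have l2' : locally_int (fun x => complex.Im (s1 x) * complex.Im (s x)).
  by apply: eq_locally_int l2 => x _; rewrite mulrC.
apply: eq_primitive (primitiveD (locally_intD l1' l1) (locally_intD l2' l2)
  (primitiveM a a p p) (primitiveM b b q q)) => x _; first by rewrite /sqr_norm !expr2.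
by rewrite /n1; ring.
Qed.

Lemma locally_int_sqr_norm s s1 : locally_intC s1 -> is_primitive s s1 ->
  locally_int (fun x => sqr_norm (s x)).
Proof.
by move=> li p; have [l q] := primitive_sqr_norm li p; exact: primitive_locally_int l q.
Qed.

(** Multiply s' = v - z s by the conjugate of s and take real parts: with a = Re z,
(|s|^2)' + a |s|^2 = |v|^2 / a - a |s - v / a|^2. *)
Lemma forward_energy z s v (X : R) : 0 < complex.Re z -> locally_intC s -> square_integrable v ->
  is_primitive s (fun x => v x - z * s x) -> 0 <= X ->
  sqr_norm (s X) + complex.Re z * \int[mu]_(t in `[0, X]) sqr_norm (s t) <=
  sqr_norm (s 0) + (complex.Re z)^-1 * sqr_L2norm v.
Proof.
move=> z0 sl vi p X0; set a := complex.Re z in z0 *.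
have s1l := locally_intCB (square_integrable_locally vi) (locally_intCZ z sl).
have [nl np] := primitive_sqr_norm s1l p.
have sn := locally_int_sqr_norm s1l p.
have vn := integrable_locally_int (integrable_sqr_norm vi).
have q1 := locally_intZ a^-1 vn; have q2 := locally_intZ a sn.
have P := primitiveB q1 (locally_intD nl q2) (primitiveZ a^-1 vn (primitive_integral _))
  (primitiveD nl q2 np (primitiveZ a sn (primitive_integral _))).
have := primitive_nondecreasing (locally_intB q1 (locally_intD nl q2)) P _ (lexx 0) X0.
move=> /= /(_ _)/wrap[x _|].
  rewrite !complex_partsE /sqr_norm -/a; set r := complex.Re (s x); set i := complex.Im (s x).
  set u := complex.Re (v x); set w := complex.Im (v x); set b := complex.Im z.
  have -> : a^-1 * (u ^+ 2 + w ^+ 2) -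
     (2 * (r * (u - (a * r - b * i)) + i * (w - (a * i + b * r))) + a * (r ^+ 2 + i ^+ 2)) =
     a * ((r - a^-1 * u) ^+ 2 + (i - a^-1 * w) ^+ 2) by field; rewrite gt_eqF.
  by apply: mulr_ge0; [exact: ltW|rewrite addr_ge0 ?sqr_ge0].
rewrite !set_itv1 !Rintegral_set1 !mulr0 addr0 sub0r.
have h : a^-1 * \int[mu]_(t in `[0, X]) sqr_norm (v t) <= a^-1 * sqr_L2norm v.
  rewrite ler_pM2l ?invr_gt0// half_line_ge//; last exact: integrable_sqr_norm.
  by move=> x _; exact: sqr_norm_ge0.
rewrite lerBrDl -lerBrDr opprK => le1.
rewrite (le_trans le1)//  addrC lerD2l.
exact: h.
Qed.

(** Let X tend to infinity in [forward_energy]. *)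
Lemma forward_bound z s v : 0 < complex.Re z -> locally_intC s -> square_integrable v ->
  is_primitive s (fun x => v x - z * s x) -> s 0 = 0 ->
  square_integrable s /\ sqr_L2norm s <= (complex.Re z)^-1 ^+ 2 * sqr_L2norm v.
Proof.
move=> z0 sl vi p s0.
have s1l := locally_intCB (square_integrable_locally vi) (locally_intCZ z sl).
have sn := locally_int_sqr_norm s1l p.
have [] := @half_line_le _ _ ((complex.Re z)^-1 ^+ 2 * sqr_L2norm v)
  (fun x _ => sqr_norm_ge0 (s x)) sn.
  move=> X X0; have := forward_energy z0 sl vi p X0.
  rewrite s0 /sqr_norm/= expr0n addr0 add0r -/(sqr_norm (s X)) => h.
  rewrite expr2 -mulrA -ler_pdivrMl ?invr_gt0// invrK.
  by apply: le_trans h; rewrite lerDr sqr_norm_ge0.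
move=> si le; split=> //; split.
- by apply: locally_int_measurable; exact: sl.1.
- by apply: locally_int_measurable; exact: sl.2.
- by move/integrable_lty : si; apply.
Qed.

(** The variation of constants formula for s' + z s = v with s 0 = 0. *)
Definition forward z v (x : R) : R[i] :=
  cexp (- z) x * Cintegral `[0, x] (fun t => cexp z t * v t).

Lemma forward0 z v : forward z v 0 = 0.
Proof.
rewrite /forward cexp0 mul1r /Cintegral set_itv1 !Rintegral_set1.
by [].
Qed.

Lemma forwardP z v : locally_intC v ->
  is_primitive (forward z v) (fun x => v x - z * forward z v x) /\ locally_intC (forward z v).
Proof.
move=> vl.
have le := locally_intCZ (-z) (@locally_intC_cexp _ (- z)).
have lv := locally_intCM (locally_intCZ z (@locally_intC_cexp _ z)) (@is_primitive_cexp _ z) vl.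
have p := is_primitiveM le lv (@is_primitive_cexp _ (- z)) (is_primitive_integral _).
have lI := is_primitive_locally_int lv (is_primitive_integral _).
have E x : - z * cexp (- z) x * Cintegral `[0, x] (fun t => cexp z t * v t) +
    cexp (- z) x * (cexp z x * v x) = v x - z * forward z v x.
  by rewrite [cexp (- z) x * (_ * _)]mulrA [cexp (- z) x * cexp z x]mulrC cexpVM /forward; ring.
have q : is_primitive (forward z v) (fun x => v x - z * forward z v x).
  by apply: eq_is_primitive p.
split=> //; apply: is_primitive_locally_int q.
apply: eq_locally_intC (fun x _ => E x) _.
apply: locally_intCD; last exact: (locally_intCM le (@is_primitive_cexp _ (- z)) lv).
by apply: eq_locally_intC (locally_intCM lv (is_primitive_integral _) le) => x _; rewrite mulrC.
Qed.

(** The difference of two solutions satisfies [forward_energy] with zero data. *)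
Lemma forward_uniq z s v : 0 < complex.Re z -> locally_intC s -> locally_intC v ->
  is_primitive s (fun x => v x - z * s x) -> s 0 = 0 ->
  forall x, 0 <= x -> s x = forward z v x.
Proof.
move=> z0 sl vl p s0 x x0.
have [q ql] := forwardP z vl.
have s1l := locally_intCB vl (locally_intCZ z sl).
have q1l := locally_intCB vl (locally_intCZ z ql).
have d : is_primitive (fun x => s x - forward z v x)
    (fun x => 0 - z * (s x - forward z v x)).
  by apply: eq_is_primitive (is_primitiveB s1l q1l p q) => // t _; ring.
have := forward_energy z0 (locally_intCB sl ql) square_integrable0 d x0.
rewrite s0 forward0 subr0.
rewrite (_ : sqr_L2norm 0 = 0); last exact: sqr_L2norm0.
rewrite mulr0 addr0 [sqr_norm 0]/sqr_norm/= expr0n addr0 => h.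
apply/eqP; rewrite -subr_eq0 -sqr_norm_eq0 eq_le sqr_norm_ge0 andbT.
apply: le_trans h; rewrite lerDl; apply: mulr_ge0; first exact: ltW.
by apply: Rintegral_ge0 => t _; exact: sqr_norm_ge0.
Qed.

Lemma forward_linear z c v w : 0 < complex.Re z -> locally_intC v -> locally_intC w ->
  forall x, 0 <= x -> forward z (fun t => c * v t + w t) x = c * forward z v x + forward z w x.
Proof.
move=> z0 vl wl x x0; apply/esym; move: x x0; apply: forward_uniq => //.
- by apply: locally_intCD; [apply: locally_intCZ|]; exact: (forwardP z _).2.
- by apply: locally_intCD => //; exact: locally_intCZ.
- have [p pl] := forwardP z vl; have [q ql] := forwardP z wl.
  have p1 := locally_intCB vl (locally_intCZ z pl).
  have q1 := locally_intCB wl (locally_intCZ z ql).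
  by apply: eq_is_primitive (is_primitiveD (locally_intCZ c p1) q1 (is_primitiveZ c p1 p) q)
    => // t _; ring.
- by rewrite !forward0 mulr0 addr0.
Qed.

Lemma backward_equationC (k : R) f : 0 < k -> square_integrable f ->
  exists g, square_integrable g /\ is_primitive g (fun x => Complex k 0 * g x - f x).
Proof.
move=> k0 /square_integrableE[fr fi].
have [a [al ap]] := backward_equation k0 fr.
have [b [bl bp]] := backward_equation k0 fi.
exists (fun x => Complex (a x) (b x)); split; first exact/square_integrableE.
by apply/is_primitiveE; split; [move: ap|move: bp]; apply: eq_primitive => // x _;
  rewrite !complex_partsE/= mul0r ?subr0 ?addr0.
Qed.

End ComplexSquareIntegrable.

(** * The Hilbert space of the star graph *)

Section L2Space.
Context {R : realType} {d : nat}.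
Notation mu := (@lebesgue_measure R).
Notation half_line := (@half_line R).
Implicit Types (f g h : L2fun R d) (c : R[i]).

Let mhl : measurable (half_line : set (measurableTypeR R)).
Proof. exact: measurable_half_line. Qed.

Lemma L2fun_square_integrable f e : square_integrable (f e).
Proof. by have /L2_predP := valP f; apply. Qed.

Definition mkL2 (f : 'I_d -> R -> R[i]) (H : forall e, square_integrable (f e)) : L2fun R d :=
  MkL2fun (introT (L2_predP f) H).

Lemma L2funD f g e t : L2fun_val (f + g) e t = f e t + g e t. Proof. by []. Qed.
Lemma L2funB f g e t : L2fun_val (f - g) e t = f e t - g e t. Proof. by []. Qed.
Lemma L2funN f e t : L2fun_val (- f) e t = - f e t. Proof. by []. Qed.
Lemma L2funZ c f e t : L2fun_val (c *: f) e t = c * f e t. Proof. by []. Qed.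

Definition sqn f : R := \sum_e sqr_L2norm (f e).

Lemma sqn_ge0 f : 0 <= sqn f.
Proof. by apply: sumr_ge0 => e _; exact: sqr_L2norm_ge0. Qed.

Lemma sqn_eq0 f : (sqn f == 0) = (f \in null_pred).
Proof.
have F := ae_filter_ringOfSetsType
  (lebesgue_measure : {measure set (measurableTypeR R) -> \bar R}).
have pe e : reflect (f e = cst 0 %[ae mu in half_line]) (sqr_L2norm (f e) == 0).
  have fi := integrable_sqr_norm (L2fun_square_integrable f e).
  have mf : measurable_fun half_line (EFin \o (fun x => sqr_norm (f e x))).
    by case/integrableP : fi.
  have key := ae_eq_integral_abs mu mhl mf.
  apply: (iffP eqP) => [f0|fe].
    have /key : (\int[mu]_(x in half_line) `|(EFin \o (fun x => sqr_norm (f e x))) x| = 0)%E.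
      transitivity (sqr_L2norm (f e))%:E; last by rewrite f0.
      rewrite /sqr_L2norm /Rintegral fineK; last exact: integrable_fin_num.
      by apply: eq_integral => x _ /=; rewrite ger0_norm// sqr_norm_ge0.
    apply: filterS => x /[apply] /= -[] /eqP.
    by rewrite sqr_norm_eq0 => /eqP.
  rewrite /sqr_L2norm /Rintegral.
  rewrite (_ : (\int[mu]_(x in half_line) _)%E = 0%E)//.
  rewrite -[RHS](key.2 _).
    by apply: eq_integral => x _ /=; rewrite ger0_norm// sqr_norm_ge0.
  apply: filterS fe => x /[apply] /= ->.
  by rewrite /sqr_norm/= expr0n addr0.
rewrite /sqn psumr_eq0 => [|e _]; last exact: sqr_L2norm_ge0.
apply/allP/null_predP => [H e|H e _]; last exact/pe.
by apply/pe; apply: H; rewrite mem_index_enum.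
Qed.

Lemma L2_class_eq f g : (forall e x, 0 <= x -> f e x = g e x) -> L2_class f = L2_class g.
Proof.
move=> fg; apply/L2_classE; rewrite -sqn_eq0 /sqn big1// => e _.
rewrite (@eq_sqr_L2norm _ _ (fun=> 0)) ?sqr_L2norm0// => x x0.
by rewrite L2funB fg// subrr.
Qed.

Lemma L2_class_scale c f : L2_class (c *: f) = c *: L2_class f.
Proof. by rewrite -L2_classZ. Qed.

Lemma L2_classN f : L2_class (- f) = - L2_class f.
Proof. by rewrite -scaleN1r L2_class_scale scaleN1r. Qed.

Lemma L2_classB f g : L2_class (f - g) = L2_class f - L2_class g.
Proof. by rewrite L2_classD L2_classN. Qed.

Lemma inner_integrable (f g : R -> R[i]) : square_integrable f -> square_integrable g ->
  mu.-integrable half_line (EFin \o (fun t => complex.Re (f t * conjc (g t)))) /\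
  mu.-integrable half_line (EFin \o (fun t => complex.Im (f t * conjc (g t)))).
Proof.
move=> /square_integrableE[fr fi] /square_integrableE[gr gi]; split.
  have := integrableD mhl (sqint_mul fr gr) (sqint_mul fi gi).
  apply: eq_integrable => // x _ /=; rewrite !complex_partsE -EFinD; congr _%:E; ring.
have := integrableB mhl (sqint_mul fi gr) (sqint_mul fr gi).
apply: eq_integrable => // x _ /=; rewrite !complex_partsE -EFinB; congr _%:E; ring.
Qed.

Lemma L2fun_inner_linear c f g h :
  L2fun_inner (c *: f + g) h = c * L2fun_inner f h + L2fun_inner g h.
Proof.
rewrite /L2fun_inner mulr_sumr -big_split; apply: eq_bigr => e _ /=.
have [fr fi] := inner_integrable (L2fun_square_integrable f e) (L2fun_square_integrable h e).
have [gr gi] := inner_integrable (L2fun_square_integrable g e) (L2fun_square_integrable h e).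
set cr := complex.Re c; set ci := complex.Im c.
have zfr k := integrableZl mhl k fr; have zfi k := integrableZl mhl k fi.
apply: complex_ext; rewrite complex_ReD || rewrite complex_ImD; rewrite complex_ReM || rewrite complex_ImM;
  rewrite /Cintegral /= -/cr -/ci -!RintegralZl//.
  rewrite -RintegralB ?zfr ?zfi// -RintegralD//.
    apply: eq_Rintegral => t _.
    transitivity (complex.Re ((c * f e t + g e t) * conjc (h e t))); first by [].
    by rewrite !complex_partsE -/cr -/ci; ring.
  exact: eq_integrable (integrableB mhl (zfr cr) (zfi ci)).
rewrite -RintegralD ?zfr ?zfi// -RintegralD//.
  apply: eq_Rintegral => t _.
  transitivity (complex.Im ((c * f e t + g e t) * conjc (h e t))); first by [].
  by rewrite !complex_partsE -/cr -/ci; ring.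
exact: eq_integrable (integrableD mhl (zfi cr) (zfr ci)).
Qed.

Lemma L2fun_inner_herm f g : L2fun_inner g f = conjc (L2fun_inner f g).
Proof.
rewrite /L2fun_inner rmorph_sum; apply: eq_bigr => e _ /=.
have [fr fi] := inner_integrable (L2fun_square_integrable f e) (L2fun_square_integrable g e).
apply: complex_ext; rewrite /Cintegral /=.
  by apply: eq_Rintegral => t _; rewrite !complex_partsE; ring.
rewrite -mulN1r -RintegralZl//.
by apply: eq_Rintegral => t _; rewrite !complex_partsE; ring.
Qed.

Lemma L2fun_inner_sqn f : complex.Re (L2fun_inner f f) = sqn f.
Proof.
rewrite /L2fun_inner /sqn (big_morph (@complex.Re R) (@complex_ReD R) (erefl : complex.Re (0 : R[i]) = 0)).
by apply: eq_bigr => e _ /=; apply: eq_Rintegral => t _; rewrite !complex_partsE /sqr_norm; ring.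
Qed.

Lemma L2_inner_linear c (x y z : L2 R d) : L2_inner (c *: x + y) z = c * L2_inner x z + L2_inner y z.
Proof.
rewrite -[x]L2_class_repr -[y]L2_class_repr -[z]L2_class_repr -L2_class_scale -L2_classD.
by rewrite !L2_inner_class L2fun_inner_linear.
Qed.

Lemma L2_inner_herm (x y : L2 R d) : L2_inner y x = conjc (L2_inner x y).
Proof.
by rewrite -[x]L2_class_repr -[y]L2_class_repr !L2_inner_class L2fun_inner_herm.
Qed.

Lemma L2_inner_addl (x y z : L2 R d) : L2_inner (x + y) z = L2_inner x z + L2_inner y z.
Proof. by have := L2_inner_linear 1 x y z; rewrite scale1r mul1r. Qed.

Lemma L2_inner_scalel c (x z : L2 R d) : L2_inner (c *: x) z = c * L2_inner x z.
Proof. by apply: (addIr (L2_inner x z)); rewrite -L2_inner_addl L2_inner_linear. Qed.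

Lemma L2_inner_oppl (x z : L2 R d) : L2_inner (- x) z = - L2_inner x z.
Proof. by rewrite -scaleN1r L2_inner_scalel mulN1r. Qed.

Lemma L2_inner_addr (x y z : L2 R d) : L2_inner z (x + y) = L2_inner z x + L2_inner z y.
Proof. by rewrite L2_inner_herm L2_inner_addl rmorphD/= -!L2_inner_herm. Qed.

Lemma L2_inner_scaler c (x z : L2 R d) : L2_inner z (c *: x) = conjc c * L2_inner z x.
Proof. by rewrite L2_inner_herm L2_inner_scalel rmorphM/= -L2_inner_herm. Qed.

Lemma L2_inner_oppr (x z : L2 R d) : L2_inner z (- x) = - L2_inner z x.
Proof. by rewrite L2_inner_herm L2_inner_oppl rmorphN/= -L2_inner_herm. Qed.

Lemma hnorm_class f : hnorm L2_inner (L2_class f) = Num.sqrt (sqn f).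
Proof. by rewrite /hnorm L2_inner_class L2fun_inner_sqn. Qed.

Lemma hnorm_sqn (x : L2 R d) : hnorm L2_inner x ^+ 2 = sqn (repr x).
Proof. by rewrite -{1}[x]L2_class_repr hnorm_class sqr_sqrtr// sqn_ge0. Qed.

Lemma hnorm_class_sqr f : hnorm L2_inner (L2_class f) ^+ 2 = sqn f.
Proof. by rewrite hnorm_class sqr_sqrtr// sqn_ge0. Qed.

Lemma hnorm_ge0 (x : L2 R d) : 0 <= hnorm L2_inner x.
Proof. exact: sqrtr_ge0. Qed.

Lemma hnorm_Re (x : L2 R d) : hnorm L2_inner x ^+ 2 = complex.Re (L2_inner x x).
Proof. by rewrite hnorm_sqn -L2fun_inner_sqn. Qed.

Lemma hnorm0_eq0 (x : L2 R d) : hnorm L2_inner x = 0 -> x = 0.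
Proof.
move=> x0; have : sqn (repr x) = 0 by rewrite -hnorm_sqn x0 expr0n.
move=> /eqP; rewrite sqn_eq0 => H; rewrite -[x]L2_class_repr.
have -> : 0 = L2_class (0 : L2fun R d) by rewrite -[X in L2_class X](scale0r (repr x)) L2_class_scale scale0r.
by apply/L2_classE; rewrite subr0.
Qed.

(** The bound shows that such an operation maps null functions to null functions, so
that it descends to classes. *)
Lemma L2_lift (op : L2fun R d -> L2fun R d) (M : R) :
  (forall c f g e t, 0 <= t -> op (c *: f + g) e t = c * op f e t + op g e t) ->
  (forall f, sqn (op f) <= M * sqn f) ->
  exists Phi : {linear L2 R d -> L2 R d},
    bounded_op L2_inner Phi /\ forall f, Phi (L2_class f) = L2_class (op f).
Proof.
move=> lin bnd.
have opE f : L2_class (op (repr (L2_class f))) = L2_class (op f).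
  apply/L2_classE; rewrite -sqn_eq0.
  have n0 : sqn (repr (L2_class f) - f) = 0.
    by apply/eqP; rewrite sqn_eq0; apply/L2_classE; rewrite L2_class_repr.
  have E : L2_class (op (repr (L2_class f)) - op f) = L2_class (op (repr (L2_class f) - f)).
    apply: L2_class_eq => e t t0; rewrite L2funB.
    have -> : repr (L2_class f) - f = (-1) *: f + repr (L2_class f) by rewrite scaleN1r addrC.
    by rewrite lin// mulN1r addrC.
  rewrite -hnorm_class_sqr E hnorm_class_sqr eq_le sqn_ge0 andbT.
  by apply: le_trans (bnd _) _; rewrite n0 mulr0.
pose Phi (x : L2 R d) : L2 R d := L2_class (op (repr x)).
have linPhi : linear Phi.
  move=> c x y; rewrite /Phi -{1}[x]L2_class_repr -{1}[y]L2_class_repr -L2_class_scale -L2_classD.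
  rewrite opE -L2_class_scale -L2_classD; apply: L2_class_eq => e t t0.
  by rewrite lin.
pose PhiL : {linear L2 R d -> L2 R d} := HB.pack Phi (GRing.isLinear.Build _ _ _ _ Phi linPhi).
exists PhiL; split=> [|f]; last exact: opE.
exists (Num.sqrt `|M|) => x.
rewrite /PhiL /= /Phi.
rewrite -[x in leRHS]L2_class_repr !hnorm_class -sqrtrM// ler_wsqrtr//.
by apply: le_trans (bnd _) _; rewrite ler_wpM2r ?sqn_ge0// ler_norm.
Qed.

End L2Space.

(** * The resolvent bound and exponential test functions *)

Section Quasimodes.
Context {R : realType} {d : nat}.
Notation mu := (@lebesgue_measure R).
Notation half_line := (@half_line R).
Notation hn := (hnorm (@L2_inner R d)).

(** The cross term between i Im z x and the rest is purely imaginary because <y, x>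
is real. *)
Lemma hnorm_sub_scale (x y : L2 R d) (z : R[i]) : complex.Im (L2_inner y x) = 0 ->
  hn (y - z *: x) ^+ 2 = hn (y - (Complex (complex.Re z) 0) *: x) ^+ 2 + complex.Im z ^+ 2 * hn x ^+ 2.
Proof.
move=> yx0.
have expand (w : R[i]) : hn (y - w *: x) ^+ 2 = hn y ^+ 2
    - 2 * complex.Re w * complex.Re (L2_inner y x) + sqr_norm w * hn x ^+ 2.
  have lin1 u v t : L2_inner (u - w *: v) t = L2_inner u t - w * L2_inner v t :> R[i].
    by rewrite addrC -scaleNr L2_inner_linear mulNr addrC.
  rewrite !hnorm_Re lin1 [L2_inner y (y - _)]L2_inner_herm [L2_inner x (y - _)]L2_inner_herm !lin1.
  have := L2_inner_herm y x; have := L2_inner_herm x x.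
  case: (L2_inner x x) => a b /= [eb]; rewrite [L2_inner x y]L2_inner_herm.
  have b0 : b = 0 by lra.
  move: yx0; case: (L2_inner y x) => r s /= -> _.
  rewrite b0 !complex_partsE /= /sqr_norm /=.
  by move: (complex.Re (L2_inner y y)) (complex.Re w) (complex.Im w) => p u v; clear; ring.
rewrite (expand z) (expand (Complex _ 0)) /sqr_norm /=.
by move: (hn y ^+ 2) (hn x ^+ 2) (complex.Re (L2_inner y x)) (complex.Re z) (complex.Im z)
  => a b c u v; clear; ring.
Qed.

(** If S = Phi T Phi^-1 is self-adjoint then <S u, u> is real, so that
|Im z| |u| <= |S u - z u|; the bounds of Phi and Phi^-1 carry this over to T. *)
Lemma similar_resolvent_bound (T : set (L2 R d * L2 R d)) :
  similar_to_self_adjoint L2_inner T ->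
  exists2 M : R, 0 <= M & forall (x y : L2 R d) (z : R[i]), T (x, y) ->
    complex.Im z ^+ 2 * hn x ^+ 2 <= M * hn (y - z *: x) ^+ 2.
Proof.
move=> [Phi [Psi [[M1 b1] [M2 b2] K1 K2 [_ sa]]]].
exists (M1 ^+ 2 * M2 ^+ 2) => [|x y z Txy]; first by rewrite mulr_ge0 ?sqr_ge0.
have S : conj_op Phi T (Phi x, Phi y) by exists (x, y).
have im0 : complex.Im (L2_inner (Phi y) (Phi x)) = 0.
  move: (S); rewrite {1}sa /adjoint_op /= => /(_ _ _ S) /=.
  rewrite [L2_inner (Phi x) _]L2_inner_herm; case: (L2_inner _ _) => a b /= []; lra.
have le1 : complex.Im z ^+ 2 * hn (Phi x) ^+ 2 <= hn (Phi (y - z *: x)) ^+ 2.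
  by rewrite linearB linearZ/= (hnorm_sub_scale _ im0) lerDr sqr_ge0.
have le2 : hn (Phi (y - z *: x)) ^+ 2 <= M1 ^+ 2 * hn (y - z *: x) ^+ 2.
  by rewrite -exprMn lerXn2r ?nnegrE ?hnorm_ge0//; exact: le_trans (hnorm_ge0 _) (b1 _).
have le3 : hn x ^+ 2 <= M2 ^+ 2 * hn (Phi x) ^+ 2.
  have := b2 (Phi x); rewrite K1 => h.
  by rewrite -exprMn lerXn2r ?nnegrE ?hnorm_ge0//; exact: le_trans (hnorm_ge0 _) h.
apply: (le_trans (ler_wpM2l (sqr_ge0 _) le3)).
rewrite mulrCA [leRHS](_ : _ = M2 ^+ 2 * (M1 ^+ 2 * hn (y - z *: x) ^+ 2)); last by ring.
apply: ler_wpM2l; first exact: sqr_ge0.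
exact: le_trans le1 le2.
Qed.

Lemma square_integrable_cexp (k : R[i]) : 0 < complex.Re k ->
  square_integrable (cexp (- k)) /\ sqr_L2norm (cexp (- k)) = (2 * complex.Re k)^-1.
Proof.
move=> k0; have k2 : 0 < 2 * complex.Re k by rewrite mulr_gt0.
have [ei ev] := integral_expRN k2.
have E x : sqr_norm (cexp (- k) x) = expR (- (2 * complex.Re k) * x).
  by rewrite sqr_norm_cexp complex_partsE; congr expR; ring.
split; last by rewrite -ev; apply: eq_Rintegral => x _; rewrite E.
have [mr mi] := @locally_intC_cexp _ (- k).
split; [exact: (locally_int_measurable mr)|exact: (locally_int_measurable mi)|].
under eq_integral do rewrite E.
by apply: (integrable_lty _ ei); exact: measurable_half_line.
Qed.

Definition xcexp (k : R[i]) (x : R) : R[i] := Complex x 0 * cexp (- k) x.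

Lemma is_primitive_id : is_primitive (fun x : R => Complex x 0) (fun=> 1).
Proof. by apply/is_primitiveE; split; [exact: primitive_id|exact: primitive_cst]. Qed.

Lemma is_primitive_xcexp k :
  is_primitive (xcexp k) (fun x => cexp (- k) x - k * xcexp k x) /\ locally_intC (xcexp k).
Proof.
have lc := locally_intCZ (- k) (@locally_intC_cexp _ (- k)).
have p := is_primitiveM (locally_intC_cst 1) lc is_primitive_id (@is_primitive_cexp _ (- k)).
split; first by apply: eq_is_primitive p => // x _; rewrite /xcexp; ring.
exact: (locally_intCM (locally_intC_cst 1) is_primitive_id (@locally_intC_cexp _ _)).
Qed.

(** The second claim integrates x^2 e^(- 2 a x) <= (2 / a)^2 e^(- a x), where a = Re k. *)
Lemma square_integrable_xcexp (k : R[i]) : 0 < complex.Re k ->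
  square_integrable (xcexp k) /\ sqr_L2norm (xcexp k) <= 4 * (complex.Re k)^-1 ^+ 3.
Proof.
set a := complex.Re k => a0; have [ei ev] := integral_expRN a0.
have [lr li] := (is_primitive_xcexp k).2.
pose C := 4 * a^-1 ^+ 2.
have Ci := integrableZl (measurable_half_line : measurable (half_line : set (measurableTypeR R))) C ei.
have sq x : sqr_norm (xcexp k x) = x ^+ 2 * expR (- (2 * a) * x).
  rewrite sqr_normM sqr_norm_cexp {1}/sqr_norm /= expr0n addr0 complex_partsE.
  by congr (_ * expR _); rewrite -/a; ring.
have le x : 0 <= x -> x ^+ 2 * expR (- (2 * a) * x) <= C * expR (- a * x).
  move=> x0.
  have -> : expR (- (2 * a) * x) = expR (- a * x) * expR (- a * x / 2) ^+ 2.
    by rewrite expr2 -!expRD; congr expR; field.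
  rewrite mulrCA mulrC ler_pM2r ?expR_gt0// -exprMn.
  rewrite (_ : C = (2 * a^-1) ^+ 2); last by rewrite /C; ring.
  rewrite lerXn2r ?nnegrE ?mulr_ge0 ?expR_ge0 ?invr_ge0 ?(ltW a0)//.
  have e : a * x / 2 <= expR (a * x / 2).
    by apply: le_trans (expR_ge1Dx _); rewrite lerDr.
  have -> : expR (- a * x / 2) = (expR (a * x / 2))^-1 by rewrite -expRN; congr expR; ring.
  rewrite ler_pdivrMr ?expR_gt0// -(ler_pM2l (_ : 0 < a / 2)) ?divr_gt0//.
  rewrite (_ : a / 2 * x = a * x / 2); last by ring.
  by rewrite (_ : a / 2 * (2 * a^-1 * expR (a * x / 2)) = expR (a * x / 2))//; field; rewrite gt_eqF.
have sl : locally_int (fun x => sqr_norm (xcexp k x)).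
  have [p _] := is_primitive_xcexp k.
  apply: locally_int_sqr_norm p; apply: locally_intCB; first exact: locally_intC_cexp.
  by apply: locally_intCZ.
have si : mu.-integrable half_line (EFin \o (fun x => sqr_norm (xcexp k x))).
  apply: integrable_le Ci; first exact: locally_int_measurable.
  move=> x; rewrite /Defs.half_line/= in_itv/= andbT => x0.
  by rewrite ger0_norm ?sqr_norm_ge0// sq le.
split.
  split; [exact: (locally_int_measurable lr)|exact: (locally_int_measurable li)|].
  by apply: (integrable_lty _ si); exact: measurable_half_line.
apply: (@le_trans _ _ (\int[mu]_(x in half_line) (C * expR (- a * x)))).
  apply: le_Rintegral; [exact: measurable_half_line|exact: si|exact: Ci|move=> x; rewrite /Defs.half_line/= in_itv/= andbT => x0].
  by rewrite sq le.
rewrite RintegralZl//; last exact: measurable_half_line.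
by rewrite ev /C -mulrA -exprSr.
Qed.

End Quasimodes.

(** * The quasimode estimate *)

Section VectorNorm.
Context {R : realType} {d : nat}.
Implicit Types (p q : 'cV[R[i]]_d) (k : R[i]).

Definition sqr_vnorm p : R := \sum_e sqr_norm (p e 0).

Lemma sqr_vnorm_ge0 p : 0 <= sqr_vnorm p.
Proof. by apply: sumr_ge0 => e _; exact: sqr_norm_ge0. Qed.

Lemma sqr_vnormZ k p : sqr_vnorm (k *: p) = sqr_norm k * sqr_vnorm p.
Proof. by rewrite /sqr_vnorm mulr_sumr; apply: eq_bigr => e _; rewrite mxE sqr_normM. Qed.

Lemma sqr_vnormN p : sqr_vnorm (- p) = sqr_vnorm p.
Proof.
rewrite -scaleN1r sqr_vnormZ (_ : sqr_norm _ = 1) ?mul1r//.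
by rewrite /sqr_norm /= oppr0 expr0n addr0 sqrrN expr1n.
Qed.

Lemma sqr_vnormD_le p q : sqr_vnorm (p + q) <= 2 * sqr_vnorm p + 2 * sqr_vnorm q.
Proof.
rewrite /sqr_vnorm !mulr_sumr -big_split; apply: ler_sum => e _.
by rewrite mxE sqr_normD_le.
Qed.

Lemma sqr_vnorm_eq0 p : sqr_vnorm p = 0 -> p = 0.
Proof.
move=> /eqP; rewrite psumr_eq0 => [/allP H|e _]; last exact: sqr_norm_ge0.
apply/matrixP => i j; rewrite (ord1 j) mxE; apply/eqP.
by rewrite -sqr_norm_eq0; apply: H; rewrite mem_index_enum.
Qed.

End VectorNorm.

Section QuasimodeEstimate.
Context {R : realType} {d : nat}.
Notation hn := (hnorm (@L2_inner R d)).
Implicit Types (f g : L2fun R d) (p q : 'cV[R[i]]_d).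

Lemma sqnD_le f g : sqn (f + g) <= 2 * sqn f + 2 * sqn g.
Proof.
rewrite /sqn !mulr_sumr -big_split; apply: ler_sum => e _.
by apply: sqr_L2normD_le; exact: L2fun_square_integrable.
Qed.

Lemma square_integrable_col p (h : R -> R[i]) : square_integrable h ->
  forall e, square_integrable (fun x => p e 0 * h x).
Proof. by move=> hi e; exact: square_integrable_fZ. Qed.

Definition col_fun p (h : R -> R[i]) (hi : square_integrable h) : L2fun R d :=
  mkL2 (square_integrable_col p hi).

Lemma sqn_col_fun p h (hi : square_integrable h) :
  sqn (col_fun p hi) = sqr_vnorm p * sqr_L2norm h.
Proof. by rewrite /sqn /sqr_vnorm mulr_suml; apply: eq_bigr => e _; rewrite -sqr_L2normZ. Qed.

(** The resolvent bound for psi = e^(- k x) p + x e^(- n x) q, which satisfies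
- psi'' + k^2 psi = 2 n e^(- n x) q + (k^2 - n^2) x e^(- n x) q. For small q the number
- k^2 is almost an eigenvalue. The hypothesis on p and q is the condition at the
vertex; n is a free decay rate for the correction. *)
Lemma quasimode_estimate (A B : 'M[R[i]]_d) (M : R) : 0 <= M ->
  (forall (x y : L2 R d) (z : R[i]), opp_op (Delta A B) (x, y) ->
    complex.Im z ^+ 2 * hn x ^+ 2 <= M * hn (y - z *: x) ^+ 2) ->
  forall (k n : R[i]) p q, 0 < complex.Re k -> 0 < complex.Re n ->
  A *m p + B *m (q - k *: p) = 0 ->
  complex.Im (k ^+ 2) ^+ 2 *
    ((4 * complex.Re k)^-1 * sqr_vnorm p - 4 * (complex.Re n)^-1 ^+ 3 * sqr_vnorm q) <=
  M * ((4 * (complex.Re n)^-1 * sqr_norm n + 8 * (complex.Re n)^-1 ^+ 3 * sqr_norm (k ^+ 2 - n ^+ 2))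
    * sqr_vnorm q).
Proof.
move=> M0 bnd k n p q k0 n0 bc.
have [ki kv] := square_integrable_cexp k0; have [ni nv] := square_integrable_cexp n0.
have [xi xv] := square_integrable_xcexp n0.
set a := complex.Re k in k0 kv *; set b := complex.Re n in n0 nv xv *.
have [px xl] := is_primitive_xcexp n.
have cl := @locally_intC_cexp R.
have psi_i e : square_integrable (fun x => p e 0 * cexp (- k) x + q e 0 * xcexp n x).
  by apply: square_integrable_fD; exact: square_integrable_fZ.
have x1i : square_integrable (fun x => cexp (- n) x - n * xcexp n x).
  by apply: square_integrable_fB => //; exact: square_integrable_fZ.
have psi1_i e : square_integrable (fun x => p e 0 * (- k * cexp (- k) x) +
    q e 0 * (cexp (- n) x - n * xcexp n x)).
  by apply: square_integrable_fD; do ?apply: square_integrable_fZ.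
have psi2_i e : square_integrable (fun x => p e 0 * (- k * (- k * cexp (- k) x)) +
    q e 0 * (- n * cexp (- n) x - n * (cexp (- n) x - n * xcexp n x))).
  apply: square_integrable_fD; do ?apply: square_integrable_fZ => //.
  by apply: square_integrable_fB; apply: square_integrable_fZ.
pose psi := mkL2 psi_i; pose psi1 := mkL2 psi1_i; pose psi2 := mkL2 psi2_i.
have pk := @is_primitive_cexp R (- k); have pn := @is_primitive_cexp R (- n).
have lkZ := locally_intCZ (- k) (cl (- k)); have lnZ := locally_intCZ (- n) (cl (- n)).
have lx1 := square_integrable_locally x1i.
have h2 : H2 psi psi1 psi2.
  move=> e; split.
    apply: is_primitiveD; [exact: locally_intCZ|exact: locally_intCZ| |]; exact: is_primitiveZ.
  apply: is_primitiveD; do ?apply: locally_intCZ => //.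
  - by apply: locally_intCB => //; exact: locally_intCZ.
  - by apply: is_primitiveZ; [exact: locally_intCZ|exact: is_primitiveZ].
  - apply: is_primitiveZ; first by apply: locally_intCB => //; exact: locally_intCZ.
    by apply: is_primitiveB => //; [exact: locally_intCZ|exact: is_primitiveZ].
have T : opp_op (Delta A B) (L2_class psi, - L2_class psi2).
  exists (L2_class psi, L2_class psi2) => //; exists psi, psi1, psi2; split=> //.
  have -> : at_vertex psi = p.
    apply/matrixP => i j; rewrite (ord1 j) !mxE /= !cexp0 /xcexp cexp0.
    by rewrite [Complex 0 0](_ : _ = 0)// !mul0r mulr0 addr0 mulr1.
  have -> : at_vertex psi1 = q - k *: p; last by [].
  apply/matrixP => i j; rewrite (ord1 j) !mxE /= !cexp0 /xcexp cexp0.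
  by rewrite [Complex 0 0](_ : _ = 0)// !mul0r; ring.
have res : - L2_class psi2 - (- k ^+ 2) *: L2_class psi =
    L2_class (col_fun ((2 * n) *: q) ni + col_fun ((k ^+ 2 - n ^+ 2) *: q) xi).
  rewrite -L2_class_scale -L2_classN -L2_classB; apply: L2_class_eq => e x x0.
  by rewrite L2funB L2funN L2funZ L2funD /= !mxE; ring.
have := bnd _ _ (- k ^+ 2) T; rewrite res !hnorm_class_sqr complex_ImN sqrrN => h.
have lo : (4 * a)^-1 * sqr_vnorm p - 4 * b^-1 ^+ 3 * sqr_vnorm q <= sqn psi.
  have : sqn (col_fun p ki) <= 2 * sqn psi + 2 * sqn (col_fun (- q) xi).
    apply: le_trans (sqnD_le _ _); rewrite le_eqVlt; apply/orP; left; apply/eqP.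
    apply: eq_bigr => e _; apply: eq_sqr_L2norm => x x0.
    by rewrite L2funD /= !mxE; ring.
  rewrite !sqn_col_fun kv sqr_vnormN.
  have := ler_wpM2l (sqr_vnorm_ge0 q) xv.
  have -> : (4 * a)^-1 = (2 * a)^-1 / 2 by field; rewrite gt_eqF.
  move: (sqn psi) (sqr_vnorm p) (sqr_vnorm q) (sqr_L2norm _) ((2 * a)^-1) (b^-1 ^+ 3).
  by clear => u v w s t r; nra.
have hi : sqn (col_fun ((2 * n) *: q) ni + col_fun ((k ^+ 2 - n ^+ 2) *: q) xi) <=
    (4 * b^-1 * sqr_norm n + 8 * b^-1 ^+ 3 * sqr_norm (k ^+ 2 - n ^+ 2)) * sqr_vnorm q.
  apply: le_trans (sqnD_le _ _) _; rewrite !sqn_col_fun !sqr_vnormZ nv sqr_normM.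
  have -> : sqr_norm (2 : R[i]) = 4.
    by rewrite /sqr_norm /= addr0 expr0n addr0; ring.
  have -> : (2 * b)^-1 = b^-1 / 2 by field; rewrite gt_eqF.
  have := ler_wpM2l (mulr_ge0 (sqr_norm_ge0 (k ^+ 2 - n ^+ 2)) (sqr_vnorm_ge0 q)) xv.
  move: (sqr_norm n) (sqr_vnorm q) (sqr_L2norm _) (sqr_norm _) b^-1 => u v w s t.
  by clear; nra.
apply: le_trans (le_trans _ h) _; first by rewrite ler_wpM2l ?sqr_ge0.
by rewrite ler_wpM2l.
Qed.

End QuasimodeEstimate.

(** * Vectors excluded by the quasimode estimate *)

Lemma le0_small (R : realType) (V C : R) :
  (forall r, 0 < r -> r <= 1 -> V <= r * C) -> V <= 0.
Proof.
move=> H; rewrite leNgt; apply/negP => V0.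
have C0 : 0 < C by have := H 1 ltr01 (lexx 1); rewrite mul1r => /(lt_le_trans V0).
have D0 : 0 < 2 * C + V by lra.
have r1 : V / (2 * C + V) <= 1 by rewrite ler_pdivrMr//; lra.
have := H _ (divr_gt0 V0 D0) r1.
rewrite mulrAC ler_pdivlMr// => h; have : V * (C + V) <= 0 by nra.
by apply/negP; rewrite -ltNge mulr_gt0// addr_gt0.
Qed.

Section PencilConsequences.
Context {R : realType} {d : nat}.
Variables (A B : 'M[R[i]]_d) (M : R).
Hypothesis M0 : 0 <= M.
Hypothesis est : forall (k n : R[i]) (p q : 'cV[R[i]]_d), 0 < complex.Re k -> 0 < complex.Re n ->
  A *m p + B *m (q - k *: p) = 0 ->
  complex.Im (k ^+ 2) ^+ 2 *
    ((4 * complex.Re k)^-1 * sqr_vnorm p - 4 * (complex.Re n)^-1 ^+ 3 * sqr_vnorm q) <=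
  M * ((4 * (complex.Re n)^-1 * sqr_norm n + 8 * (complex.Re n)^-1 ^+ 3 * sqr_norm (k ^+ 2 - n ^+ 2))
    * sqr_vnorm q).

(** p e^(- l x) would be an eigenfunction for the nonreal eigenvalue - l ^+ 2. *)
Lemma no_nonreal_eigenvalue (l : R[i]) (p : 'cV[R[i]]_d) :
  0 < complex.Re l -> complex.Im l != 0 -> A *m p = l *: (B *m p) -> p = 0.
Proof.
move=> l0 i0 Ap; apply: sqr_vnorm_eq0.
have v0 : sqr_vnorm (0 : 'cV[R[i]]_d) = 0.
  by rewrite /sqr_vnorm big1// => e _; rewrite mxE /sqr_norm /= expr0n addr0.
have := est (k := l) (n := l) (p := p) (q := 0) l0 l0.
rewrite sub0r mulmxN -scalemxAr Ap subrr => /(_ erefl).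
rewrite v0 !mulr0 subr0 => h; apply/eqP; rewrite eq_le sqr_vnorm_ge0 andbT.
have c0 : 0 < complex.Im (l ^+ 2) ^+ 2 * (4 * complex.Re l)^-1.
  have -> : complex.Im (l ^+ 2) = 2 * (complex.Re l * complex.Im l).
    by rewrite expr2 complex_ImM; ring.
  apply: mulr_gt0; last by rewrite invr_gt0 mulr_gt0.
  by rewrite exprn_even_gt0//= mulf_neq0// mulf_neq0// gt_eqF.
by rewrite mulrA pmulr_rle0 in h.
Qed.

(** For a Jordan chain of the pencil at infinity, the test functions with
k = n = r (1 - i), p = v, q = - w show that the norm of the resolvent at - k^2 is at
least of order 1 / r, whereas 1 / |Im k^2| is of order 1 / r^2 for large r. *)
Lemma no_chain_at_infinity (v w : 'cV[R[i]]_d) : B *m v = 0 -> A *m v = B *m w -> v = 0.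
Proof.
move=> Bv Av; apply: sqr_vnorm_eq0; apply/eqP; rewrite eq_le sqr_vnorm_ge0 andbT.
apply: (@le0_small _ _ ((16 + 8 * M) * sqr_vnorm w)) => s s0 s1.
set r := s^-1; have r0 : 0 < r by rewrite invr_gt0.
have := est (k := Complex r (- r)) (n := Complex r (- r)) (p := v) (q := - w) r0 r0.
rewrite mulmxDr mulmxN -scaleNr -scalemxAr Bv scaler0 addr0 Av subrr => /(_ erefl).
rewrite sqr_vnormN subrr.
have -> : sqr_norm (0 : R[i]) = 0 by rewrite /sqr_norm /= expr0n addr0.
rewrite expr2 complex_ImM /sqr_norm /= mulr0 addr0 sqrrN.
set V := sqr_vnorm v; set W := sqr_vnorm w; have W0 : 0 <= W := sqr_vnorm_ge0 _.
rewrite (_ : (_ ^+ 2 * _) = r * (r ^+ 2 * V - 16 * W)); last by field; rewrite gt_eqF.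
rewrite (_ : M * _ = r * (8 * M * W)); last by field; rewrite gt_eqF.
rewrite ler_pM2l// => h.
have -> : V = s ^+ 2 * (r ^+ 2 * V).
  by rewrite mulrA -exprMn /r mulfV ?gt_eqF// expr1n mul1r.
apply: (@le_trans _ _ (s ^+ 2 * ((16 + 8 * M) * W))).
  by rewrite ler_wpM2l ?sqr_ge0//; lra.
have C0 : 0 <= (16 + 8 * M) * W by rewrite mulr_ge0// addr_ge0// mulr_ge0.
by rewrite ler_wpM2r// expr2 ger_pMr.
Qed.

(** p e^(- i b x) solves the equation but just fails to be square-integrable. Damped
by e^(- e x) it becomes a quasimode with relative error of order e^(3/2), whereas
the imaginary part of k^2 = (e + i b)^2 is only of order e. *)
Lemma no_imaginary_eigenvalue (b : R) (p : 'cV[R[i]]_d) : b != 0 ->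
  A *m p = Complex 0 b *: (B *m p) -> p = 0.
Proof.
move=> b0 Ap; apply: contrapT => /eqP p0.
have V0 : 0 < sqr_vnorm p.
  rewrite lt_neqAle sqr_vnorm_ge0 andbT eq_sym; apply: contra p0 => /eqP.
  by move=> /sqr_vnorm_eq0 ->.
suff : b ^+ 2 <= 0 by apply/negP; rewrite -ltNge exprn_even_gt0.
apply: (@le0_small _ _ (16 * b ^+ 2 + M * (4 + 8 * ((b ^+ 2 + 1) ^+ 2 + 4 * b ^+ 2)))) => e e0 e1.
have := est (k := Complex e b) (n := 1) (p := p) (q := Complex e 0 *: p) e0 ltr01.
have -> : Complex e 0 *: p - Complex e b *: p = (- Complex 0 b) *: p.
  by rewrite -scalerBl; congr (_ *: _); apply: complex_ext; rewrite !complex_partsE /=; ring.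
rewrite -scalemxAr Ap scaleNr subrr => /(_ erefl).
rewrite expr1n sqr_vnormZ [complex.Re (Complex e b)]/= [complex.Re 1]/=.
have -> : sqr_norm (1 : R[i]) = 1 by rewrite /sqr_norm /= expr0n addr0 expr1n.
have -> : sqr_norm (Complex e 0) = e ^+ 2 by rewrite /sqr_norm /= expr0n addr0.
have -> : complex.Im (Complex e b ^+ 2) = 2 * e * b by rewrite expr2 complex_ImM /=; ring.
have -> : sqr_norm (Complex e b ^+ 2 - 1) = (e ^+ 2 - b ^+ 2 - 1) ^+ 2 + 4 * e ^+ 2 * b ^+ 2.
  by rewrite /sqr_norm expr2 !complex_partsE /=; ring.
set V := sqr_vnorm p in V0 *; set K := (X in 8 * _ * X).
have Kle : K <= (b ^+ 2 + 1) ^+ 2 + 4 * b ^+ 2.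
  rewrite /K; have : e ^+ 2 <= 1 by rewrite expr_le1// ltW.
  have := sqr_ge0 e; have := sqr_ge0 b; move: (e ^+ 2) (b ^+ 2) => x y; nra.
rewrite invr1 expr1n !mulr1.
rewrite (_ : (_ ^+ 2 * _) = e * V * (b ^+ 2 - 16 * b ^+ 2 * e ^+ 3)); last by field; rewrite gt_eqF.
rewrite (_ : M * _ = e * V * (e * (M * (4 + 8 * K)))); last by ring.
rewrite ler_pM2l ?mulr_gt0// => h.
have h1 : M * (4 + 8 * K) <= M * (4 + 8 * ((b ^+ 2 + 1) ^+ 2 + 4 * b ^+ 2)).
  by rewrite ler_wpM2l//; lra.
have h2 : e ^+ 3 <= e by rewrite exprS ger_pMr// expr_le1// ltW.
have h3 : 16 * b ^+ 2 * e ^+ 3 <= 16 * b ^+ 2 * e.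
  by rewrite ler_wpM2l// mulr_ge0// sqr_ge0.
have h4 := ler_wpM2l (ltW e0) h1.
rewrite mulrDr; move: h h3 h4; lra.
Qed.

(** For a Jordan chain u, v at l and k = l + del with del = r (1 - i), the function
e^(- k x) (u + del v) satisfies the conditions at the vertex up to del^2 B v. Its
relative error is of order r^2 for l > 0 and r^(5/2) for l = 0, whereas Im k^2 is of
order r and r^2 respectively. *)
Lemma no_chain_nonneg (l : R) (u v : 'cV[R[i]]_d) : 0 <= l ->
  A *m u = Complex l 0 *: (B *m u) -> A *m v = Complex l 0 *: (B *m v) + B *m u -> u = 0.
Proof.
move=> l0 Au Av; apply: sqr_vnorm_eq0; apply/eqP; rewrite eq_le sqr_vnorm_ge0 andbT.
set V := sqr_vnorm u; pose W := sqr_vnorm v; have W0 : 0 <= W := sqr_vnorm_ge0 _.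
pose K := (l ^+ 2 + 2 * l + 1) ^+ 2 + 4 * (l + 1) ^+ 2.
pose C := (64 * (l + 1) + 4 * M * (4 + 8 * K)) * W.
apply: (@le0_small _ _ (2 * C + 4 * W)) => r r0 r1.
have lr0 : 0 < l + r by rewrite ltr_wpDl.
pose del := Complex r (- r); pose k := Complex (l + r) (- r).
have kE : k = Complex l 0 + del by apply: complex_ext; rewrite /= ?add0r.
have := est (k := k) (n := 1) (p := u + del *: v) (q := del ^+ 2 *: v) lr0 ltr01.
have -> : A *m (u + del *: v) + B *m (del ^+ 2 *: v - k *: (u + del *: v)) = 0.
  rewrite !(mulmxDr, mulmxN) -!scalemxAr !mulmxDr -!scalemxAr Au Av kE.
  set c := Complex l 0; move: (B *m u) (B *m v) => bu bv.
  by apply/matrixP => i j; rewrite !mxE; ring.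
move=> /(_ erefl); rewrite expr1n sqr_vnormZ [complex.Re k]/= [complex.Re 1]/= invr1 expr1n !mulr1 -/W.
have -> : sqr_norm (1 : R[i]) = 1 by rewrite /sqr_norm /= expr0n addr0 expr1n.
have -> : sqr_norm (del ^+ 2) = 4 * r ^+ 4 by rewrite expr2 sqr_normM /sqr_norm /=; ring.
have -> : complex.Im (k ^+ 2) = - 2 * r * (l + r) by rewrite expr2 complex_ImM /=; ring.
have -> : sqr_norm (k ^+ 2 - 1) = (l ^+ 2 + 2 * l * r - 1) ^+ 2 + 4 * r ^+ 2 * (l + r) ^+ 2.
  by rewrite /sqr_norm expr2 !complex_partsE /=; ring.
set P := sqr_vnorm _; set K' := (X in 8 * X).
have Kle : K' <= K.
  rewrite /K' /K; apply: lerD.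
    have a1 : 0 <= l * (1 - r) by rewrite mulr_ge0// subr_ge0.
    have a2 : 0 <= l * r by rewrite mulr_ge0// ltW.
    have a3 := sqr_ge0 l.
    by rewrite -subr_ge0 subr_sqr; apply: mulr_ge0; lra.
  have [r0' lr0'] := (ltW r0, ltW lr0).
  rewrite -mulrA ler_pM2l// -exprMn lerXn2r// ?nnegrE; [exact: mulr_ge0|exact: addr_ge0|].
  by apply: (@le_trans _ _ (l + r)); [rewrite ger_pMl|rewrite lerD2l].
rewrite mulr1.
rewrite (_ : (_ ^+ 2 * _) = r ^+ 2 * (l + r) * (P - 64 * r ^+ 4 * (l + r) * W)); last first.
  by field; rewrite gt_eqF.
rewrite (_ : M * _ = r ^+ 2 * (r ^+ 2 * (4 * M * (4 + 8 * K') * W))); last by ring.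
rewrite -mulrA ler_pM2l ?exprn_gt0// => h.
have VP : V <= 2 * P + 4 * r ^+ 2 * W.
  have -> : V = sqr_vnorm ((u + del *: v) + (- del) *: v).
    by rewrite scaleNr addrK.
  apply: le_trans (sqr_vnormD_le _ _) _; rewrite lerD2l sqr_vnormZ -/W.
  by rewrite (_ : sqr_norm (- del) = 2 * r ^+ 2); [lra|rewrite /sqr_norm /=; ring].
have MK : M * (4 + 8 * K') <= M * (4 + 8 * K) by rewrite ler_wpM2l//; lra.
have MK0 : 0 <= M * (4 + 8 * K).
  rewrite mulr_ge0// addr_ge0// mulr_ge0// addr_ge0 ?sqr_ge0// mulr_ge0// sqr_ge0.
  by [].
have PC : P <= r * C.
  have h' : (l + r) * (P - 64 * r ^+ 4 * (l + r) * W) <= (l + r) * (r * (4 * M * (4 + 8 * K) * W)).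
    apply: le_trans h _.
    have : r ^+ 2 * (4 * M * (4 + 8 * K') * W) <= r ^+ 2 * (4 * M * (4 + 8 * K) * W).
      by rewrite ler_wpM2l ?sqr_ge0// ler_wpM2r// -!mulrA ler_pM2l.
    move=> /le_trans; apply; rewrite expr2 -mulrA; apply: ler_wpM2r; last by rewrite lerDr.
    apply: mulr_ge0; first exact: ltW.
    by apply: mulr_ge0 => //; rewrite -(mulrA 4); apply: mulr_ge0.
  rewrite ler_pM2l// in h'.
  have h4 : r ^+ 4 <= r by rewrite exprS ger_pMr// expr_le1// ltW.
  have h5 : r ^+ 4 * (l + r) <= r * (l + 1) 
    by apply: ler_pM => //; [apply: exprn_ge0; exact: ltW|exact: ltW|rewrite lerD2l].
  have h6 := ler_wpM2r W0 h5.
  rewrite /C; move: h' h6; nra.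
have r2 : r ^+ 2 <= r by rewrite expr2 ger_pMr.
have := ler_wpM2r W0 r2; move: VP PC; nra.
Qed.

End PencilConsequences.

(** * Semisimple eigenvalues and matrix pencils *)

Section LinearAlgebra.
Context {F : fieldType}.

Lemma char_poly_similar n (L U D : 'M[F]_n) : U \in unitmx -> U *m L = D *m U ->
  char_poly L = char_poly D.
Proof.
move=> Uu UL; pose Up := map_mx polyC U.
have Uu' : \det Up != 0 by rewrite det_map_mx polyC_eq0 -unitfE -unitmxE.
apply: (mulfI Uu'); rewrite [RHS]mulrC -!det_mulmx; congr (\det _).
rewrite /char_poly_mx mulmxBr mulmxBl -!map_mxM UL; congr (_ - _).
by rewrite scalar_mxC.
Qed.

Lemma char_poly_block k g (Y : 'M[F]_k) (X : 'M[F]_(k, g)) (Z : 'M[F]_g) :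
  char_poly (block_mx Y X 0 Z) = char_poly Y * char_poly Z.
Proof.
rewrite /char_poly /char_poly_mx map_block_mx map_mx0 scalar_mx_block.
by rewrite opp_block_mx add_block_mx oppr0 addr0 det_ublock.
Qed.

Lemma char_poly_scalar g (l : F) : char_poly (l%:M : 'M[F]_g) = ('X - l%:P) ^+ g.
Proof.
by rewrite /char_poly /char_poly_mx map_scalar_mx -raddfB/= det_scalar.
Qed.

(** The last rows of the inverse of the column echelon basis span the left kernel of
N. *)
Lemma left_kernel_basis k g (N : 'M[F]_(k + g)) : \rank N = k ->
  exists (U : 'M[F]_(k + g)) Y X, U \in unitmx /\ U *m N = block_mx Y X 0 0 *m U.
Proof.
move=> rN; pose U := invmx (col_ebase N).
have Uu : U \in unitmx by rewrite unitmx_inv col_ebase_unit.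
pose T := row_ebase N *m invmx U.
exists U, (ulsubmx T), (ursubmx T); split=> //.
have -> : U *m N = pid_mx k *m row_ebase N.
  by rewrite -{1}[N]mulmx_ebase rN /U !mulmxA mulVmx ?col_ebase_unit// mul1mx.
have -> : row_ebase N = T *m U by rewrite /T mulmxKV.
rewrite mulmxA; congr (_ *m _); rewrite pid_mx_block -{1}[T]submxK mulmx_block.
by rewrite !mul1mx !mul0mx !addr0.
Qed.

Lemma rank_block_top k g (Y : 'M[F]_k) (X : 'M[F]_(k, g)) :
  \rank (block_mx Y X 0 0 : 'M[F]_(k + g)) = \rank (row_mx Y X).
Proof.
rewrite block_mxEv row_mx0; apply/eqP; rewrite eqn_leq; apply/andP; split.
  have -> : col_mx (row_mx Y X) (0 : 'M[F]_(g, _)) = col_mx 1%:M 0 *m row_mx Y X.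
    by rewrite mul_col_mx mul1mx mul0mx.
  exact: mxrankM_maxr.
have {1}-> : row_mx Y X = row_mx 1%:M 0 *m col_mx (row_mx Y X) (0 : 'M[F]_(g, _)).
  by rewrite mul_row_col mul1mx mul0mx addr0.
exact: mxrankM_maxr.
Qed.

Lemma rank_similar n (N U D : 'M[F]_n) : U \in unitmx -> U *m N = D *m U ->
  \rank D = \rank N.
Proof.
move=> Uu UN; rewrite -(mxrankMfree D (B := U)) ?row_free_unit// -UN.
by rewrite -mxrank_tr trmx_mul mxrankMfree ?mxrank_tr// row_free_unit unitmx_tr.
Qed.

Lemma similar_mul n (N U D : 'M[F]_n) : U *m N = D *m U ->
  U *m (N *m N) = D *m D *m U.
Proof. by move=> UN; rewrite mulmxA UN -mulmxA UN mulmxA. Qed.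

(** Zero is a semisimple eigenvalue of N exactly when N is injective on its image,
that is, when the block Y is invertible. *)
Lemma semisimple_block k g (N U : 'M[F]_(k + g)) Y X : \rank N = k -> U \in unitmx ->
  U *m N = block_mx Y X 0 0 *m U -> (\rank (N *m N) == \rank N) = (Y \in unitmx).
Proof.
move=> rN Uu UN.
have rT : \rank (row_mx Y X) = k by rewrite -rank_block_top (rank_similar Uu UN).
rewrite -(rank_similar Uu (similar_mul UN)) rN mulmx_block !mulmx0 !mul0mx !addr0.
rewrite rank_block_top -mul_mx_row -row_free_unit /row_free.
have fT : row_free (row_mx Y X) by rewrite /row_free rT.
by rewrite mxrankMfree.
Qed.

(** In the block form of L - l given by [left_kernel_basis], the multiplicity of l
exceeds the dimension of the eigenspace by its multiplicity in the block Y + l,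
which is zero exactly when Y is invertible. *)
Lemma mup_rank n (L : 'M[F]_n) (l : F) :
  mup l (char_poly L) = \rank (eigenspace L l) <->
  \rank ((L - l%:M) *m (L - l%:M)) = \rank (L - l%:M).
Proof.
pose k := \rank (L - l%:M); pose g := (n - k)%N.
have rN : \rank (L - l%:M) = k by [].
have rE : \rank (eigenspace L l) = g by rewrite mxrank_ker.
have e : (k + g)%N = n by rewrite /g subnKC// rank_leq_row.
move: k g rN rE e => k g rN rE e; case: n / e L rN rE => L rN ->.
have [U [Y [X [Uu UN]]]] := left_kernel_basis rN.
have ss := semisimple_block rN Uu UN.
have UL : U *m L = (block_mx (Y + l%:M) X 0 l%:M : 'M[F]_(k + g)) *m U.
  have -> : block_mx (Y + l%:M) X 0 l%:M = block_mx Y X 0 0 + l%:M :> 'M[F]_(k + g).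
    by rewrite (scalar_mx_block k g) add_block_mx !addr0 add0r.
  by rewrite mulmxDl -UN -scalar_mxC -mulmxDr subrK.
rewrite (char_poly_similar Uu UL) char_poly_block char_poly_scalar.
have nz : char_poly (Y + l%:M) != 0 by exact/monic_neq0/char_poly_monic.
rewrite mupM// ?expf_neq0 ?polyXsubC_eq0// mup_XsubCX eqxx.
have key : root (char_poly (Y + l%:M)) l = (Y \notin unitmx).
  rewrite rootE /char_poly -horner_evalE -det_map_mx /char_poly_mx.
  rewrite unitmxE unitfE negbK.
  have -> : map_mx (horner_eval l) ('X%:M - map_mx polyC (Y + l%:M)) = - Y.
    by apply/matrixP => i j; rewrite !mxE /horner_eval !(hornerE, hornerMn); 
      case: eqP => _; rewrite ?mulr1n ?mulr0n ?addr0 ?subr0 ?sub0r// opprD addrCA subrr addr0.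
  by rewrite -scaleN1r detZ mulf_eq0 expf_eq0 oppr_eq0 oner_eq0 andbF.
split=> [/eqP|/eqP].
  rewrite -{2}[g]add0n eqn_add2r => /eqP m0; apply/eqP; rewrite ss -[_ \in _]negbK -key.
  by rewrite -dvdp_XsubCl XsubC_dvd// m0.
rewrite ss => Yu; rewrite mupNroot ?add0n//.
by rewrite key Yu.
Qed.

Lemma semisimple_of_kernel n (N : 'M[F]_n) :
  (forall w : 'cV_n, N *m (N *m w) = 0 -> N *m w = 0) -> \rank (N *m N) = \rank N.
Proof.
move=> H; apply/eqP; rewrite eqn_leq mxrankM_maxl /=.
have : (kermx (N *m N)^T <= kermx N^T)%MS.
  apply/row_subP => i; apply/sub_kermxP.
  have /(congr1 trmx) : row i (kermx (N *m N)^T) *m (N *m N)^T = 0.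
    by rewrite -row_mul mulmx_ker row0.
  rewrite trmx_mul trmxK trmx0 -mulmxA => /H /(congr1 trmx).
  by rewrite trmx_mul trmxK trmx0.
move=> /mxrankS; rewrite !mxrank_ker !mxrank_tr.
by rewrite leq_sub2lE ?rank_leq_row.
Qed.

(** Fitting decomposition: since Y is invertible, a shear removes the off-diagonal
block of [left_kernel_basis]. *)
Lemma semisimple_split k g (N : 'M[F]_(k + g)) : \rank N = k -> \rank (N *m N) = k ->
  exists (U : 'M[F]_(k + g)) (Y : 'M[F]_k), [/\ U \in unitmx, Y \in unitmx &
    U *m N = block_mx Y 0 0 0 *m U].
Proof.
move=> rN rNN; have [U [Y [X [Uu UN]]]] := left_kernel_basis rN.
have Yu : Y \in unitmx by rewrite -(semisimple_block rN Uu UN) rN rNN.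
pose P : 'M[F]_(k + g) := block_mx 1%:M (invmx Y *m X) 0 1%:M.
have Pu : P \in unitmx by rewrite unitmxE det_ublock !det1 mulr1 unitr1.
exists (P *m U), Y; split=> //; first by rewrite unitmx_mul Pu.
rewrite -mulmxA UN !mulmxA; congr (_ *m U).
rewrite /P !mulmx_block !(mul0mx, mulmx0, mul1mx, mulmx1, addr0, add0r).
by rewrite mulmxA mulmxV// mul1mx.
Qed.

End LinearAlgebra.

(** With C = A + lam B invertible and E = C^-1 B, the quasi-Weierstrass form of (A, B)
is the Fitting decomposition of E, and its nilpotent part vanishes as soon as 0 is
a semisimple eigenvalue of E. *)
Lemma quasi_sectorial_of_no_chain {F : closedFieldType} d (A B : 'M[F]_d) lam :
  \det (A + lam *: B) != 0 ->
  (forall v w : 'cV_d, B *m v = 0 -> A *m v = B *m w -> v = 0) ->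
  quasi_sectorial A B.
Proof.
move=> det0 nochain; pose C := A + lam *: B.
have Cu : C \in unitmx by rewrite unitmxE unitfE.
split.
  split; last by exists lam.
  apply/eqP; rewrite eqn_leq rank_leq_row /=.
  have {1}<- : \rank C = d by apply: mxrank_unit.
  have -> : C = row_mx A B *m col_mx 1%:M lam%:M.
    by rewrite mul_row_col mulmx1 mul_mx_scalar.
  exact: mxrankM_maxl.
pose E := invmx C *m B.
have BE : B = C *m E by rewrite /E mulKVmx.
have rEE : \rank (E *m E) = \rank E.
  apply: semisimple_of_kernel => w EEw.
  have Bv : B *m (E *m w) = 0 by rewrite BE -mulmxA EEw mulmx0.
  apply: (nochain _ w Bv).
  have -> : A = C - lam *: B by rewrite /C addrK.
  by rewrite mulmxBl -scalemxAl Bv scaler0 subr0 mulmxA -BE.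
pose k := \rank E; pose g := (d - k)%N; have rE : \rank E = k by [].
have e : (k + g)%N = d by rewrite /g subnKC// rank_leq_row.
rewrite rE in rEE; exists k, g, e.
have AE : A = C - lam *: B by rewrite /C addrK.
clear det0 nochain; clearbody C E k g.
case: d / e A B C E Cu BE rE rEE AE => A B C E Cu BE rE rEE AE.
have [U [Y [Uu Yu UE]]] := semisimple_split rE rEE.
have EU : E = invmx U *m (block_mx Y 0 0 0 *m U) by rewrite -UE mulKmx.
have Fu : (block_mx Y 0 0 1%:M : 'M[F]_(k + g)) \in unitmx.
  by rewrite unitmxE det_ublock det1 mulr1 -unitmxE.
exists (C *m invmx U *m block_mx Y 0 0 1%:M), U, (invmx Y *m (1%:M - lam *: Y)), 0.
split=> //; split; rewrite ?castmx_id//.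
- by rewrite !unitmx_mul Cu unitmx_inv Uu.
- by exists 1%N; rewrite expr1.
- rewrite -[in RHS](mulmxA _ (block_mx Y 0 0 1%:M)) mulmx_block.
  rewrite !(mul0mx, mulmx0, mul1mx, mulmx1, addr0, add0r) mulmxA mulmxV// mul1mx.
  rewrite AE BE EU.
  have -> : block_mx (1%:M - lam *: Y) 0 0 1%:M = 1%:M - lam *: block_mx Y 0 0 0 :> 'M[F]_(k + g).
    rewrite (scalar_mx_block k g) scale_block_mx !scaler0 opp_block_mx add_block_mx !oppr0 !addr0.
    by [].
  rewrite mulmxBr mulmx1 mulmxBl mulmxKV//; congr (_ - _).
  by rewrite -scalemxAr -scalemxAl !mulmxA.
- rewrite -[in RHS](mulmxA _ (block_mx Y 0 0 1%:M)) mulmx_block.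
  rewrite !(mul0mx, mulmx0, mul1mx, mulmx1, addr0, add0r).
  by rewrite BE EU !mulmxA.
Qed.

(** * Necessity of the three conditions *)

Lemma det0_colP (F : fieldType) n (X : 'M[F]_n) :
  \det X = 0 -> exists2 u : 'cV_n, u != 0 & X *m u = 0.
Proof.
rewrite -det_tr => /eqP/det0P[v v0 vX]; exists v^T; first by rewrite trmx_eq0.
by rewrite -[X]trmxK -trmx_mul vX trmx0.
Qed.

Lemma eigenvalue_col (F : fieldType) n (L : 'M[F]_n) l :
  eigenvalue L l -> exists2 u : 'cV_n, u != 0 & L *m u = l *: u.
Proof.
move=> /eigenvalueP[v vL v0].
have : \det (L - l%:M) = 0.
  by apply/eqP/det0P; exists v => //; rewrite mulmxBr vL mul_mx_scalar subrr.
move=> /det0_colP[u u0 uL]; exists u => //; apply/eqP.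
by rewrite -subr_eq0 -mul_scalar_mx -mulmxBl uL.
Qed.

Lemma complex_ge0E (R : realType) (l : R[i]) :
  (0 <= l) = (0 <= complex.Re l) && (complex.Im l == 0).
Proof. by case: l => a b; rewrite lecE /= andbC eq_sym. Qed.

(** Each condition that fails provides a vector excluded by one of the previous
lemmas: a singular pencil has the nonreal eigenvalue 1 + i among all others, a
nonzero nilpotent block contains a chain at infinity, and eigenvectors and Jordan
chains of L are eigenvectors and chains of the pencil (A, B). *)
Lemma similar_necessary (R : realType) (d : nat) (A B : 'M[R[i]]_d) :
  similar_to_self_adjoint L2_inner (opp_op (Delta A B)) ->
  quasi_sectorial A B /\
  forall (m n : nat) (dE : (m + n)%N = d) (F G : 'M[R[i]]_d)
         (L : 'M[R[i]]_m) (N : 'M[R[i]]_n),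
    quasi_Weierstrass A B dE F G L N ->
    (forall l : R[i], eigenvalue L l -> complex.Re l < 0 \/ 0 <= l) /\
    (forall l : R[i], eigenvalue L l -> 0 <= l ->
       algebraic_multiplicity L l = geometric_multiplicity L l).
Proof.
move=> /similar_resolvent_bound[M M0 bnd].
have est := quasimode_estimate M0 bnd.
split.
  (* a kernel vector of A - (1 + i) B would be an eigenvector for l = 1 + i *)
  apply: (@quasi_sectorial_of_no_chain _ _ _ _ (- Complex 1 1)); last first.
    by move=> v w; exact: (no_chain_at_infinity M0 est).
  apply/eqP => /det0_colP[u u0 uAB]; move/eqP: u0; apply.
  apply: (no_nonreal_eigenvalue est (l := Complex 1 1)); rewrite ?ltr01 ?oner_eq0//.
  by apply/eqP; rewrite -subr_eq0 scalemxAl -mulmxBl -scaleNr uAB.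
move=> m n dE F G L N; case: d / dE A B F G bnd est => A B F G bnd est.
rewrite /quasi_Weierstrass !castmx_id => -[Fu Gu _ AE BE].
(* phi embeds the first block: there A acts as L and B as the identity *)
pose phi (u : 'cV[R[i]]_m) : 'cV_(m + n) := invmx G *m col_mx u 0.
have phi0 u : phi u = 0 -> u = 0.
  move=> /(congr1 (mulmx G)); rewrite mulKVmx// mulmx0 => /eqP.
  by rewrite col_mx_eq0 => /andP[/eqP].
have Aphi u : A *m phi u = F *m col_mx (L *m u) 0.
  rewrite AE -!mulmxA mulKVmx//; congr (F *m _).
  by rewrite mul_block_col !(mul0mx, mulmx0, addr0).
have Bphi u : B *m phi u = F *m col_mx u 0.
  rewrite BE -!mulmxA mulKVmx//; congr (F *m _).
  by rewrite mul_block_col !(mul0mx, mulmx0, addr0, mul1mx).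
have Bphi_scale l u : l *: (B *m phi u) = F *m col_mx (l *: u) 0.
  by rewrite Bphi scalemxAr scale_col_mx scaler0.
split=> [l /eigenvalue_col[u u0 Lu]|l el l0].
  have ev : A *m phi u = l *: (B *m phi u) by rewrite Aphi Bphi_scale Lu.
  have [|re0] := ltP (complex.Re l) 0; [by left|right].
  have [im0|im0] := eqVneq (complex.Im l) 0; first by rewrite complex_ge0E re0 im0 eqxx.
  exfalso; move/eqP: u0; apply; apply: phi0.
  move: re0; rewrite le_eqVlt => /predU1P[re0|re0].
    apply: (no_imaginary_eigenvalue M0 est im0); rewrite ev; congr (_ *: _).
    by apply: complex_ext; rewrite //= -re0.
  exact: (no_nonreal_eigenvalue est re0 im0 ev).
rewrite /algebraic_multiplicity /geometric_multiplicity; apply/mup_rank.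
apply: semisimple_of_kernel => w; set u := _ *m w => Nu.
have Lu : L *m u = l *: u by apply/eqP; rewrite -subr_eq0 -mul_scalar_mx -mulmxBl Nu.
have Lw : L *m w = l *: w + u by rewrite /u mulmxBl mul_scalar_mx addrC subrK.
move: l0; rewrite complex_ge0E => /andP[re0 /eqP im0].
have lE : l = Complex (complex.Re l) 0 by apply: complex_ext; rewrite //= im0.
apply: phi0; apply: (no_chain_nonneg M0 est (l := complex.Re l) (v := phi w) re0); rewrite -lE.
  by rewrite Aphi Bphi_scale Lu.
by rewrite Aphi Bphi_scale Bphi Lw -mulmxDr add_col_mx addr0.
Qed.

(** * Canonical boundary conditions *)

Lemma kernel_of_semisimple (F : fieldType) n (N : 'M[F]_n) :
  \rank (N *m N) = \rank N -> forall w : 'cV_n, N *m (N *m w) = 0 -> N *m w = 0.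
Proof.
pose k := \rank N; pose g := (n - k)%N; have rN : \rank N = k by [].
have e : (k + g)%N = n by rewrite /g subnKC// rank_leq_row.
rewrite rN; clearbody k g; case: n / e N rN => N rN rNN w.
have [U [Y [Uu Yu UN]]] := semisimple_split rN rNN.
have -> : N = invmx U *m (block_mx Y 0 0 0 *m U) by rewrite -UN mulKmx.
rewrite -!mulmxA mulKVmx// -[U *m w]vsubmxK; set x := usubmx _; set y := dsubmx _.
rewrite !mul_block_col !(mul0mx, addr0) => /(congr1 (mulmx U)).
rewrite mulKVmx// mulmx0 => /eqP; rewrite col_mx_eq0 => /andP[/eqP YYx _].
have -> : Y *m x = 0 by rewrite -[Y *m x](mulKmx Yu) YYx mulmx0.
by rewrite col_mx0 mulmx0.
Qed.

Section CanonicalBoundaryConditions.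
Context {R : realType}.
Local Notation C := R[i].

(** Splitting off one nonnegative eigenvalue at a time, L becomes similar to a matrix
that is diagonal with nonnegative entries outside S. The last conclusion is the
statement that the block supported by S keeps only the eigenvalues with negative
real part, in a form that needs no cast to the size of that block. *)
Lemma split_nonneg_spectrum m (L : 'M[C]_m) :
  (forall l, eigenvalue L l -> complex.Re l < 0 \/ 0 <= l) ->
  (forall l, eigenvalue L l -> 0 <= l ->
     forall w : 'cV_m, (L - l%:M) *m ((L - l%:M) *m w) = 0 -> (L - l%:M) *m w = 0) ->
  exists (P D : 'M[C]_m) (S : pred 'I_m),
    [/\ P \in unitmx, P *m L = D *m P,
        forall i j, ~~ (S i && S j) -> i != j -> D i j = 0,
        forall i, ~~ S i -> 0 <= D i i &
        forall (v : 'rV_m) l, v != 0 -> (forall i, ~~ S i -> v 0 i = 0) -> v *m D = l *: v ->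
          complex.Re l < 0].
Proof.
have [N] := ubnP m; elim: N m L => // N IH m L; rewrite ltnS => mN H1 H2.
have [[l el l0]|no] := pselect (exists2 l : C, eigenvalue L l & (0 <= l)); last first.
  exists 1%:M, L, predT; split=> //; first exact: unitmx1.
  - by rewrite mul1mx mulmx1.
  - move=> v l v0 _ vL; have el : eigenvalue L l by apply/eigenvalueP; exists v.
    by have [//|l0] := H1 l el; case: no; exists l.
pose k := \rank (L - l%:M); pose g := (m - k)%N.
have rN : \rank (L - l%:M) = k by [].
have e : (k + g)%N = m by rewrite /g subnKC// rank_leq_row.
have g0 : (0 < g)%N.
  move: el; rewrite /eigenvalue -mxrank_eq0 mxrank_ker -/k -/g.
  by rewrite lt0n.
have rNN := semisimple_of_kernel (H2 l el l0); rewrite rN in rNN.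
clearbody k g; case: m / e L mN H1 H2 el rN rNN => L mN H1 H2 el rN rNN.
have [U [Y [Uu Yu UN]]] := semisimple_split rN rNN.
pose L2 := Y + l%:M.
have UL : U *m L = (block_mx L2 0 0 (l%:M) : 'M[C]_(k + g)) *m U.
  have -> : block_mx L2 0 0 (l%:M) = block_mx Y 0 0 0 + l%:M :> 'M[C]_(k + g).
    by rewrite (scalar_mx_block k g) add_block_mx !addr0 add0r.
  by rewrite mulmxDl -UN -scalar_mxC -mulmxDr subrK.
have kN : (k < N)%N by rewrite (@leq_trans (k + g)%N)// -{1}[k]addn0 ltn_add2l.
have H1' r : eigenvalue L2 r -> eigenvalue L r.
  move=> /eigenvalueP[v vL v0]; apply/eigenvalueP; exists (row_mx v 0 *m U).
    rewrite -mulmxA UL mulmxA mul_row_block !(mul0mx, mulmx0, addr0) vL.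
    by rewrite -[X in row_mx _ X](scaler0 _ r) -scale_row_mx scalemxAl.
  apply: contra v0 => /eqP /(congr1 (mulmx^~ (invmx U))).
  by rewrite mulmxK// mul0mx => /eqP; rewrite row_mx_eq0 => /andP[].
have shift r (w : 'cV_k) : (L - r%:M) *m (invmx U *m col_mx w 0) =
    invmx U *m col_mx ((L2 - r%:M) *m w) (0 : 'cV_g).
  apply: (can_inj (mulKmx Uu)); rewrite [RHS]mulKVmx//.
  rewrite mulmxA mulmxBr UL [U *m _]scalar_mxC -mulmxBl -mulmxA mulKVmx//.
  rewrite (scalar_mx_block k g) opp_block_mx add_block_mx mul_block_col.
  by rewrite !oppr0 !addr0 !mulmx0 mul0mx !addr0.
have H2' r : eigenvalue L2 r -> 0 <= r -> forall w : 'cV_k,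
    (L2 - r%:M) *m ((L2 - r%:M) *m w) = 0 -> (L2 - r%:M) *m w = 0.
  move=> er r0 w w0; have := H2 r (H1' r er) r0 (invmx U *m col_mx w 0).
  rewrite !shift w0 col_mx0 mulmx0 => /(_ erefl) /(congr1 (mulmx U)).
  by rewrite mulKVmx// mulmx0 => /eqP; rewrite col_mx_eq0 => /andP[/eqP].
have [P2 [D2 [S2 [P2u PL2 off diag ev]]]] := IH k L2 kN (fun r er => H1 r (H1' r er)) H2'.
pose P : 'M[C]_(k + g) := block_mx P2 0 0 (1%:M).
have Pu : P \in unitmx by rewrite unitmxE det_ublock det1 mulr1 -unitmxE.
pose S (i : 'I_(k + g)) := match fintype.split i with inl j => S2 j | inr _ => false end.
have Sl j : S (lshift g j) = S2 j by rewrite /S -[lshift g j]/(unsplit (inl j)) unsplitK.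
have Sr j : S (rshift k j) = false by rewrite /S -[rshift k j]/(unsplit (inr j)) unsplitK.
exists (P *m U), (block_mx D2 0 0 (l%:M)), S; split.
- by rewrite unitmx_mul Pu.
- rewrite -mulmxA UL !mulmxA; congr (_ *m U).
  by rewrite !mulmx_block !(mul0mx, mulmx0, addr0, add0r, mul1mx, mulmx1) PL2.
- move=> i j; case: (split_ordP i) => i' ->; case: (split_ordP j) => j' ->.
  + by rewrite !Sl block_mxEul => nS ij; apply: off.
  + by rewrite block_mxEur mxE.
  + by rewrite block_mxEdl mxE.
  + by rewrite block_mxEdr mxE (inj_eq (@rshift_inj _ _)) => _ /negbTE ->.
- move=> i; case: (split_ordP i) => i' ->; first by rewrite Sl block_mxEul; exact: diag.
  by rewrite block_mxEdr mxE eqxx.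
- move=> v r v0 vS; rewrite -[v]hsubmxK.
  have -> : rsubmx v = 0.
    by apply/matrixP => i j; rewrite !mxE (ord1 i) vS// Sr.
  rewrite mul_row_block !(mul0mx, mulmx0, addr0) scale_row_mx => /eq_row_mx[vD _].
  apply: ev vD; last by move=> i Si; rewrite mxE vS// Sl.
  apply: contra v0 => /eqP v1; rewrite -[v]hsubmxK v1 row_mx_eq0 eqxx /=.
  by apply/eqP/matrixP => i j; rewrite !mxE (ord1 i) vS// Sr.
Qed.

(** After multiplying A and B by an invertible F on the left and changing the
coordinates by G, the conditions indexed by S read u' = M u, where every
eigenvalue of M has a positive real part, and the others are separated, real Robin
or Dirichlet conditions. M is extended by the identity outside S so that it keeps
the size d. *)
Definition canonical_bc d (A B F G : 'M[C]_d) (S : pred 'I_d) (M : 'M[C]_d) (a b : 'I_d -> R) :=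
  [/\ F \in unitmx, G \in unitmx,
      A = F *m (\matrix_(i, j) (if S i then - M i j else (Complex (a i) 0) *+ (i == j))) *m G,
      B = F *m (\matrix_(i, j) ((if S i then 1 else Complex (b i) 0) *+ (i == j))) *m G &
      [/\ forall i j, ~~ (S i && S j) -> M i j = (i == j)%:R,
          forall l, eigenvalue M l -> 0 < complex.Re l &
          forall i, ~~ S i -> b i = 1 \/ a i = 1 /\ b i = 0]].

(** On the first block of the normal form the condition is u' = - L u. The part of L
with Re < 0 becomes M = - L, the semisimple nonnegative eigenvalues give real Robin
conditions, and the second block gives Dirichlet conditions. *)
Lemma quasi_sectorial_canonical d (A B : 'M[C]_d) :
  quasi_sectorial A B ->
  (forall (m n : nat) (dE : (m + n)%N = d) (F G : 'M[C]_d) (L : 'M[C]_m) (N : 'M[C]_n),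
    quasi_Weierstrass A B dE F G L N ->
    (forall l, eigenvalue L l -> complex.Re l < 0 \/ 0 <= l) /\
    (forall l, eigenvalue L l -> 0 <= l ->
       algebraic_multiplicity L l = geometric_multiplicity L l)) ->
  exists F G S M a b, canonical_bc A B F G S M a b.
Proof.
move=> [_ [m [n [dE [F [G [L [N [qW N0]]]]]]]]] /(_ _ _ _ _ _ _ _ qW)[H1 H2].
have {}H2 l : eigenvalue L l -> 0 <= l ->
    forall w : 'cV_m, (L - l%:M) *m ((L - l%:M) *m w) = 0 -> (L - l%:M) *m w = 0.
  by move=> el l0; apply: kernel_of_semisimple; apply/mup_rank; exact: H2.
have [P [D [S [Pu PL off diag ev]]]] := split_nonneg_spectrum H1 H2.
case: d / dE A B F G qW => A B F G [Fu Gu _]; rewrite !castmx_id N0 => AE BE.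
pose Pb : 'M[C]_(m + n) := block_mx P 0 0 (1%:M).
have Pbu : Pb \in unitmx by rewrite unitmxE det_ublock det1 mulr1 -unitmxE.
pose T (i : 'I_(m + n)) := match fintype.split i with inl j => S j | inr _ => false end.
have Tl j : T (lshift n j) = S j by rewrite /T -[lshift n j]/(unsplit (inl j)) unsplitK.
have Tr j : T (rshift m j) = false by rewrite /T -[rshift m j]/(unsplit (inr j)) unsplitK.
pose DD : 'M[C]_(m + n) := block_mx D 0 0 (1%:M).
pose M : 'M[C]_(m + n) := \matrix_(i, j) if T i && T j then - DD i j else (i == j)%:R.
have DDoff i j : ~~ (T i && T j) -> i != j -> DD i j = 0.
  case: (split_ordP i) => i' ->; case: (split_ordP j) => j' ->.
  - by rewrite !Tl block_mxEul => nS ij; apply: off.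
  - by rewrite block_mxEur mxE.
  - by rewrite block_mxEdl mxE.
  - by rewrite block_mxEdr mxE (inj_eq (@rshift_inj _ _)) => _ /negbTE ->.
have DDreal i : ~~ T i -> DD i i = Complex (complex.Re (DD i i)) 0.
  case: (split_ordP i) => i' ->; last by rewrite block_mxEdr mxE eqxx.
  rewrite Tl block_mxEul => /diag; case: (D i' i') => x y.
  by rewrite lecE /= => /andP[/eqP <-].
pose a i := complex.Re (DD i i).
pose b (i : 'I_(m + n)) : R := match fintype.split i with inl _ => 1 | inr _ => 0 end.
exists (F *m invmx Pb), (Pb *m G), T, M, a, b; split.
- by rewrite unitmx_mul Fu unitmx_inv.
- by rewrite unitmx_mul Pbu.
- rewrite AE -!mulmxA; congr (F *m _); rewrite !mulmxA; congr (_ *m G).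
  apply: (can_inj (mulKmx Pbu)); rewrite !mulmxA mulmxV// mul1mx.
  have -> : \matrix_(i, j) (if T i then - M i j else Complex (a i) 0 *+ (i == j)) = DD.
    apply/matrixP => i j; rewrite mxE; case: ifPn => Ti.
      rewrite [M i j]mxE; case: ifPn => [_|nT]; first by rewrite opprK.
      have ij : i != j by apply: contra nT => /eqP <-; rewrite Ti.
      by rewrite (negbTE ij) oppr0; apply/esym/DDoff.
    have [<-|ij] := eqVneq i j; first by rewrite mulr1n -DDreal.
    by rewrite mulr0n DDoff// negb_and Ti.
  by rewrite /Pb /DD !mulmx_block !(mul0mx, mulmx0, addr0, add0r, mul1mx, mulmx1) PL.
- rewrite BE -!mulmxA; congr (F *m _); rewrite !mulmxA; congr (_ *m G).
  apply: (can_inj (mulKmx Pbu)); rewrite !mulmxA mulmxV// mul1mx.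
  have -> : \matrix_(i, j) ((if T i then 1 else Complex (b i) 0) *+ (i == j)) =
      block_mx (1%:M) 0 0 0 :> 'M[C]_(m + n).
    apply/matrixP => i j; rewrite mxE.
    have bl i' : b (lshift n i') = 1 by rewrite /b -[lshift n i']/(unsplit (inl i')) unsplitK.
    have br i' : b (rshift m i') = 0 by rewrite /b -[rshift m i']/(unsplit (inr i')) unsplitK.
    case: (split_ordP i) => i' ->; case: (split_ordP j) => j' ->.
    + rewrite block_mxEul mxE bl if_same (inj_eq (@lshift_inj _ _)).
      by [].
    + by rewrite block_mxEur mxE eq_lrshift mulr0n.
    + by rewrite block_mxEdl mxE eq_rlshift mulr0n.
    + by rewrite block_mxEdr mxE Tr br mul0rn.
  by rewrite /Pb !mulmx_block !(mul0mx, mulmx0, addr0, add0r, mul1mx, mulmx1).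
split.
- by move=> i j nT; rewrite mxE (negbTE nT).
- move=> l /eigenvalueP[v vM v0].
  have [vT|/existsNP[i /not_implyP[Ti vi]]] := pselect (forall i, ~~ T i -> v 0 i = 0); last first.
    have := congr1 (fun u : 'rV_(m + n) => u 0 i) vM; rewrite !mxE (bigD1 i)//= mxE.
    rewrite (negbTE Ti) /= eqxx mulr1 big1 ?addr0 => [/eqP|j ji]; last first.
      by rewrite mxE (negbTE Ti) andbF (negbTE ji) mulr0.
    rewrite -subr_eq0 -{1}[v 0 i]mul1r -mulrBl mulf_eq0 subr_eq0 => /orP[/eqP <-|/eqP//].
    exact: ltr01.
  have vr : rsubmx v = 0 by apply/matrixP => i j; rewrite !mxE (ord1 i) vT// Tr.
  have : complex.Re (- l) < 0.
    apply: (ev (lsubmx v)).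
    - by apply: contra v0 => /eqP v1; rewrite -[v]hsubmxK v1 vr row_mx_eq0 !eqxx.
    - by move=> i Si; rewrite mxE vT// Tl.
    have vDD : v *m DD = - l *: v.
      rewrite scaleNr -vM; apply/matrixP => i j; rewrite !mxE -sumrN; apply: eq_bigr => k _.
      rewrite (ord1 i) [M k j]mxE; have [Tk|Tk] := boolP (T k); last by rewrite vT// !mul0r oppr0.
      rewrite /=; case: ifPn => Tj; first by rewrite mulrN opprK.
      have kj : k != j by apply: contra Tj => /eqP <-.
      by rewrite (negbTE kj) DDoff ?mulr0 ?oppr0// negb_and Tj orbT.
    move: vDD; set w := lsubmx v; have -> : v = row_mx w 0 by rewrite -vr hsubmxK.
    rewrite /DD mul_row_block !(mul0mx, mulmx0, addr0) scale_row_mx.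
    by move=> /eq_row_mx[].
  by case: (l) => x y /=; rewrite oppr_lt0.
- move=> i; rewrite /b /a; case: (split_ordP i) => i' -> _.
    by left.
  by right; split=> //; rewrite block_mxEdr mxE eqxx.
Qed.

End CanonicalBoundaryConditions.

(** * Bounded operators on the star graph *)

Section BoundedOperators.
Context {R : realType} {d : nat}.
Notation hn := (hnorm (@L2_inner R d)).
Notation H := (L2 R d).
Implicit Types (Phi Psi : H -> H) (P Q : 'M[R[i]]_d) (z w : R[i]) (f g : L2fun R d).

Definition bounded_linear Phi := linear Phi /\ bounded_op L2_inner Phi.

Lemma hnormD_sqr (x y : H) : hn (x + y) ^+ 2 <= 2 * hn x ^+ 2 + 2 * hn y ^+ 2.
Proof.
rewrite -[x]L2_class_repr -[y]L2_class_repr -L2_classD !hnorm_class_sqr.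
exact: sqnD_le.
Qed.

Lemma hnormZ z (x : H) : hn (z *: x) ^+ 2 = sqr_norm z * hn x ^+ 2.
Proof.
rewrite -[x]L2_class_repr -L2_class_scale !hnorm_class_sqr /sqn mulr_sumr.
by apply: eq_bigr => e _; rewrite -sqr_L2normZ//; exact: L2fun_square_integrable.
Qed.

Lemma bounded_of_sqr Phi (M : R) : (forall x, hn (Phi x) ^+ 2 <= M * hn x ^+ 2) ->
  bounded_op L2_inner Phi.
Proof.
move=> h; exists (Num.sqrt `|M|) => x.
have Mx0 : 0 <= Num.sqrt `|M| * hn x by rewrite mulr_ge0 ?sqrtr_ge0 ?hnorm_ge0.
rewrite -(@ler_pXn2r _ 2) ?nnegrE ?hnorm_ge0// exprMn (sqr_sqrtr (normr_ge0 M)).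
by apply: (le_trans (h x)); rewrite ler_wpM2r ?sqr_ge0// ler_norm.
Qed.

Lemma bounded_sqr Phi : bounded_op L2_inner Phi ->
  exists2 M : R, 0 <= M & forall x, hn (Phi x) ^+ 2 <= M * hn x ^+ 2.
Proof.
move=> [M h]; exists (M ^+ 2) => [|x]; first exact: sqr_ge0.
have Mx0 : 0 <= M * hn x by exact: le_trans (hnorm_ge0 (Phi x)) (h x).
by rewrite -exprMn lerXn2r ?nnegrE ?hnorm_ge0.
Qed.

Lemma bounded_linear_id : bounded_linear (fun x => x).
Proof. by split=> [c x y //|]; exists 1 => x; rewrite mul1r. Qed.

Lemma bounded_linear_comp Phi Psi : bounded_linear Phi -> bounded_linear Psi ->
  bounded_linear (fun x => Phi (Psi x)).
Proof.
move=> [l1 /bounded_sqr[M1 M10 b1]] [l2 /bounded_sqr[M2 M20 b2]].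
split=> [c x y|]; first by rewrite l2 l1.
apply: (@bounded_of_sqr _ (M1 * M2)) => x; apply: le_trans (b1 _) _.
by rewrite -mulrA ler_wpM2l.
Qed.

Lemma bounded_linearD Phi Psi : bounded_linear Phi -> bounded_linear Psi ->
  bounded_linear (fun x => Phi x + Psi x).
Proof.
move=> [l1 /bounded_sqr[M1 M10 b1]] [l2 /bounded_sqr[M2 M20 b2]].
split=> [c x y|]; first by rewrite l2 l1 scalerDr addrACA.
apply: (@bounded_of_sqr _ (2 * M1 + 2 * M2)) => x; apply: le_trans (hnormD_sqr _ _) _.
by rewrite [leRHS]mulrDl -!mulrA; apply: lerD; rewrite ler_wpM2l.
Qed.

Lemma bounded_linearZ z Phi : bounded_linear Phi -> bounded_linear (fun x => z *: Phi x).
Proof.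
move=> [l /bounded_sqr[M M0 b]]; split=> [c x y|].
  by rewrite l scalerDr !scalerA mulrC.
apply: (@bounded_of_sqr _ (sqr_norm z * M)) => x; rewrite hnormZ -mulrA.
by rewrite ler_wpM2l ?sqr_norm_ge0.
Qed.

Lemma bounded_linearN Phi : bounded_linear Phi -> bounded_linear (fun x => - Phi x).
Proof.
move=> /(bounded_linearZ (-1)); rewrite (_ : (fun x => - Phi x) = (fun x => -1 *: Phi x))//.
by apply/funext => x; rewrite scaleN1r.
Qed.

Lemma bounded_linear0 : bounded_linear (fun=> 0).
Proof.
have := bounded_linearZ 0 bounded_linear_id.
by rewrite (_ : (fun x : H => 0 *: x) = (fun=> 0))//; apply/funext => x; rewrite scale0r.
Qed.

Lemma linear_add Phi (x y : H) : linear Phi -> Phi (x + y) = Phi x + Phi y.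
Proof. by move=> l; have := l 1 x y; rewrite !scale1r. Qed.

Lemma linear_zero Phi : linear Phi -> Phi 0 = 0.
Proof. by move=> l; have := l (-1) 0 0; rewrite scaler0 addr0 scaleN1r addNr. Qed.

Lemma linear_scale Phi z (x : H) : linear Phi -> Phi (z *: x) = z *: Phi x.
Proof. by move=> l; have := l z x 0; rewrite !addr0 linear_zero// addr0. Qed.

Lemma linear_opp Phi (x : H) : linear Phi -> Phi (- x) = - Phi x.
Proof. by move=> l; rewrite -scaleN1r linear_scale// scaleN1r. Qed.

Lemma linear_sub Phi (x y : H) : linear Phi -> Phi (x - y) = Phi x - Phi y.
Proof. by move=> l; rewrite linear_add// linear_opp. Qed.

Definition L2_map (op : L2fun R d -> L2fun R d) (x : H) : H := L2_class (op (repr x)).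

Lemma L2_mapP (op : L2fun R d -> L2fun R d) (M : R) :
  (forall c f g e t, 0 <= t -> op (c *: f + g) e t = c * op f e t + op g e t) ->
  (forall f, sqn (op f) <= M * sqn f) ->
  bounded_linear (L2_map op) /\ forall f, L2_map op (L2_class f) = L2_class (op f).
Proof.
move=> lin bnd; have [Phi [bPhi PhiE]] := L2_lift lin bnd.
have -> : L2_map op = Phi.
  by apply/funext => x; rewrite -[in RHS](L2_class_repr x) PhiE.
by split=> //; split=> // c x y; rewrite linearP.
Qed.

Lemma mxact_si P f e : square_integrable (fun t => \sum_j P e j * f j t).
Proof. by apply: square_integrable_sum => j; exact/square_integrable_fZ/L2fun_square_integrable. Qed.

Definition mxact P f : L2fun R d := mkL2 (mxact_si P f).
Definition mxop P : H -> H := L2_map (mxact P).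

Lemma sqr_L2norm_sum I (r : seq I) (h : I -> R -> R[i]) :
  (forall j, square_integrable (h j)) ->
  sqr_L2norm (fun t => \sum_(j <- r) h j t) <= (2 ^ size r)%:R * \sum_(j <- r) sqr_L2norm (h j).
Proof.
move=> hi; elim: r => [|j r ih].
  rewrite !big_nil mulr0 (@eq_sqr_L2norm _ _ (fun=> 0)) ?sqr_L2norm0// => t _.
  by rewrite big_nil.
rewrite big_cons /= expnS natrM -mulrA.
rewrite (@eq_sqr_L2norm _ _ (fun t => h j t + \sum_(j <- r) h j t)); last first.
  by move=> t _; rewrite big_cons.
apply: le_trans (sqr_L2normD_le _ _) _ => //; first exact: square_integrable_sum.
rewrite -mulrDr ler_pM2l// mulrDr lerD// ler_peMl ?sqr_L2norm_ge0//.
by rewrite ler1n expn_gt0.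
Qed.

Lemma mxact_linear P c f g e t : mxact P (c *: f + g) e t = c * mxact P f e t + mxact P g e t.
Proof.
rewrite /= mulr_sumr -big_split; apply: eq_bigr => j _ /=.
by transitivity (P e j * (c * f j t + g j t)) => //; ring.
Qed.

Lemma mxopP P : bounded_linear (mxop P) /\ forall f, mxop P (L2_class f) = L2_class (mxact P f).
Proof.
pose N := (2 ^ size (index_enum 'I_d))%:R : R.
apply: (@L2_mapP _ (\sum_e N * \sum_j sqr_norm (P e j))) => [c f g e t _|f].
  exact: mxact_linear.
rewrite {1}/sqn mulr_suml; apply: ler_sum => e _.
apply: le_trans (sqr_L2norm_sum _ _) _.
  by move=> j; exact/square_integrable_fZ/L2fun_square_integrable.
rewrite -mulrA ler_wpM2l// mulr_suml; apply: ler_sum => j _.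
rewrite sqr_L2normZ ?ler_wpM2l ?sqr_norm_ge0//; last exact: L2fun_square_integrable.
rewrite /sqn (bigD1 j)//= lerDl; apply: sumr_ge0 => i _; exact: sqr_L2norm_ge0.
Qed.

Lemma mxopM P Q x : mxop P (mxop Q x) = mxop (P *m Q) x.
Proof.
rewrite -[x]L2_class_repr !(mxopP _).2; apply: L2_class_eq => e t _ /=.
under eq_bigr do rewrite mulr_sumr; rewrite exchange_big /=; apply: eq_bigr => j _.
by rewrite mxE mulr_suml; apply: eq_bigr => k _; rewrite mulrA.
Qed.

Lemma mxopD P Q x : mxop (P + Q) x = mxop P x + mxop Q x.
Proof.
rewrite -[x]L2_class_repr !(mxopP _).2 -L2_classD; apply: L2_class_eq => e t _.
by rewrite L2funD /= -big_split; apply: eq_bigr => j _; rewrite mxE mulrDl.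
Qed.

Lemma mxop_scalar z x : mxop z%:M x = z *: x.
Proof.
rewrite -[x]L2_class_repr !(mxopP _).2 -L2_class_scale; apply: L2_class_eq => e t _.
rewrite L2funZ /= (bigD1 e)//= mxE eqxx big1 ?addr0// => j je.
by rewrite mxE eq_sym (negbTE je) mul0r.
Qed.

Lemma mxop1 x : mxop 1%:M x = x.
Proof. by rewrite mxop_scalar scale1r. Qed.

Lemma mxop0 x : mxop 0 x = 0.
Proof. by have := mxop_scalar 0 x; rewrite scale0r raddf0. Qed.

End BoundedOperators.

(** * The transmutation operator *)

Section ForwardOperator.
Context {R : realType} {d : nat}.
Notation hn := (hnorm (@L2_inner R d)).
Notation H := (L2 R d).
Implicit Types (P Q M : 'M[R[i]]_d) (z w : R[i]) (f g s : L2fun R d).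

Lemma fwd_square_integrable z f e :
  square_integrable (if 0 < complex.Re z then forward z (f e) else fun=> 0).
Proof.
case: ifPn => z0; last exact: square_integrable0.
have fi := L2fun_square_integrable f e.
have [p l] := forwardP z (square_integrable_locally fi).
by have [] := forward_bound z0 l fi p (forward0 _ _).
Qed.

(** The edgewise solution of s' + z s = f with s 0 = 0. For Re z <= 0, where it need
not be square-integrable, 0 is a default value. *)
Definition fwd z f : L2fun R d := mkL2 (fwd_square_integrable z f).
Definition Kop z : H -> H := L2_map (fwd z).

Lemma fwdE z f e x : 0 < complex.Re z -> fwd z f e x = forward z (f e) x.
Proof. by move=> z0; rewrite /= z0. Qed.

Lemma fwd0 z f e : fwd z f e 0 = 0.
Proof. by rewrite /=; case: ifP => // _; rewrite forward0. Qed.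

Lemma locally_intC_L2fun f e : locally_intC (f e).
Proof. exact/square_integrable_locally/L2fun_square_integrable. Qed.

Lemma fwdP z f e : 0 < complex.Re z ->
  is_primitive (fwd z f e) (fun x => f e x - z * fwd z f e x).
Proof.
move=> z0; have [p _] := forwardP z (locally_intC_L2fun f e).
by apply: eq_is_primitive p => x _; rewrite fwdE.
Qed.

Lemma fwd_uniq z f s e : 0 < complex.Re z ->
  is_primitive (s e) (fun x => f e x - z * s e x) -> s e 0 = 0 ->
  forall x, 0 <= x -> s e x = fwd z f e x.
Proof.
move=> z0 p s0 x x0; rewrite fwdE//.
by apply: forward_uniq => //; exact: locally_intC_L2fun.
Qed.

Lemma KopP z : 0 < complex.Re z ->
  bounded_linear (Kop z) /\ forall f, Kop z (L2_class f) = L2_class (fwd z f).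
Proof.
move=> z0; apply: (@L2_mapP _ _ _ ((complex.Re z)^-1 ^+ 2)) => [c f g e t t0|f].
  rewrite !fwdE//.
  by rewrite -(forward_linear c z0 (locally_intC_L2fun f e) (locally_intC_L2fun g e)).
rewrite /sqn mulr_sumr; apply: ler_sum => e _.
by have [] := forward_bound z0 (locally_intC_L2fun (fwd z f) e)
  (L2fun_square_integrable f e) (fwdP f e z0) (fwd0 z f e).
Qed.

Lemma mxop_Kop P z x : 0 < complex.Re z -> mxop P (Kop z x) = Kop z (mxop P x).
Proof.
move=> z0; rewrite -[x]L2_class_repr (KopP z0).2 !(mxopP P).2 (KopP z0).2.
set f := repr x; apply: L2_class_eq => e t t0.
apply: (fwd_uniq (f := mxact P f) (s := mxact P (fwd z f))) => //.
  have li j : locally_intC (fun t => f j t - z * fwd z f j t).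
    by apply: locally_intCB; [exact: locally_intC_L2fun|apply: locally_intCZ; exact: locally_intC_L2fun].
  have p j := is_primitiveZ (P e j) (li j) (fwdP f j z0).
  apply: eq_is_primitive (is_primitive_sum (index_enum 'I_d) (fun j => locally_intCZ (P e j) (li j)) p) => //= u _.
  rewrite mulr_sumr -sumrB; apply: eq_bigr => j _.
  by rewrite mulrBr mulrCA.
transitivity (\sum_j P e j * fwd z f j 0) => //.
by rewrite big1// => j _; rewrite fwd0 mulr0.
Qed.

(** The resolvent identity for d/dx with the condition s(0) = 0. *)
Lemma Kop_resolvent z w x : 0 < complex.Re z -> 0 < complex.Re w ->
  Kop w x - Kop z x = (z - w) *: Kop w (Kop z x).
Proof.
move=> z0 w0; have [[lw _] Ew] := KopP w0.
have E : Kop w (x + (w - z) *: Kop z x) = Kop z x.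
  rewrite -[x]L2_class_repr (KopP z0).2 -L2_class_scale -L2_classD Ew.
  apply/esym; apply: L2_class_eq => e t t0; apply: fwd_uniq => //; last exact: fwd0.
  apply: eq_is_primitive (fwdP (repr x) e z0) => // u _.
  rewrite L2funD L2funZ; ring.
move: E; rewrite (linear_add _ _ lw) (linear_scale _ _ lw) => E.
apply: (addIr (Kop z x)); rewrite subrK -{2}E addrCA -scalerDl.
by rewrite [z - w + _]addrC addrA subrK subrr scale0r addr0.
Qed.

Lemma Kop_comm z w x : 0 < complex.Re z -> 0 < complex.Re w ->
  Kop w (Kop z x) = Kop z (Kop w x).
Proof.
move=> z0 w0; have [->//|zw] := eqVneq z w.
have zw0 : z - w != 0 by rewrite subr_eq0.
have : (z - w) *: Kop w (Kop z x) = (z - w) *: Kop z (Kop w x).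
  rewrite -Kop_resolvent// -[z - w]opprB scaleNr -Kop_resolvent//.
  by rewrite opprB.
by move=> /(congr1 (fun y => (z - w)^-1 *: y)); rewrite !scalerA mulVf// !scale1r.
Qed.

Section Transmutation.
Variable M : 'M[R[i]]_d.
Hypothesis M_accretive : forall l, eigenvalue M l -> 0 < complex.Re l.

Let one_gt0 : 0 < complex.Re (1 : R[i]). Proof. exact: ltr01. Qed.

(** (d/dx + M) (d/dx + 1)^-1, where the inverse is taken with the condition
s(0) = 0. *)
Definition transmutation (x : H) : H := x + mxop (M - 1%:M) (Kop 1 x).
Local Notation X := transmutation.

(** The inverse of 1 + (z - 1) K_1, i.e. (d/dx + 1) (d/dx + z)^-1: what the inverse of
[transmutation] would be for M = z. *)
Let t z (x : H) : H := x - (z - 1) *: Kop z x.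

Let bX : bounded_linear X.
Proof.
apply: bounded_linearD; first exact: bounded_linear_id.
by apply: bounded_linear_comp; [exact: (mxopP _).1|exact: (KopP one_gt0).1].
Qed.

Let bt z : 0 < complex.Re z -> bounded_linear (t z).
Proof.
move=> z0; apply: bounded_linearD; first exact: bounded_linear_id.
by apply: bounded_linearN; apply: bounded_linearZ; exact: (KopP z0).1.
Qed.

Let lK z : 0 < complex.Re z -> linear (Kop z). Proof. by move=> /KopP[[]]. Qed.
Let lmx P : linear (mxop P). Proof. by have [[]] := mxopP P. Qed.

Let t_mx z P x : 0 < complex.Re z -> t z (mxop P x) = mxop P (t z x).
Proof. by move=> z0; rewrite /t -mxop_Kop// (linear_sub _ _ (@lmx P)) (linear_scale _ _ (@lmx P)). Qed.

Let t_X z x : 0 < complex.Re z -> t z (X x) = X (t z x).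
Proof.
move=> z0; rewrite /X (linear_add _ _ (bt z0).1).
rewrite t_mx//; congr (_ + mxop _ _).
by rewrite /t (linear_sub _ _ (lK one_gt0)) (linear_scale _ _ (lK one_gt0)) Kop_comm.
Qed.

Let t_key z x : 0 < complex.Re z -> x - t z (X x) = mxop (z%:M - M) (t z (Kop 1 x)).
Proof.
move=> z0; have lt := (bt z0).1.
have -> : z%:M - M = (z - 1)%:M - (M - 1%:M).
  by rewrite raddfB /= opprB addrA subrK.
rewrite mxopD mxop_scalar.
have -> : mxop (- (M - 1%:M)) (t z (Kop 1 x)) = - mxop (M - 1%:M) (t z (Kop 1 x)).
  apply/eqP; rewrite -addr_eq0 -mxopD addrC subrr; apply/eqP; exact: mxop0.
rewrite /X (linear_add _ _ lt) t_mx// opprD addrA; congr (_ - _).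
rewrite /t opprB addrC subrK; congr (_ *: _).
apply: (addIr (- Kop 1 x)); rewrite (Kop_resolvent x one_gt0 z0) addrAC subrr add0r.
by rewrite -scaleNr opprB.
Qed.

Let X_t z x : 0 < complex.Re z -> X (t z x) = t z (X x).
Proof. by move=> z0; rewrite t_X. Qed.

Let lX : linear X := bX.1.

(** Induction over the roots: if Y inverts X up to p, then Y + t z (1 - X Y) inverts
X up to (z - M) p, because t z X differs from the identity by a multiple of
z - M. *)
Let approximate_inverse (r : seq R[i]) : (forall z, z \in r -> 0 < complex.Re z) ->
  exists Y W, bounded_linear Y /\
    let p := foldr (fun z Q => (z%:M - M) *m Q) 1%:M r in
    forall x, x - X (Y x) = mxop p (W x) /\ x - Y (X x) = mxop p (W x).
Proof.
elim: r => [_|z r IH rpos].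
  exists (fun=> 0), id; split; first exact: bounded_linear0.
  by move=> p x; rewrite /p /= mxop1 (linear_zero lX) !subr0.
have [|Y [W [bY YW]]] := IH; first by move=> w wr; apply: rpos; rewrite inE wr orbT.
have z0 : 0 < complex.Re z by apply: rpos; rewrite mem_head.
have [lt _] := bt z0; have [lY _] := bY.
exists (fun x => Y x + t z x - t z (X (Y x))), (fun x => t z (Kop 1 (W x))); split.
  apply: bounded_linearD; first by apply: bounded_linearD => //; exact: bt.
  by apply: bounded_linearN; apply: bounded_linear_comp; [exact: bt|exact: bounded_linear_comp].
move=> p x; pose v := x - X (Y x); pose v' := x - Y (X x).
have [e1 e2] := YW x.
have key u : u = mxop (foldr (fun z Q => (z%:M - M) *m Q) 1%:M r) (W x) ->
    u - t z (X u) = mxop p (t z (Kop 1 (W x))).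
  move=> ->; rewrite t_key// -mxop_Kop// t_mx// mxopM.
  by [].
split.
- have kv : t z (X v) = t z (X x) - t z (X (X (Y x))).
    by rewrite /v (linear_sub _ _ lX) (linear_sub _ _ lt).
  rewrite -(key v e1) kv (linear_sub _ _ lX) (linear_add _ _ lX) !X_t//.
  by rewrite /v !opprD !opprK !addrA.
- have kv : t z (X v') = t z (X x) - t z (X (Y (X x))).
    by rewrite /v' (linear_sub _ _ lX) (linear_sub _ _ lt).
  by rewrite -(key v' e2) kv /v' !opprD !opprK !addrA.
Qed.

(** The Cayley-Hamilton theorem for the split characteristic polynomial. *)
Lemma char_poly_annihilates : exists2 r : seq R[i], (forall z, z \in r -> 0 < complex.Re z) &
  foldr (fun z Q => (z%:M - M) *m Q) 1%:M r = 0.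
Proof.
have [r cE] := closed_field_poly_normal (char_poly M).
rewrite (monicP (char_poly_monic M)) scale1r in cE.
exists r => [z zr|].
  apply: M_accretive; rewrite eigenvalue_root_char cE root_prod_XsubC zr.
  by [].
case: d M cE => [|n] N cE; first by apply/matrixP => -[].
have := Cayley_Hamilton N; rewrite cE rmorph_prod /=.
under eq_bigr do rewrite rmorphB /= horner_mx_X horner_mx_C.
move=> CH; rewrite -[RHS](scaler0 _ ((-1) ^+ size r)) -CH.
elim: r {cE CH} => [|z r ih]; first by rewrite big_nil expr0 scale1r.
rewrite big_cons /= ih exprS -scalerA.
have -> : z%:M - N = -1 *: (N - z%:M) by rewrite scaleN1r opprB.
by rewrite -scalemxAl -scalemxAr.
Qed.

(** The obstruction left by [approximate_inverse] vanishes by [char_poly_annihilates]. *)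
Lemma transmutation_invertible : exists Y,
  [/\ bounded_linear Y, cancel X Y & cancel Y X].
Proof.
have [r rpos r0] := char_poly_annihilates.
have [Y [W [bY YW]]] := approximate_inverse rpos.
exists Y; split=> // x; have [e1 e2] := YW x; rewrite r0 mxop0 in e1 e2.
  by apply/esym/eqP; rewrite -subr_eq0 e2.
by apply/esym/eqP; rewrite -subr_eq0 e1.
Qed.

Lemma transmutation_bounded : bounded_linear X. Proof. exact: bX. Qed.

End Transmutation.
End ForwardOperator.

(** * Transport of boundary conditions *)

Section SimilarityTransfer.
Context {R : realType} {d : nat}.
Notation H := (L2 R d).
Implicit Types (A B P M : 'M[R[i]]_d) (f g : L2fun R d).

(** Similarity is transitive; for the graphs of T and T' two inclusions suffice. *)
Lemma similar_transfer (T T' : set (H * H)) (Phi Psi : H -> H) :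
  bounded_linear Phi -> bounded_linear Psi -> cancel Phi Psi -> cancel Psi Phi ->
  (forall x y, T (x, y) -> T' (Phi x, Phi y)) ->
  (forall x y, T' (x, y) -> T (Psi x, Psi y)) ->
  similar_to_self_adjoint L2_inner (opp_op T') ->
  similar_to_self_adjoint L2_inner (opp_op T).
Proof.
move=> bPhi bPsi K1 K2 sub1 sub2 [Phi2 [Psi2 [b1 b2 K3 K4 sa]]].
have l1 : linear Phi2 by move=> c x y; rewrite linearP.
have l2 : linear Psi2 by move=> c x y; rewrite linearP.
have [lin1 bnd1] := bounded_linear_comp (conj l1 b1) bPhi.
have [lin2 bnd2] := bounded_linear_comp bPsi (conj l2 b2).
pose Phi' : {linear H -> H} := HB.pack (fun x => Phi2 (Phi x)) (GRing.isLinear.Build _ _ _ _ _ lin1).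
pose Psi' : {linear H -> H} := HB.pack (fun x => Psi (Psi2 x)) (GRing.isLinear.Build _ _ _ _ _ lin2).
exists Phi', Psi'; split=> //.
- by move=> x /=; rewrite K3 K1.
- by move=> x /=; rewrite K2 K4.
suff -> : conj_op Phi' (opp_op T) = conj_op Phi2 (opp_op T') by [].
apply/seteqP; split => [_ [_ [[x y] Txy <-] <-]|_ [_ [[x y] Txy <-] <-]] /=.
  exists (Phi x, - Phi y); last by rewrite (linear_opp _ bPhi.1).
  by exists (Phi x, Phi y) => //; exact: sub1.
exists (Psi x, - Psi y); first by exists (Psi x, Psi y) => //; exact: sub2.
by rewrite /= (linear_opp _ bPhi.1) !K2.
Qed.

Lemma H2D f f1 f2 g g1 g2 : H2 f f1 f2 -> H2 g g1 g2 -> H2 (f + g) (f1 + g1) (f2 + g2).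
Proof.
by move=> hf hg e; have [a b] := hf e; have [a' b'] := hg e; split;
  apply: is_primitiveD => //; exact: locally_intC_L2fun.
Qed.

Lemma is_primitive_mxact P f f1 : (forall e, is_primitive (f e) (f1 e)) ->
  forall e, is_primitive (mxact P f e) (mxact P f1 e).
Proof.
move=> p e; apply: is_primitive_sum => j.
  by apply: locally_intCZ; exact: locally_intC_L2fun.
by apply: is_primitiveZ => //; exact: locally_intC_L2fun.
Qed.

Lemma H2_mxact P f f1 f2 : H2 f f1 f2 -> H2 (mxact P f) (mxact P f1) (mxact P f2).
Proof.
by move=> h e; split; apply: is_primitive_mxact => j; case: (h j).
Qed.

Lemma at_vertexD f g : at_vertex (f + g) = at_vertex f + at_vertex g.
Proof. by apply/matrixP => i j; rewrite !mxE. Qed.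

Lemma at_vertexB f g : at_vertex (f - g) = at_vertex f - at_vertex g.
Proof. by apply/matrixP => i j; rewrite !mxE. Qed.

Lemma at_vertex_mxact P f : at_vertex (mxact P f) = P *m at_vertex f.
Proof. by apply/matrixP => i j; rewrite !mxE; apply: eq_bigr => k _; rewrite mxE. Qed.

Lemma Delta_mxop A B A' B' P E : A' *m P = E *m A -> B' *m P = E *m B ->
  forall x y, Delta A B (x, y) -> Delta A' B' (mxop P x, mxop P y).
Proof.
move=> hA hB x y [f [f1 [f2 [h bc /= -> ->]]]].
exists (mxact P f), (mxact P f1), (mxact P f2); split => /=; rewrite ?(mxopP P).2//.
  exact: H2_mxact.
by rewrite !at_vertex_mxact !mulmxA hA hB -!mulmxA -mulmxDr bc mulmx0.
Qed.

End SimilarityTransfer.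

Section TransmutationDomain.
Context {R : realType} {d : nat}.
Notation H := (L2 R d).
Variables (S : pred 'I_d) (M : 'M[R[i]]_d) (a b : 'I_d -> R).
Hypothesis M_off : forall i j, ~~ (S i && S j) -> M i j = (i == j)%:R.
Hypothesis M_accretive : forall l, eigenvalue M l -> 0 < complex.Re l.

(** [bcA] and [bcB] are the matrices of [canonical_bc]. The choice Q = 1 is the
reference, where the conditions u' = u on S are separated and real. *)
Definition bcA (Q : 'M[R[i]]_d) : 'M[R[i]]_d :=
  \matrix_(i, j) (if S i then - Q i j else (Complex (a i) 0) *+ (i == j)).
Definition bcB : 'M[R[i]]_d :=
  \matrix_(i, j) ((if S i then 1 else Complex (b i) 0) *+ (i == j)).

Lemma bcP (Q : 'M[R[i]]_d) (u u1 : 'cV[R[i]]_d) : bcA Q *m u + bcB *m u1 = 0 <->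
  forall i, if S i then u1 i 0 = (Q *m u) i 0
            else Complex (a i) 0 * u i 0 + Complex (b i) 0 * u1 i 0 = 0.
Proof.
have diag (k : 'I_d -> R[i]) (w : 'cV[R[i]]_d) i : \sum_j (k i *+ (i == j)) * w j 0 = k i * w i 0.
  rewrite (bigD1 i)//= eqxx mulr1n big1 ?addr0// => j ji.
  by rewrite eq_sym (negbTE ji) mulr0n mul0r.
have row i : (bcA Q *m u + bcB *m u1) i 0 =
    if S i then u1 i 0 - (Q *m u) i 0 else Complex (a i) 0 * u i 0 + Complex (b i) 0 * u1 i 0.
  rewrite mxE [(bcA Q *m u) i 0]mxE [(bcB *m u1) i 0]mxE.
  under eq_bigr do rewrite mxE.
  under [X in _ + X]eq_bigr do rewrite mxE.
  rewrite (diag (fun i => if S i then 1 else Complex (b i) 0)).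
  case: ifPn => Si; last by rewrite (diag (fun i => Complex (a i) 0)).
  rewrite mul1r addrC mxE; congr (_ + _); rewrite -sumrN.
  by apply: eq_bigr => j _; rewrite mulNr.
split=> [h i|h].
  have := row i; rewrite h mxE; case: ifP => _ /esym // /eqP.
  by rewrite subr_eq0 => /eqP.
apply/matrixP => i j; rewrite (ord1 j) row [RHS]mxE; have := h i; case: ifP => _ // ->.
by rewrite subrr.
Qed.

Let one_gt0 : 0 < complex.Re (1 : R[i]). Proof. exact: ltr01. Qed.

Let X := transmutation M.
Let N := M - 1%:M.

Let X_class (f : L2fun R d) : X (L2_class f) = L2_class (f + mxact N (fwd 1 f)).
Proof. by rewrite /X /transmutation (KopP one_gt0).2 (mxopP _).2 L2_classD. Qed.

Let N_off i j : ~~ (S i && S j) -> N i j = 0.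
Proof. by move=> nS; rewrite !mxE M_off// subrr. Qed.

Let N_off_row (w : 'cV[R[i]]_d) i : ~~ S i -> (N *m w) i 0 = 0.
Proof.
by move=> Si; rewrite mxE big1// => j _; rewrite N_off ?mul0r// negb_and Si.
Qed.

(** If f'(0) = f(0) on S, then d^2/dx^2 commutes with (d/dx + 1)^-1 there. *)
Let fwd_second (f f1 f2 s1 : L2fun R d) : H2 f f1 f2 ->
  (forall e, is_primitive (s1 e) ((f1 - s1 : L2fun R d) e)) ->
  (forall i, S i -> f1 i 0 = s1 i 0) ->
  X (L2_class f2) = L2_class (f2 + mxact N (f1 - s1)).
Proof.
move=> h p s0; rewrite X_class !L2_classD; congr (_ + _).
apply: L2_class_eq => e x x0.
transitivity (\sum_j N e j * fwd 1 f2 j x) => //.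
transitivity (\sum_j N e j * L2fun_val (f1 - s1) j x) => //.
apply: eq_bigr => j _.
have [Sj|Sj] := boolP (S j); last by rewrite N_off ?mul0r// negb_and Sj orbT.
congr (_ * _); apply/esym; move: x x0; apply: fwd_uniq => //.
  have [_ p2] := h j.
  apply: eq_is_primitive (is_primitiveB (locally_intC_L2fun f2 j)
    (locally_intC_L2fun (f1 - s1) j) p2 (p j)) => // t _.
  by rewrite mul1r.
by rewrite L2funB s0// subrr.
Qed.

(** Let s = K_1 f, so that X f = s' + M s. If f'(0) = f(0) on S, then s(0) = s''(0) = 0
on S, so that u = X f has u(0) = s'(0) and u'(0) = M s'(0) on S. *)
Lemma Delta_transmutation x y :
  Delta (bcA 1%:M) bcB (x, y) -> Delta (bcA M) bcB (X x, X y).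
Proof.
move=> [f [f1 [f2 [h /bcP bc /= -> ->]]]].
pose s := fwd 1 f; pose s1 := f - s; pose s2 := f1 - s1.
have ps e : is_primitive (s e) (s1 e).
  by apply: eq_is_primitive (fwdP f e one_gt0) => // t _; rewrite mul1r.
have ps1 e : is_primitive (s1 e) (s2 e).
  by apply: is_primitiveB; [exact: locally_intC_L2fun|exact: locally_intC_L2fun|case: (h e)|exact: ps].
have vs : at_vertex s = 0 by apply/matrixP => i j; rewrite !mxE fwd0.
have vs1 : at_vertex s1 = at_vertex f by rewrite at_vertexB vs subr0.
exists (f + mxact N s), (f1 + mxact N s1), (f2 + mxact N s2); split => //=.
- by apply: H2D => //; apply: H2_mxact => e; split.
- apply/bcP => i; rewrite !at_vertexD !at_vertex_mxact vs vs1 mulmx0 addr0.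
  have := bc i; case: ifPn => Si; last by rewrite [(_ + N *m _) i 0]mxE N_off_row// addr0.
  rewrite mul1mx => e1; rewrite mxE e1 /N mulmxBl mul1mx !mxE.
  ring.
- apply: (fwd_second h ps1) => i Si; have := bc i; rewrite Si mul1mx => e1.
  have := congr1 (fun w : 'cV_d => w i 0) vs1; rewrite -e1 !mxE.
  by move=> <-.
Qed.

(** A primitive depends only on the class of the function that is integrated. *)
Lemma fwd_class (f g : L2fun R d) : L2_class f = L2_class g ->
  forall e x, 0 <= x -> fwd 1 f e x = fwd 1 g e x.
Proof.
move=> fg e x x0.
have p1 := fwdP f e one_gt0; have p2 := fwdP g e one_gt0.
have lf := locally_intC_L2fun f e; have lg := locally_intC_L2fun g e.
have l1 := locally_intC_L2fun (fwd 1 f) e; have l2 := locally_intC_L2fun (fwd 1 g) e.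
pose h := (f - g : L2fun R d).
have hi := L2fun_square_integrable h e.
have d1 : is_primitive (fun x => fwd 1 f e x - fwd 1 g e x)
    (fun x => h e x - 1 * (fwd 1 f e x - fwd 1 g e x)).
  apply: eq_is_primitive (is_primitiveB (locally_intCB lf (locally_intCZ 1 l1))
    (locally_intCB lg (locally_intCZ 1 l2)) p1 p2) => // t _.
  by rewrite L2funB; ring.
have := forward_energy one_gt0 (locally_intCB l1 l2) hi d1 x0.
have -> : sqr_L2norm (h e) = 0.
  have : sqn h = 0 by apply/eqP; rewrite sqn_eq0; apply/L2_classE.
  move=> /eqP; rewrite psumr_eq0 => [/allP H0|? _]; last exact: sqr_L2norm_ge0.
  by apply/eqP; apply: H0; rewrite mem_index_enum.
rewrite !fwd0 subrr mulr0 addr0 [sqr_norm 0]/sqr_norm /= expr0n addr0 => le.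
apply/eqP; rewrite -subr_eq0 -sqr_norm_eq0 eq_le sqr_norm_ge0 andbT.
apply: le_trans le; rewrite lerDl mul1r.
by apply: Rintegral_ge0 => t _; exact: sqr_norm_ge0.
Qed.

(** The class Y x has the twice differentiable representative v = u - (M - 1) s, where
s = K_1 (Y x); the conditions for v follow as in [Delta_transmutation]. *)
Lemma Delta_transmutation_inv Y : cancel X Y -> cancel Y X -> forall x y,
  Delta (bcA M) bcB (x, y) -> Delta (bcA 1%:M) bcB (Y x, Y y).
Proof.
move=> K1 K2 x y [u [u1 [u2 [h /bcP bc /= xE yE]]]].
pose f : L2fun R d := repr (Y x); have fE : L2_class f = Y x by exact: L2_class_repr.
pose s := fwd 1 f; pose v := u - mxact N s.
have vE : L2_class v = Y x.
  have E := X_class f; rewrite fE K2 xE L2_classD in E.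
  by rewrite L2_classB E addrK fE.
have sv e t : 0 <= t -> fwd 1 v e t = s e t by apply: fwd_class; rewrite vE.
pose s1 := v - s; pose v1 := u1 - mxact N s1; pose s2 := v1 - s1.
pose v2 := u2 - mxact N s2.
have ps e : is_primitive (s e) (s1 e).
  apply: eq_is_primitive (fwdP v e one_gt0) => t t0; first exact: sv.
  by rewrite sv// mul1r.
have pv e : is_primitive (v e) (v1 e).
  exact: (is_primitiveB (locally_intC_L2fun u1 e) (locally_intC_L2fun (mxact N s1) e)
    (h e).1 (is_primitive_mxact N ps e)).
have ps1 e : is_primitive (s1 e) (s2 e).
  exact: (is_primitiveB (locally_intC_L2fun v1 e) (locally_intC_L2fun s1 e) (pv e) (ps e)).
have pv1 e : is_primitive (v1 e) (v2 e).
  exact: (is_primitiveB (locally_intC_L2fun u2 e) (locally_intC_L2fun (mxact N s2) e)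
    (h e).2 (is_primitive_mxact N ps1 e)).
have vs : at_vertex s = 0 by apply/matrixP => i j; rewrite !mxE fwd0.
have vv : at_vertex v = at_vertex u by rewrite at_vertexB at_vertex_mxact vs mulmx0 subr0.
have vs1 : at_vertex s1 = at_vertex u by rewrite at_vertexB vs vv subr0.
have vv1 : at_vertex v1 = at_vertex u1 - N *m at_vertex u.
  by rewrite at_vertexB at_vertex_mxact vs1.
have hv : H2 v v1 v2 by move=> e; split.
have v1S i : S i -> v1 i 0 = at_vertex u i 0.
  move=> Si; have := bc i; rewrite Si => e1.
  have -> : v1 i 0 = at_vertex v1 i 0 by rewrite mxE.
  by rewrite vv1 mxE e1 /N mulmxBl mul1mx !mxE; ring.
have Xv2 : X (L2_class v2) = L2_class u2.
  rewrite (fwd_second hv ps1); first by rewrite subrK.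
  by move=> i Si; rewrite v1S// -vs1 mxE.
exists v, v1, v2; split=> //=; last by rewrite yE -Xv2 K1.
apply/bcP => i; have := bc i; case: ifPn => Si.
  by move=> _; rewrite mul1mx vv mxE v1S.
have e1 : (at_vertex u1 - N *m at_vertex u) i 0 = at_vertex u1 i 0.
  by rewrite mxE [X in _ + X]mxE N_off_row// subr0.
by rewrite vv vv1 e1.
Qed.

End TransmutationDomain.

(** * Exponential averages *)

Section Density.
Context {R : realType}.
Notation mu := (@lebesgue_measure R).
Notation half_line := (@half_line R).
Implicit Types (f s F : R -> R).

Let mhl : measurable (half_line : set (measurableTypeR R)).
Proof. exact: measurable_half_line. Qed.

(** s x is the average of f against the weight k e^(- k (x - y)) on [0, x], so it is close
to phi as soon as F is close to its tangent line at x. In the proof u = x - y, rho is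
the distance of F from the tangent line and w = s - phi - k rho, so that
(e^(k y) w)' = - k^2 e^(k y) rho; the polynomial p is chosen so that
(e^(k y) p)' = k^2 e^(k y) (e u + C u^2), and the two derivatives are compared. *)
Lemma exponential_average_estimate f s F (k x e C phi : R) :
  0 < k -> 0 <= x -> 0 <= e -> 0 <= C ->
  locally_int f -> locally_int s -> primitive F f ->
  primitive s (fun y => k * (f y - s y)) -> s 0 = 0 ->
  (forall y, 0 <= y -> y <= x -> `|F y - F x + phi * (x - y)| <= e * (x - y) + C * (x - y) ^+ 2) ->
  `|s x - phi| <= e + 2 * C / k + `|phi| * expR (- k * x).
Proof.
move=> k0 x0 e0 C0 fl sl Ff sp s0 tangent.
have l0 c := locally_int_cst c : locally_int (fun=> c : R).
pose E y := expR (k * y); have E0 y : 0 < E y by exact: expR_gt0.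
have El : locally_int (fun y => k * E y).
  by apply/locally_intZ/locally_int_continuous; exact: continuous_expRM.
pose u y := x - y.
have up : primitive u (fun=> 0 - 1) := primitiveB (l0 0) (l0 1) (primitive_cst x) primitive_id.
have ul : locally_int u := primitive_locally_int (locally_intB (l0 0) (l0 1)) up.
pose rho y := F y - F x + phi * u y.
have rl : locally_int (fun y => f y - 0 + phi * (0 - 1)).
  by apply: locally_intD; [exact: locally_intB|exact: locally_intZ].
have rp : primitive rho (fun y => f y - 0 + phi * (0 - 1)).
  apply: (primitiveD (locally_intB fl (l0 0)) (locally_intZ _ (locally_intB (l0 0) (l0 1)))).
    by apply: primitiveB => //; exact: primitive_cst.
  by apply: primitiveZ => //; exact: locally_intB.
pose w y := s y - phi - k * rho y.
have s'l : locally_int (fun y => k * (f y - s y)) by apply/locally_intZ/locally_intB.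
have wl := locally_intB (locally_intB s'l (l0 0)) (locally_intZ k rl).
have wp : primitive w _ := primitiveB (locally_intB s'l (l0 0)) (locally_intZ k rl)
  (primitiveB s'l (l0 0) sp (primitive_cst phi)) (primitiveZ k rl rp).
pose p y := e * (1 + k * u y) + C / k * (2 + 2 * k * u y + k ^+ 2 * (u y * u y)).
have pp : locally_int (fun y => - e * k - 2 * C - 2 * C * k * u y) /\
    primitive p (fun y => - e * k - 2 * C - 2 * C * k * u y).
  split; first by apply: locally_intB => //; exact: locally_intZ.
  have u1 := locally_intB (l0 0) (l0 1).
  have uu := locally_intD (locally_intM u1 up u1) (locally_intM u1 up u1).
  have uul : locally_int (fun x0 : R => (0 - 1) * u x0 + u x0 * (0 - 1)).
    by apply: eq_locally_int uu => y _; ring.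
  have q1 := primitiveZ e (locally_intD (l0 0) (locally_intZ k u1))
     (primitiveD (l0 0) (locally_intZ k u1) (primitive_cst 1) (primitiveZ k u1 up)).
  have q2 := primitiveZ (C / k) (locally_intD (locally_intD (l0 0) (locally_intZ (2 * k) u1)) (locally_intZ (k ^+ 2) uul))
     (primitiveD (locally_intD (l0 0) (locally_intZ (2 * k) u1)) (locally_intZ (k ^+ 2) uul)
       (primitiveD (l0 0) (locally_intZ (2 * k) u1) (primitive_cst 2) (primitiveZ (2 * k) u1 up))
       (primitiveZ (k ^+ 2) uul (primitiveM u1 u1 up up))).
  have l1 : locally_int (fun x0 : R => e * (0 + k * (0 - 1))).
    exact/locally_intZ/(locally_intD (l0 0) (locally_intZ k u1)).
  have l2 : locally_int (fun x0 : R => C / k * (0 + 2 * k * (0 - 1) +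
      k ^+ 2 * ((0 - 1) * u x0 + u x0 * (0 - 1)))).
    apply/locally_intZ/locally_intD; last exact: locally_intZ.
    exact: (locally_intD (l0 0) (locally_intZ (2 * k) u1)).
  apply: eq_primitive (primitiveD l1 l2 q1 q2) => // y _.
  by field; rewrite gt_eqF.
have [pl ppr] := pp.
have EpE := @primitive_expRM _ k.
have comm (g h : R -> R) : locally_int (fun x => g x * h x) -> locally_int (fun x => h x * g x).
  by apply: eq_locally_int => y _; rewrite mulrC.
have Aq := primitiveM El pl EpE ppr; have Qq := primitiveM El wl EpE wp.
have Al : locally_int (fun y => k * E y * p y + E y * (- e * k - 2 * C - 2 * C * k * u y)).
  by apply: locally_intD; [apply: comm; exact: (locally_intM pl ppr El)|exact: (locally_intM El EpE pl)].
have Ql := locally_intD (comm _ _ (locally_intM wl wp El)) (locally_intM El EpE wl).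
have derE y : k * E y * p y + E y * (- e * k - 2 * C - 2 * C * k * u y) =
    k ^+ 2 * E y * (e * u y + C * u y ^+ 2).
  by rewrite /p; field; rewrite gt_eqF.
have derQ y : k * E y * w y + E y * (k * (f y - s y) - 0 - k * (f y - 0 + phi * (0 - 1))) =
    k ^+ 2 * E y * - rho y by rewrite /w; ring.
have hi : E 0 * p 0 + E 0 * w 0 <= E x * p x + E x * w x.
  apply: (primitive_nondecreasing_on (locally_intD Al Ql) (primitiveD Al Ql Aq Qq)) => // y y0 yx.
  rewrite derE derQ -mulrDr; apply: mulr_ge0; first by rewrite mulr_ge0 ?sqr_ge0 ?expR_ge0.
  by have := tangent y y0 yx; rewrite ler_norml -/(u y) -/(rho y) => /andP[_]; rewrite subr_ge0.
have lo : E 0 * p 0 - E 0 * w 0 <= E x * p x - E x * w x.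
  apply: (primitive_nondecreasing_on (locally_intB Al Ql) (primitiveB Al Ql Aq Qq)) => // y y0 yx.
  rewrite derE derQ -mulrBr; apply: mulr_ge0; first by rewrite mulr_ge0 ?sqr_ge0 ?expR_ge0.
  have := tangent y y0 yx; rewrite ler_norml -/(u y) -/(rho y) => /andP[+ _].
  by rewrite opprK -subr_ge0 opprK addrC.
have px : p x = e + 2 * C / k by rewrite /p /u subrr; field; rewrite gt_eqF.
have wx : w x = s x - phi by rewrite /w /rho /u !subrr; ring.
have p0 : k * (e * x + C * x ^+ 2) <= p 0.
  rewrite /p /u subr0 -subr_ge0.
  rewrite (_ : _ - _ = e + C * (2 / k + 2 * x)); last by field; rewrite gt_eqF.
  by rewrite addr_ge0 ?mulr_ge0 ?addr_ge0 ?divr_ge0 ?mulr_ge0// ltW.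
have w0 : `|w 0| <= `|phi| + p 0.
  rewrite /w s0 sub0r -opprD normrN; apply: le_trans (ler_normD _ _) _; rewrite lerD2l.
  apply: le_trans p0; rewrite normrM gtr0_norm// ler_pM2l//.
  by have := tangent 0 (lexx 0) x0; rewrite /rho /u !subr0.
have E00 : E 0 = 1 by rewrite /E mulr0 expR0.
have main : E x * `|s x - phi| <= E x * (e + 2 * C / k) + `|phi|.
  rewrite -px -wx -[X in X * `|_|](gtr0_norm (E0 x)) -normrM.
  move: hi lo w0; rewrite E00 !mul1r ler_norml => h1 h2 /andP[h3 h4].
  by rewrite ler_norml; apply/andP; split; lra.
have -> : expR (- k * x) = (E x)^-1 by rewrite mulNr expRN.
rewrite -(ler_pM2l (E0 x)) mulrDr mulrCA divff ?mulr1//.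
by rewrite gt_eqF.
Qed.

(** The quadratic term takes care of the points y that are far from x, where F is only
known to be bounded. *)
Lemma derivable_tangent f F (x phi e : R) : locally_int f -> primitive F f -> 0 <= x -> 0 < e ->
  derivable F x 1 -> derive1 F x = phi ->
  exists2 C, 0 <= C &
   forall y, 0 <= y -> y <= x -> `|F y - F x + phi * (x - y)| <= e * (x - y) + C * (x - y) ^+ 2.
Proof.
move=> fl Ff x0 e0 dF <-.
have [D /= D0 HD] : exists2 D : R, 0 < D & forall h, `|h| < D -> h != 0 ->
    `|derive1 F x - h^-1 * (F (h + x) - F x)| <= e.
  move: dF => /cvg_ex[l dF].
  have lE : derive1 F x = l by rewrite derive1E; apply: cvg_lim dF.
  rewrite lE; move: dF => /cvgrPdist_le /(_ e e0).
  rewrite near_withinE => /nbhs_norm0P[D D0 HD]; exists D => // h hD h0.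
  have := HD h hD h0; rewrite /GRing.scale /=.
  by rewrite mulr1.
have [B [Br HB]] := primitive_bounded fl Ff x0.
set phi' := derive1 F x in HD *.
pose B' := 2 * (`|B| + 1) + `|phi'| * x.
have B'0 : 0 <= B' by rewrite addr_ge0 ?mulr_ge0 ?addr_ge0.
have FB y : 0 <= y -> y <= x -> `|F y| <= `|B| + 1.
  move=> y0 yx; apply: HB; first by rewrite (le_lt_trans (ler_norm B))// ltrDl.
  by rewrite /= in_itv/= y0 yx.
exists (B' / D ^+ 2) => [|y y0 yx]; first by rewrite divr_ge0// sqr_ge0.
have u0 : 0 <= x - y by rewrite subr_ge0.
have D2 : 0 < D ^+ 2 by rewrite exprn_gt0.
have [uD|uD] := ltP (x - y) D; last first.
  apply: (@le_trans _ _ B').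
    apply: le_trans (ler_normD _ _) _; apply: lerD.
      apply: le_trans (ler_normB _ _) _; rewrite mulr_natl mulr2n.
      by apply: lerD; exact: FB.
    by rewrite normrM ler_wpM2l// ger0_norm// gerBl.
  apply: (@le_trans _ _ (B' / D ^+ 2 * (x - y) ^+ 2)); last first.
    by rewrite lerDr mulr_ge0// ltW.
  rewrite mulrAC ler_pdivlMr// ler_wpM2l// lerXn2r ?nnegrE//; exact: ltW.
apply: (@le_trans _ _ (e * (x - y))); last by rewrite lerDl mulr_ge0 ?sqr_ge0// divr_ge0// sqr_ge0.
have [->|xy] := eqVneq y x; first by rewrite !subrr !mulr0 addr0 normr0.
have h0 : y - x != 0 by rewrite subr_eq0.
have := HD (y - x); rewrite distrC ger0_norm// => /(_ uD h0); rewrite subrK.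
move=> h; have -> : F y - F x + phi' * (x - y) =
    (phi' - (y - x)^-1 * (F y - F x)) * (x - y).
  by field.
by rewrite normrM [X in _ * X]ger0_norm// ler_wpM2r.
Qed.

(** s is k (d/dx + k)^-1 f. *)
Lemma average_exists f (k : R) : 0 < k -> sqint f ->
  exists s, [/\ sqint s, primitive s (fun x => k * (f x - s x)) & s 0 = 0].
Proof.
move=> k0 fL; pose v x : R[i] := Complex (f x) 0; pose z : R[i] := Complex k 0.
have vL : square_integrable v.
  apply/square_integrableE; split=> //.
  split; first exact: measurable_cst.
  by have := integrable0 mu half_line; apply: eq_integrable => // x _ /=; rewrite expr0n.
have [p l] := forwardP z (square_integrable_locally vL).
have [] := @forward_bound _ z _ _ k0 l vL p (forward0 z v).
move=> /square_integrableE[sr _] _; exists (fun x => k * complex.Re (forward z v x)).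
split; first exact: sqintZ.
- have [_ /is_primitiveE[pr _]] := (vL, p).
  have rl := (locally_intCB (square_integrable_locally vL) (locally_intCZ z l)).1.
  apply: eq_primitive (primitiveZ k rl pr) => // x _.
  by rewrite !complex_partsE /= mul0r subr0.
- by rewrite forward0 mulr0.
Qed.

(** s (f - s) = s s' / k integrates to 0, so that f = s + (f - s) is an orthogonal
decomposition. *)
Lemma average_energy f s (k : R) : 0 < k -> sqint f -> sqint s ->
  primitive s (fun x => k * (f x - s x)) -> s 0 = 0 ->
  \int[mu]_(x in half_line) (f x - s x) ^+ 2 =
  \int[mu]_(x in half_line) f x ^+ 2 - \int[mu]_(x in half_line) s x ^+ 2.
Proof.
move=> k0 fL sL p s0; have [mf fi] := fL; have [ms si] := sL.
have [_ fsi] : sqint (fun x => f x - s x).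
  by apply: eq_sqint (sqintD fL (sqintZ (-1) sL)) => x _; rewrite mulN1r.
have fsL : sqint (fun x => f x - s x).
  by apply: eq_sqint (sqintD fL (sqintZ (-1) sL)) => x _; rewrite mulN1r.
have pi := sqint_mul sL fsL.
have pi2 := integrableZl mhl 2 pi.
have ssi : mu.-integrable half_line (EFin \o (fun x => k^-1 * (s x * s x))).
  exact: integrableZl (sqint_mul sL sL).
have sl := sqint_locally sL.
have dl : locally_int (fun x => k * (f x - s x)).
  by apply/locally_intZ/locally_intB => //; exact: sqint_locally.
have dsl := locally_intM dl p dl.
have dsl' : locally_int (fun x => k * (f x - s x) * s x).
  by apply: eq_locally_int dsl => x _; rewrite mulrC.
have W : primitive (fun x => k^-1 * (s x * s x)) (fun x => 2 * (s x * (f x - s x))).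
  apply: eq_primitive (primitiveZ k^-1 (locally_intD dsl' dsl) (primitiveM dl dl p p)) => // x _.
  by field; rewrite gt_eqF.
have := half_line_boundary pi2 ssi W; rewrite s0 mulr0 mulr0 oppr0 => key.
have E : \int[mu]_(x in half_line) f x ^+ 2 =
    \int[mu]_(x in half_line) ((f x - s x) ^+ 2 + s x ^+ 2 + 2 * (s x * (f x - s x))).
  by apply: eq_Rintegral => x _; ring.
have ai : mu.-integrable half_line (EFin \o (fun x => (f x - s x) ^+ 2 + s x ^+ 2)).
  exact: integrableD fsi si.
rewrite E RintegralD// key addr0 RintegralD//.
by rewrite addrK.
Qed.

(** Almost every x is a point of differentiability of the primitive of f, with
derivative f x; there [exponential_average_estimate] applies. *)
Lemma average_cvg_ae f (s : nat -> R -> R) : sqint f ->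
  (forall n, [/\ sqint (s n), primitive (s n) (fun x => n.+1%:R * (f x - s n x)) & s n 0 = 0]) ->
  {ae mu, forall x, half_line x -> s n x @[n --> \oo] --> f x}.
Proof.
move=> fL sP; have fl := sqint_locally fL.
pose f0 := f \_ half_line.
have f0E x : 0 <= x -> f0 x = f x.
  by move=> x0; rewrite /f0 patchE mem_set// /Defs.half_line /= in_itv/= x0.
have f0l : locally_int f0 by apply: eq_locally_int fl => x /f0E.
have f0i y : mu.-integrable `[0, y] (EFin \o f0).
  have [y0|y0] := leP 0 y; first exact: f0l.
  by rewrite set_itv_ge ?bnd_simp -?ltNge//; exact: integrable_set0.
have mf0 : measurable_fun setT f0.
  by apply/(measurable_restrictT _ _).1 => //; exact: fL.1.
have f0loc : locally_integrable setT f0.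
  split=> //; first exact: openT.
  move=> K _ cK; have [b [br Hb]] := compact_bounded cK.
  pose B := `|b| + 1; have B0 : 0 <= B by rewrite addr_ge0.
  have KB x : K x -> x <= B.
    move=> Kx; apply: le_trans (ler_norm x) _; apply: Hb => //.
    by rewrite (le_lt_trans (ler_norm b))// ltrDl.
  have mI : measurable (`[0, B]%classic : set (measurableTypeR R)) by exact: measurable_itv.
  have /integrableP[mfB fB] : mu.-integrable setT (EFin \o f \_ `[0, B]).
    by rewrite -restrict_EFin; apply/(integrable_mkcond _ mI).1/fl.
  apply: le_lt_trans fB.
  rewrite (_ : (\int[mu]_(x in K) _)%E = (\int[mu]_(x in K) `|(EFin \o f \_ `[0%R, B]) x|)%E).
    apply: ge0_subset_integral => //; first exact: compact_measurable.
    by apply: measurableT_comp.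
  apply: eq_integral => x /set_mem Kx; rewrite /f0 /= !patchE !mem_setE.
  by rewrite /Defs.half_line !in_itv/= (KB x Kx) !andbT.
pose F x := \int[mu]_(t in `[0, x]) f0 t.
have Ff : primitive F f by apply: eq_primitive (primitive_integral f0) => // x /f0E.
have := FTC1 f0i f0loc.
have z0 : {ae mu, forall x : R, x != 0}.
  exists [set 0]; split=> //; first exact: lebesgue_measure_set1.
  by move=> x /= /negP; rewrite negbK => /eqP.
have FF := ae_filter_ringOfSetsType
  (lebesgue_measure : {measure set (measurableTypeR R) -> \bar R}).
apply: filterS2 z0 => x x0 dF hx.
have {hx} x0' : 0 < x.
  by move: hx; rewrite /Defs.half_line/= in_itv/= andbT lt0r x0.
have [dFx F'x] := dF x0'.
rewrite f0E in F'x; last exact: ltW.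
apply/cvgrPdist_le => e e0.
have e2 : 0 < e / 2 by rewrite divr_gt0.
have [C C0 tan] := derivable_tangent fl Ff (ltW x0') e2 dFx F'x.
pose D := (e / 2)^-1 * (2 * C + `|f x| / x).
near=> n.
have n0 : 0 < n.+1%:R :> R by [].
have [sL sp s0] := sP n.
rewrite distrC.
apply: le_trans (exponential_average_estimate n0 (ltW x0') (ltW e2) C0 fl (sqint_locally sL) Ff sp s0 tan) _.
have e3 : expR (- n.+1%:R * x) <= (n.+1%:R * x)^-1.
  rewrite mulNr expRN lef_pV2 ?posrE ?mulr_gt0 ?expR_gt0//.
  by apply: le_trans (expR_ge1Dx _); rewrite lerDr.
have e4 : 2 * C / n.+1%:R + `|f x| * (n.+1%:R * x)^-1 <= e / 2.
  rewrite (_ : _ + _ = (2 * C + `|f x| / x) / n.+1%:R); last by field; rewrite gt_eqF//= gt_eqF.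
  rewrite ler_pdivrMr// -ler_pdivrMl// -/D.
  by near: n; apply: filterS (nbhs_infty_ger D) => n Dn; apply: (le_trans Dn); rewrite ler_nat.
have e5 := ler_wpM2l (normr_ge0 (f x)) e3.
rewrite [leRHS]splitr -addrA lerD2l; apply: le_trans e4; rewrite lerD2l.
exact: e5.
Unshelve. all: by end_near.
Qed.

(** Otherwise the squared norms of the averages would stay below that of f by eps, by
[average_energy]. This contradicts Fatou's lemma, as the averages converge to f
almost everywhere. *)
Lemma range_average_dense f (eps : R) : sqint f -> 0 < eps ->
  exists (k : R) s, [/\ 0 < k, sqint s, primitive s (fun x => k * (f x - s x)), s 0 = 0 &
    \int[mu]_(x in half_line) (f x - s x) ^+ 2 < eps].
Proof.
move=> fL eps0; have [mf fi] := fL.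
have k0 n : 0 < n.+1%:R :> R by [].
have /choice[s sP] : forall n, exists s, [/\ sqint s, primitive s (fun x => n.+1%:R * (f x - s x)) & s 0 = 0].
  by move=> n; exact: average_exists.
apply: contrapT => no.
have big n : \int[mu]_(x in half_line) s n x ^+ 2 <= \int[mu]_(x in half_line) f x ^+ 2 - eps.
  rewrite leNgt; apply/negP => lt; apply: no; exists n.+1%:R, (s n).
  have [sL sp s0] := sP n; split=> //.
  by rewrite (average_energy (k0 n) fL sL sp s0) ltrBlDr -ltrBlDl.
have cv := average_cvg_ae fL sP.
pose g n x := (s n x ^+ 2)%:E.
have gi n : mu.-integrable half_line (g n) by have [[]] := sP n.
have mg n : measurable_fun half_line (g n) by case/integrableP: (gi n).
have g0 n x : half_line x -> (0 <= g n x)%E by move=> _; rewrite lee_fin sqr_ge0.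
have := @fatou _ _ _ mu half_line mhl g mg g0.
have mf2 : measurable_fun half_line (EFin \o (fun x => f x ^+ 2)) by case/integrableP: fi.
have mlim : measurable_fun half_line (fun x => limn_einf (g^~ x)).
  rewrite /limn_einf; apply: measurableT_comp => //.
  apply: (@measurable_fun_limn_esup _ _ _ half_line (fun n => \- g n)%E) => n.
  exact: measurableT_comp.
have lim0 x : half_line x -> (0 <= limn_einf (g^~ x))%E.
  move=> hx; rewrite limn_einf_lim; apply: lime_ge; first exact: is_cvg_einfs.
  by apply: nearW => n; apply: le_ereal_inf_tmp => _ [m /= _ <-]; exact: g0.
have ae2 : {ae mu, forall x, half_line x -> limn_einf (g^~ x) = (EFin \o (fun x => f x ^+ 2)) x}.
  have FF := ae_filter_ringOfSetsType
    (lebesgue_measure : {measure set (measurableTypeR R) -> \bar R}).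
  apply: filterS cv => x cvx hx.
  apply: (cvg_limn_einf_sup _).1; apply: cvg_EFin; first exact: nearW.
  have cs := cvx hx.
  rewrite (_ : fine \o _ = fun n => s n x * s n x); last by apply/funext => n; rewrite /= expr2.
  by rewrite expr2; apply: cvgM.
have -> : (\int[mu]_(x in half_line) limn_einf (g^~ x) = \int[mu]_(x in half_line) (f x ^+ 2)%R%:E)%E.
  apply: ge0_ae_eq_integral => // x _; by rewrite lee_fin sqr_ge0.
apply/negP; rewrite -ltNge limn_einf_lim.
have fin := integrable_fin_num mhl fi.
rewrite -(fineK fin).
apply: (@le_lt_trans _ _ (\int[mu]_(x in half_line) f x ^+ 2 - eps)%:E); last first.
  by rewrite lte_fin gtrBl.
apply: lime_le; first exact: is_cvg_einfs.
apply: nearW => n.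
apply: (@le_trans _ _ (\int[mu]_(x in half_line) g n x)%E).
  by apply: ereal_inf_lbound; exists n => /=.
rewrite -(fineK (integrable_fin_num mhl (gi n))) lee_fin.
exact: big.
Qed.

End Density.

(** * Density of the domain *)

Section DenseDomain.
Context {R : realType}.
Notation mu := (@lebesgue_measure R).
Notation half_line := (@half_line R).

Let one_gt0 : 0 < complex.Re (1 : R[i]). Proof. exact: ltr01. Qed.

(** An average s is in the range because s = (d/dx + 1)^-1 (s' + s). *)
Lemma forward_range_dense (f : R -> R[i]) (eps : R) : square_integrable f -> 0 < eps ->
  exists2 v, square_integrable v & sqr_L2norm (fun x => f x - forward 1 v x) < eps.
Proof.
move=> fL eps0; have [fr fi] := (square_integrableE f).1 fL.
have e2 : 0 < eps / 2 by rewrite divr_gt0.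
have [kr [sr [kr0 srL pr sr0 lr]]] := range_average_dense fr e2.
have [ki [si [ki0 siL pi si0 li]]] := range_average_dense fi e2.
pose s x : R[i] := Complex (sr x) (si x).
pose ar x := kr * (complex.Re (f x) - sr x).
pose ai x := ki * (complex.Im (f x) - si x).
have arL : sqint ar.
  by apply: eq_sqint (sqintZ kr (sqintD fr (sqintZ (-1) srL))) => x _; rewrite mulN1r.
have aiL : sqint ai.
  by apply: eq_sqint (sqintZ ki (sqintD fi (sqintZ (-1) siL))) => x _; rewrite mulN1r.
pose v x : R[i] := Complex (ar x) (ai x) + s x.
have sL : square_integrable s by apply/square_integrableE.
have vL : square_integrable v.
  by apply: square_integrable_fD => //; apply/square_integrableE.
have sE : forall x, 0 <= x -> s x = forward 1 v x.
  apply: forward_uniq => //; try exact: square_integrable_locally.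
    apply: (@eq_is_primitive _ s _ (fun x => Complex (ar x) (ai x))) => // [x _|].
      by rewrite /v mul1r addrK.
    exact/is_primitiveE.
  by rewrite /s sr0 si0.
exists v => //.
rewrite -(@eq_sqr_L2norm _ (fun x => f x - s x)) => [|x /sE -> //].
have /square_integrableE[[_ i1] [_ i2]] := square_integrable_fB fL sL.
rewrite /sqr_L2norm /sqr_norm RintegralD//; last exact: measurable_half_line.
rewrite [ltRHS]splitr ltrD//.
  apply: le_lt_trans lr; rewrite le_eqVlt; apply/orP; left; apply/eqP; apply: eq_Rintegral => x _.
  by rewrite complex_ReD complex_ReN.
apply: le_lt_trans li; rewrite le_eqVlt; apply/orP; left; apply/eqP; apply: eq_Rintegral => x _.
by rewrite complex_ImD complex_ImN.
Qed.

Context {d : nat}.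
Notation hn := (hnorm (@L2_inner R d)).

Lemma Kop_range_dense (x : L2 R d) (eps : R) : 0 < eps ->
  exists w, hn (x - Kop 1 w) ^+ 2 < eps.
Proof.
move=> eps0; pose f := repr x.
have e1 : 0 < eps / d.+1%:R by rewrite divr_gt0.
have /choice[v vP] : forall e, exists v, square_integrable v /\
    sqr_L2norm (fun t => f e t - forward 1 v t) < eps / d.+1%:R.
  by move=> e; have [v ? ?] := forward_range_dense (L2fun_square_integrable f e) e1; exists v.
pose g := mkL2 (fun e => (vP e).1).
exists (L2_class g).
rewrite (KopP one_gt0).2 -[x]L2_class_repr -L2_classB hnorm_class_sqr.
apply: (@le_lt_trans _ _ (\sum_(e < d) eps / d.+1%:R)).
  apply: ler_sum => e _; apply: ltW; apply: le_lt_trans (vP e).2.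
  by rewrite (@eq_sqr_L2norm _ _ (fun t => f e t - forward 1 (v e) t)) // => t _; rewrite L2funB fwdE.
rewrite sumr_const card_ord -[X in X < _]mulr_natr -mulrA gtr_pMr// mulrC ltr_pdivrMr// mul1r ltr_nat.
exact: ltnSn.
Qed.

(** The functions K_1 (K_1 y) vanish at the vertex together with their derivatives, so
that they satisfy all conditions, and they are dense since K_1 is bounded with
dense range. *)
Lemma Delta_densely_defined (A B : 'M[R[i]]_d) : densely_defined L2_inner (Delta A B).
Proof.
move=> x eps eps0.
have [[lK bK] KE] := @KopP R d 1 one_gt0.
have [M M0 hM] := bounded_sqr bK.
have e1 : 0 < eps ^+ 2 / 4 by rewrite divr_gt0// exprn_gt0.
have [w hw] := Kop_range_dense x e1.
have e2 : 0 < eps ^+ 2 / 4 / (M + 1) by rewrite divr_gt0// ltr_wpDl.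
have [y hy] := Kop_range_dense w e2.
pose h := repr y; pose g := fwd 1 h; pose u := fwd 1 g.
have yE : Kop 1 (Kop 1 y) = L2_class u by rewrite -[y]L2_class_repr !KE.
exists (L2_class u), (L2_class ((h - g) - (g - u))); split.
  exists u, (g - u), ((h - g) - (g - u)).
  have z0 : at_vertex u = 0 by apply/matrixP => i j; rewrite !mxE fwd0.
  have z1 : at_vertex (g - u) = 0 by apply/matrixP => i j; rewrite !mxE L2funB !fwd0 subrr.
  split=> //; last by rewrite z0 z1 !mulmx0 addr0.
  have p1 e : is_primitive (u e) ((g - u : L2fun R d) e).
    by apply: eq_is_primitive (fwdP g e one_gt0) => // t _; rewrite L2funB mul1r.
  have p2 e : is_primitive (g e) ((h - g : L2fun R d) e).
    by apply: eq_is_primitive (fwdP h e one_gt0) => // t _; rewrite L2funB mul1r.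
  move=> e; split; first exact: p1.
  by apply: is_primitiveB (p2 e) (p1 e); exact: locally_intC_L2fun.
rewrite -yE -(ltr_pXn2r (n := 2))// ?nnegrE ?hnorm_ge0 ?ltW//.
have -> : x - Kop 1 (Kop 1 y) = (x - Kop 1 w) + Kop 1 (w - Kop 1 y).
  by rewrite (linear_sub _ _ lK) addrA subrK.
apply: (le_lt_trans (hnormD_sqr _ _)).
have h1 : M * hn (w - Kop 1 y) ^+ 2 <= eps ^+ 2 / 4.
  apply: (@le_trans _ _ ((M + 1) * hn (w - Kop 1 y) ^+ 2)).
    by apply: ler_wpM2r; [exact: sqr_ge0|rewrite lerDl].
  by rewrite mulrC -ler_pdivlMr ?ltW// ltr_wpDl.
have := hM (w - Kop 1 y); lra.
Qed.

End DenseDomain.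

(** * Self-adjointness for separated real conditions *)

Section SelfAdjointReference.
Context {R : realType}.
Notation mu := (@lebesgue_measure R).
Notation half_line := (@half_line R).

Let mhl : measurable (half_line : set (measurableTypeR R)).
Proof. exact: measurable_half_line. Qed.

Definition robin (al be : R) (z w : R[i]) := Complex al 0 * z + Complex be 0 * w = 0.

Definition admissible (al be : R) := be = 1 \/ al = 1 /\ be = 0.

Lemma is_primitive_conj (f g : R -> R[i]) : locally_intC g -> is_primitive f g ->
  locally_intC (fun x => conjc (g x)) /\ is_primitive (fun x => conjc (f x)) (fun x => conjc (g x)).
Proof.
move=> [lr li] /is_primitiveE[pr pi]; split.
  split; first by apply: eq_locally_int lr => x _; rewrite complex_Re_conj.
  by apply: eq_locally_int (locally_intZ (-1) li) => x _; rewrite complex_Im_conj mulN1r.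
apply/is_primitiveE; split.
  by apply: eq_primitive pr => x _; rewrite complex_Re_conj.
by apply: eq_primitive (primitiveZ (-1) li pi) => x _; rewrite complex_Im_conj mulN1r.
Qed.

Lemma robin_wronskian (al be : R) (z z1 w w1 : R[i]) : admissible al be ->
  robin al be z z1 -> robin al be w w1 -> z1 * conjc w - z * conjc w1 = 0.
Proof.
rewrite /robin; case=> [->|[-> ->]].
  rewrite !mul1r !(addrC (_ * _)) => /eqP; rewrite addr_eq0 => /eqP -> /eqP; rewrite addr_eq0 => /eqP ->.
  by apply: complex_ext; rewrite !complex_partsE /=; ring.
by rewrite !mul0r !mul1r !addr0 => -> ->; rewrite conjc0 mulr0 mul0r subr0.
Qed.

(** The Wronskian W = f' conj(g) - f conj(g') is integrable with integrable derivative
f'' conj(g) - f conj(g''), and W 0 = 0 because the condition at 0 is real. *)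
Lemma edge_symmetric (al be : R) (f f1 f2 g g1 g2 : R -> R[i]) : admissible al be ->
  square_integrable f -> square_integrable f1 -> square_integrable f2 ->
  square_integrable g -> square_integrable g1 -> square_integrable g2 ->
  is_primitive f f1 -> is_primitive f1 f2 -> is_primitive g g1 -> is_primitive g1 g2 ->
  robin al be (f 0) (f1 0) -> robin al be (g 0) (g1 0) ->
  Cintegral half_line (fun t => f2 t * conjc (g t)) =
  Cintegral half_line (fun t => f t * conjc (g2 t)).
Proof.
move=> ad fL f1L f2L gL g1L g2L p1 p2 q1 q2 bf bg.
have lf1 := square_integrable_locally f1L; have lf2 := square_integrable_locally f2L.
have [lg1 cq1] := is_primitive_conj (square_integrable_locally g1L) q1.
have [lg2 cq2] := is_primitive_conj (square_integrable_locally g2L) q2.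
have W1 := is_primitiveM lf2 lg1 p2 cq1.
have W2 := is_primitiveM lf1 lg2 p1 cq2.
have l0 : locally_intC (fun t => conjc (g t)) := is_primitive_locally_int lg1 cq1.
have l0' : locally_intC f := is_primitive_locally_int lf1 p1.
have la : locally_intC (fun t => f2 t * conjc (g t)).
  by apply: eq_locally_intC (locally_intCM lg1 cq1 lf2) => x _; rewrite mulrC.
have lb := locally_intCM lf2 p2 lg1.
have lc : locally_intC (fun t => f1 t * conjc (g1 t)).
  by apply: eq_locally_intC (locally_intCM lg2 cq2 lf1) => x _; rewrite mulrC.
have ld := locally_intCM lf1 p1 lg2.
have /is_primitiveE[Wr Wi] : is_primitive (fun t => f1 t * conjc (g t) - f t * conjc (g1 t))
    (fun t => f2 t * conjc (g t) - f t * conjc (g2 t)).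
  apply: eq_is_primitive (is_primitiveB (locally_intCD la lb) (locally_intCD lc ld) W1 W2) => // x _.
  move: (f2 x * _) (f1 x * _) (f x * _) => A B C; ring.
have W0 := robin_wronskian ad bf bg.
have [ar ai] := inner_integrable f2L gL; have [br bi] := inner_integrable fL g2L.
have [cr ci] := inner_integrable f1L gL; have [dr di] := inner_integrable fL g1L.
apply/eqP; rewrite -subr_eq0; apply/eqP.
apply: complex_ext; rewrite (complex_ReD, complex_ImD) (complex_ReN, complex_ImN) /Cintegral /= -RintegralB//.
  transitivity (- complex.Re (f1 0 * conjc (g 0) - f 0 * conjc (g1 0))); last by rewrite W0 /= oppr0.
  apply: (@half_line_boundary _ (fun t => complex.Re (f1 t * conjc (g t) - f t * conjc (g1 t)))) => //.
  - by apply: eq_integrable (integrableB mhl ar br).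
  - by apply: eq_integrable (integrableB mhl cr dr) => // x _ /=; rewrite complex_ReD complex_ReN EFinB.
  - by apply: eq_primitive Wr => // x _; rewrite complex_ReD complex_ReN.
transitivity (- complex.Im (f1 0 * conjc (g 0) - f 0 * conjc (g1 0))); last by rewrite W0 /= oppr0.
apply: (@half_line_boundary _ (fun t => complex.Im (f1 t * conjc (g t) - f t * conjc (g1 t)))) => //.
- by apply: eq_integrable (integrableB mhl ai bi).
- by apply: eq_integrable (integrableB mhl ci di) => // x _ /=; rewrite complex_ImD complex_ImN EFinB.
- by apply: eq_primitive Wi => // x _; rewrite complex_ImD complex_ImN.
Qed.

(** Factor - d^2/dx^2 + k^2 = (- d/dx + k) (d/dx + k). The first factor is inverted by
[backward_equationC]; for the second one, the multiple of e^(- k x) that may be added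
to [forward] is adjusted to the condition at 0. *)
Lemma edge_resolvent (al be k : R) (f : R -> R[i]) : admissible al be -> 0 < k -> al < k ->
  square_integrable f ->
  exists u u1, [/\ square_integrable u, square_integrable u1, is_primitive u u1,
    is_primitive u1 (fun t => Complex k 0 ^+ 2 * u t - f t) & robin al be (u 0) (u1 0)].
Proof.
move=> ad k0 ak fL; pose K : R[i] := Complex k 0.
have K0 : 0 < complex.Re K by [].
have [g [gL pg]] := backward_equationC k0 fL.
have lg := square_integrable_locally gL; have lf := square_integrable_locally fL.
have [p0 l0] := forwardP K lg.
have [u0L _] := forward_bound K0 l0 gL p0 (forward0 K g).
have [eL _] := square_integrable_cexp K0.
pose Al : R[i] := Complex al 0.
pose c : R[i] := if be == 1 then g 0 / (K - Al) else 0.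
pose u x := forward K g x + c * cexp (- K) x.
pose u1 x := g x - K * u x.
have uL : square_integrable u by apply: square_integrable_fD => //; exact: square_integrable_fZ.
have u1L : square_integrable u1 by apply: square_integrable_fB => //; exact: square_integrable_fZ.
have le := square_integrable_locally (square_integrable_fZ (- K) eL).
have pu : is_primitive u u1.
  apply: eq_is_primitive (is_primitiveD _ (locally_intCZ c le) p0 (is_primitiveZ c le (is_primitive_cexp (- K)))).
  - by [].
  - by move=> x _; rewrite /u1 /u; ring.
  - by apply: locally_intCB => //; exact: locally_intCZ.
have lu1 := square_integrable_locally u1L.
exists u, u1; split=> //.
  apply: eq_is_primitive (is_primitiveB _ (locally_intCZ K lu1) pg (is_primitiveZ K lu1 pu)) => //.
  - by move=> x _; rewrite /u1 -/K; move: (f x) (g x) (u x) => p q r; rewrite expr2; ring.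
  - by apply: locally_intCB => //; exact: locally_intCZ.
rewrite /robin /u1 /u forward0 cexp0 add0r mulr1 -/Al.
case: ad => [be1|[al1 be0]].
  have KA : K - Al != 0.
    by apply/eqP => /(congr1 (@complex.Re R)) /=; apply/eqP; rewrite subr_eq0 gt_eqF.
  have cE : c * (K - Al) = g 0 by rewrite /c be1 eqxx divfK.
  rewrite be1 -[Complex 1 0]/(1 : R[i]) -cE mul1r; ring.
rewrite be0 /c be0 eq_sym oner_eq0 mulr0 add0r.
by rewrite /= mul0r.
Qed.

Context {d : nat}.
Variables (al be : 'I_d -> R) (A B : 'M[R[i]]_d).
Hypothesis ad : forall i, admissible (al i) (be i).
Hypothesis bcE : forall u u1 : 'cV[R[i]]_d, A *m u + B *m u1 = 0 <->
  forall i, robin (al i) (be i) (u i 0) (u1 i 0).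
Notation H := (L2 R d).
Notation ip := (@L2_inner R d).

Lemma Delta_symmetric x y v w : Delta A B (x, y) -> Delta A B (v, w) -> ip y v = ip x w.
Proof.
move=> [f [f1 [f2 [hf /bcE bf /= -> ->]]]] [g [g1 [g2 [hg /bcE bg /= -> ->]]]].
rewrite !L2_inner_class; apply: eq_bigr => e _.
have [p1 p2] := hf e; have [q1 q2] := hg e.
by have := bf e; have := bg e; rewrite !mxE => bge bfe;
  apply: edge_symmetric (ad e) _ _ _ _ _ _ p1 p2 q1 q2 bfe bge; exact: L2fun_square_integrable.
Qed.

Lemma Delta_resolvent (k : R) : 0 < k -> (forall i, al i < k) -> forall z : H,
  exists x y, Delta A B (x, y) /\ Complex k 0 ^+ 2 *: x - y = z.
Proof.
move=> k0 ak z; pose f := repr z.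
have /choice[u uP] : forall e, exists u, exists u1, [/\ square_integrable u, square_integrable u1, is_primitive u u1,
    is_primitive u1 (fun t => Complex k 0 ^+ 2 * u t - f e t) & robin (al e) (be e) (u 0) (u1 0)].
  by move=> e; apply: edge_resolvent => //; exact: L2fun_square_integrable.
have /choice[u1 u1P] := uP.
have L e : square_integrable (u e) by have [] := u1P e.
have L1 e : square_integrable (u1 e) by have [] := u1P e.
pose U := mkL2 L; pose U1 := mkL2 L1; pose U2 := Complex k 0 ^+ 2 *: U - f.
exists (L2_class U), (L2_class U2); split.
  exists U, U1, U2; split=> // [e|]; first by have [] := u1P e.
  by apply/bcE => i; rewrite !mxE; have [] := u1P i.
by rewrite -L2_class_scale -L2_classB /U2 opprB addrC subrK L2_class_repr.
Qed.

(** A symmetric operator T with dense domain such that T + c is surjective for some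
real c is self-adjoint: for (y, z) in the adjoint, take u in the domain with
(T + c) u = z + c y; then y - u is orthogonal to the range of T + c. *)
Lemma self_adjoint_of_real_conditions : self_adjoint ip (opp_op (Delta A B)).
Proof.
split.
  move=> x eps eps0; have [u [w [Duw h]]] := Delta_densely_defined A B x eps0.
  by exists u, (- w); split=> //; exists (u, w).
have [k k0 ak] : exists2 k : R, 0 < k & forall i, al i < k.
  exists (1 + \sum_i `|al i|) => [|i]; first by rewrite ltr_pwDl// sumr_ge0.
  rewrite (bigD1 i)//=; apply: (le_lt_trans (ler_norm _)).
  by rewrite addrCA ltrDl ltr_pwDl// sumr_ge0.
pose c := Complex k 0 ^+ 2.
have conj_c : conjc c = c by apply: complex_ext; rewrite /c expr2 /=; ring.
apply/seteqP; split=> [[_ _] [[x y] Dxy [<- <-]] u w [[v z] Dvz [<- <-]] /=|].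
  by rewrite L2_inner_oppl L2_inner_oppr (Delta_symmetric Dvz Dxy).
move=> [y z] adj.
have [u [w [Duw uwE]]] := Delta_resolvent k0 ak (z + c *: y).
have yu : y - u = 0.
  have [v [v2 [Dv vE]]] := Delta_resolvent k0 ak (y - u).
  apply: hnorm0_eq0; apply/eqP; rewrite -sqrf_eq0 hnorm_Re; apply/eqP.
  suff -> : ip (y - u) (y - u) = 0 by [].
  have /= adjv : ip (- v2) y = ip v z by apply: adj; exists (v, v2).
  have sym := Delta_symmetric Dv Duw.
  have E : c * ip v u - ip v2 u = - ip v2 y + c * ip v y.
    have := congr1 (ip v) uwE.
    by rewrite !(L2_inner_addr, L2_inner_oppr, L2_inner_scaler) conj_c -adjv L2_inner_oppl -sym.
  rewrite -{1}vE !(L2_inner_addr, L2_inner_oppr, L2_inner_addl, L2_inner_oppl, L2_inner_scalel).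
  move: E; rewrite -/c; move: (ip v2 y) (ip v2 u) (ip v y) (ip v u) => p q r s E.
  have -> : c * r + - p + - (c * s + - q) = (- p + c * r) - (c * s - q) by ring.
  by rewrite -E subrr.
exists (u, w) => //=; move/eqP: yu; rewrite subr_eq0 => /eqP yu'.
by rewrite yu'; congr pair; apply: (addIr (c *: u)); rewrite -[in RHS]yu' -uwE addrC.
Qed.

End SelfAdjointReference.

(** * Similarity to the reference operator *)

Section Sufficiency.
Context {R : realType} {d : nat}.
Implicit Types (A B : 'M[R[i]]_d).

(** On S the reference condition u' = u is the Robin condition with coefficients
- 1 and 1, so the operator is self-adjoint and no similarity is needed. *)
Lemma similar_diagonal_real (S : pred 'I_d) (a b : 'I_d -> R) :
  (forall i, ~~ S i -> b i = 1 \/ a i = 1 /\ b i = 0) ->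
  similar_to_self_adjoint L2_inner (opp_op (Delta (bcA S a 1%:M) (bcB S b))).
Proof.
move=> ab; pose al i := if S i then -1 else a i; pose be i := if S i then 1 else b i.
have l : linear (fun x : L2 R d => x) by [].
have bd : bounded_op L2_inner (fun x : L2 R d => x) := (bounded_linear_id).2.
pose I : {linear L2 R d -> L2 R d} := HB.pack (fun x => x) (GRing.isLinear.Build _ _ _ _ _ l).
exists I, I; split=> //.
rewrite (_ : conj_op I _ = opp_op (Delta (bcA S a 1%:M) (bcB S b))); last first.
  apply/seteqP; split=> [_ [[x y] T <-] //|[x y] T]; by exists (x, y).
apply: (@self_adjoint_of_real_conditions _ _ al be) => [i|u u1].
  by rewrite /admissible /al /be; case: ifPn => [_|/ab //]; left.
have m1 : Complex (-1) 0 = -1 :> R[i] by apply: complex_ext => //=; rewrite oppr0.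
rewrite bcP mul1mx; split=> h i; have := h i; rewrite /robin /al /be; case: ifP => // _.
  by move=> ->; rewrite m1 mulN1r -[Complex 1 0]/(1 : R[i]) mul1r addNr.
by rewrite m1 mulN1r -[Complex 1 0]/(1 : R[i]) mul1r addrC => /eqP; rewrite subr_eq0 => /eqP.
Qed.

Lemma similar_sufficient A B :
  quasi_sectorial A B ->
  (forall (m n : nat) (dE : (m + n)%N = d) (F G : 'M[R[i]]_d) (L : 'M[R[i]]_m) (N : 'M[R[i]]_n),
    quasi_Weierstrass A B dE F G L N ->
    (forall l : R[i], eigenvalue L l -> complex.Re l < 0 \/ 0 <= l) /\
    (forall l : R[i], eigenvalue L l -> 0 <= l ->
       algebraic_multiplicity L l = geometric_multiplicity L l)) ->
  similar_to_self_adjoint L2_inner (opp_op (Delta A B)).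
Proof.
move=> qs spec.
have [F [G [S [M [a [b [Fu Gu AE BE [off acc ab]]]]]]]] := quasi_sectorial_canonical qs spec.
rewrite -/(bcA S a M) in AE; rewrite -/(bcB S b) in BE.
apply: (similar_transfer (T' := Delta (bcA S a M) (bcB S b)) (mxopP G).1 (mxopP (invmx G)).1).
- by move=> x; rewrite mxopM mulVmx// mxop1.
- by move=> x; rewrite mxopM mulmxV// mxop1.
- by apply: (Delta_mxop (E := invmx F)); rewrite ?AE ?BE -!mulmxA mulKmx.
- by apply: (Delta_mxop (E := F)); rewrite ?AE ?BE mulmxK.
have [Y [bY K1 K2]] := transmutation_invertible acc.
apply: (similar_transfer (T' := Delta (bcA S a 1%:M) (bcB S b)) bY (transmutation_bounded M) K2 K1).
- exact: Delta_transmutation_inv.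
- exact: Delta_transmutation.
exact: similar_diagonal_real.
Qed.

End Sufficiency.

Theorem theorem5p1 (R : realType) (d : nat) (A B : 'M[R[i]]_d) :
  similar_to_self_adjoint L2_inner (opp_op (Delta A B)) <->
  quasi_sectorial A B /\
  forall (m n : nat) (dE : (m + n)%N = d) (F G : 'M[R[i]]_d)
         (L : 'M[R[i]]_m) (N : 'M[R[i]]_n),
    quasi_Weierstrass A B dE F G L N ->
    (forall l : R[i], eigenvalue L l -> complex.Re l < 0 \/ 0 <= l) /\
    (forall l : R[i], eigenvalue L l -> 0 <= l ->
       algebraic_multiplicity L l = geometric_multiplicity L l).
Proof.
split=> [sim|[qs spec]]; last exact: similar_sufficient.
exact: similar_necessary.
Qed.
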